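(* There exist a probability space $(\Omega,\mu)$, a markovian semigroup on $(\Omega,\mu)$ with negative generator $A$, and a weight $w$ on $\Omega$ with $Q^A_2(w)<\infty$ such that for no $s>0$ does $A$ have a Hörmander $\mathcal H^s$ calculus on $L^2(\Omega,w\,d\mu)$; that is, for no $s>0$ does there exist a constant $C>0$ such that $$\|m(A)\|_{L^2(\Omega,w\,d\mu)\to L^2(\Omega,w\,d\mu)}\le C\bigl(|m(0)|+\|m\|_{\mathcal H^s}\bigr)$$ holds for all $m\in\mathcal H^s$.
   Context: A $c_0$-semigroup $(T_t)_{t\ge0}$ on $L^2(\Omega,\mu)$ is markovian if each $T_t$ is self-adjoint, extends to a contraction on $L^p(\Omega)$ for all $p\in[1,\infty]$, satisfies $T_tf\ge0$ whenever $f\ge0$, and $T_t(1)=1$. Its negative generator $A$ is given by $T_t=\exp(-tA)$. A weight is a measurable $w:\Omega\to(0,\infty)$; $T_t(w):=\lim_nT_t(w1_{w\le n})$, and $Q^A_2(w)=\sup_{t>0}\operatorname{ess\,sup}_{x\in\Omega}T_t(w)(x)T_t(w^{-1})(x)$. For $s>0$, $\mathcal H^s=\{m\in L^1_{\mathrm{loc}}(0,\infty):\|m\|_{\mathcal H^s}=\sup_{t>0}\|\eta\, m(t\,\cdot)\|_{W^\infty_s(\mathbb R)}<\infty\}$, where $\eta\in C_c^\infty(0,\infty)$ is a fixed non-zero function (different choices give equivalent norms) and $W^\infty_s(\mathbb R)$ is the usual Sobolev (Bessel potential) space of order $s$ over $L^\infty(\mathbb R)$. A value $m(0)\in\mathbb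 C$ is prescribed along with $m$, and $m(A)$ is defined by the self-adjoint functional calculus on $L^2(\Omega,\mu)$; the estimate is understood as: $m(A)$ restricted to $L^2(\Omega,\mu)\cap L^2(\Omega,w\,d\mu)$ extends to a bounded operator on $L^2(\Omega,w\,d\mu)$ with the stated bound. *)

(* Defs.v *)
From HB Require Import structures.
From mathcomp Require Import all_boot all_order all_algebra.
From mathcomp Require Import all_classical all_reals all_analysis.
From mathcomp Require Import measurable_realfun ess_sup_inf.
From mathcomp Require Import complex.

Set Implicit Arguments.
Unset Strict Implicit.
Unset Printing Implicit Defensive.

Import Order.TTheory GRing.Theory Num.Theory.
Import numFieldNormedType.Exports.

Local Open Scope classical_set_scope.
Local Open Scope ring_scope.

(* Elements of a complex Lp space are represented by functions, identified up
   to almost everywhere equality; operators are maps on functions that are only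
   constrained on Lp and are compatible with that identification. *)
Section complex_Lp.
Context d (T : measurableType d) (R : realType).
Variable mu : {measure set T -> \bar R}.
Implicit Types (f g : T -> R[i]) (p : \bar R).

Definition cmeasurable f :=
  measurable_fun setT (fun x => complex.Re (f x)) /\
  measurable_fun setT (fun x => complex.Im (f x)).

Definition cLnorm p f : \bar R :=
  Lnorm mu p (fun x => (Normc.normc (f x))%:E).

Definition in_Lp p f := cmeasurable f /\ (cLnorm p f < +oo)%E.

Definition cintegral f : R[i] :=
  Complex (Rintegral mu setT (fun x => complex.Re (f x)))
          (Rintegral mu setT (fun x => complex.Im (f x))).

Definition cdot f g : R[i] := cintegral (fun x => f x * conjc (g x)).

Definition Lp_bounded_by p (S : (T -> R[i]) -> T -> R[i]) (K : \bar R) :=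
  [/\ forall f, in_Lp p f -> in_Lp p (S f),
      forall f g, in_Lp p f -> in_Lp p g ->
        f = g %[ae mu] -> S f = S g %[ae mu],
      forall (a : R[i]) f g, in_Lp p f -> in_Lp p g ->
        S (fun x => a * f x + g x) = (fun x => a * S f x + S g x) %[ae mu] &
      forall f, in_Lp p f -> (cLnorm p (S f) <= K * cLnorm p f)%E].

Definition L2_selfadjoint (S : (T -> R[i]) -> T -> R[i]) :=
  forall f g, in_Lp 2%:E f -> in_Lp 2%:E g -> cdot (S f) g = cdot f (S g).

End complex_Lp.

Section markovian_semigroups.
Context d (T : measurableType d) (R : realType).
Variable mu : {measure set T -> \bar R}.
Implicit Types (f g : T -> R[i]) (S : R -> (T -> R[i]) -> T -> R[i]).

Definition c0_semigroup S :=
  [/\ forall t, 0 <= t -> exists K : R, Lp_bounded_by mu 2%:E (S t) K%:E,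
      forall f, in_Lp mu 2%:E f -> S 0 f = f %[ae mu],
      forall s t f, 0 <= s -> 0 <= t -> in_Lp mu 2%:E f ->
        S (s + t) f = S s (S t f) %[ae mu] &
      forall f, in_Lp mu 2%:E f ->
        cLnorm mu 2%:E (fun x => S t f x - f x) @[t --> (0 : R)^'+] --> 0%E].

Definition markovian S :=
  c0_semigroup S /\
  forall t, 0 <= t ->
  [/\ L2_selfadjoint mu (S t),
      forall p : \bar R, (1 <= p)%E ->
        exists2 Sp, Lp_bounded_by mu p Sp 1%E &
          forall f, in_Lp mu 2%:E f -> in_Lp mu p f -> Sp f = S t f %[ae mu],
      (* [0 <= z] in [R[i]] means that [z] is real and nonnegative *)
      forall f, in_Lp mu 2%:E f ->
        (\forall x \ae mu, 0 <= f x) -> \forall x \ae mu, 0 <= S t f x &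
      S t (cst 1) = cst 1 %[ae mu]].

(* graph of the negative generator: [f] is in its domain and is mapped to [g] *)
Definition neg_generator S f g :=
  [/\ in_Lp mu 2%:E f, in_Lp mu 2%:E g &
      cLnorm mu 2%:E (fun x => (t^-1)%:C%C * (f x - S t f x) - g x)
        @[t --> (0 : R)^'+] --> 0%E].

End markovian_semigroups.

Section self_adjoint_calculus.
Context d (T : measurableType d) (R : realType).
Variable mu : {measure set T -> \bar R}.
Implicit Types (f g : T -> R[i]) (E : set R -> (T -> R[i]) -> T -> R[i]).

Definition scalar_spectral_measure E f (nu : {measure set R -> \bar R}) :=
  forall B, measurable B -> nu B = (complex.Re (cdot mu (E B f) f))%:E.

Definition projection_valued_measure E :=
  [/\ forall B, measurable B ->
        Lp_bounded_by mu 2%:E (E B) 1%E /\ L2_selfadjoint mu (E B),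
      forall f, in_Lp mu 2%:E f -> E setT f = f %[ae mu],
      forall B C f, measurable B -> measurable C -> in_Lp mu 2%:E f ->
        E (B `&` C) f = E B (E C f) %[ae mu] &
      forall f, in_Lp mu 2%:E f -> exists nu, scalar_spectral_measure E f nu].

(* [A] is the (graph of the) self-adjoint operator \int \lambda dE(\lambda) *)
Definition spectral_resolution (A : (T -> R[i]) -> (T -> R[i]) -> Prop) E :=
  projection_valued_measure E /\
  forall f nu, in_Lp mu 2%:E f -> scalar_spectral_measure E f nu ->
    ((exists g, A f g) <-> (\int[nu]_l (l ^+ 2)%:E < +oo)%E) /\
    (forall g, A f g -> cdot mu g f = cintegral nu (fun l => l%:C%C)).

(* [M] is the bounded operator m(A) = \int m dE; on a complex Hilbert space it
   is determined by its quadratic form <M f, f> = \int m d<E f, f> *)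
Definition functional_calculus E (m : R -> R[i])
    (M : (T -> R[i]) -> T -> R[i]) :=
  (exists K : R, Lp_bounded_by mu 2%:E M K%:E) /\
  forall f nu, in_Lp mu 2%:E f -> scalar_spectral_measure E f nu ->
    cdot mu (M f) f = cintegral nu m.

End self_adjoint_calculus.

Record weight d (T : measurableType d) (R : realType) := Weight {
  weight_fun :> T -> R;
  measurable_weight : measurable_fun setT weight_fun;
  weight_gt0 : forall x, 0 < weight_fun x }.

Section weighted_measure.
Context d (T : measurableType d) (R : realType).
Variables (mu : {measure set T -> \bar R}) (w : weight T R).

Definition weighted_measure (B : set T) : \bar R :=
  (\int[mu]_(x in B) (w x)%:E)%E.

Let weighted_measure0 : weighted_measure set0 = 0%E.
Proof. by rewrite /weighted_measure integral_set0. Qed.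

Let weighted_measure_ge0 B : (0 <= weighted_measure B)%E.
Proof. by apply: integral_ge0 => x _; rewrite lee_fin ltW// weight_gt0. Qed.

Let weighted_measure_sigma_additive : semi_sigma_additive weighted_measure.
Proof.
move=> /= F mF tF mUF; rewrite /weighted_measure ge0_integral_bigcup//=.
- apply: is_cvg_ereal_nneg_natsum_cond => n _ _.
  exact: weighted_measure_ge0.
- by apply/measurable_EFinP/measurable_funTS; exact: measurable_weight.
- by move=> x _; rewrite lee_fin ltW// weight_gt0.
Qed.

HB.instance Definition _ := isMeasure.Build _ _ _ weighted_measure
  weighted_measure0 weighted_measure_ge0 weighted_measure_sigma_additive.

End weighted_measure.

Section Q2_characteristic.
Context d (T : measurableType d) (R : realType).
Variable mu : {measure set T -> \bar R}.
Implicit Types (v : T -> R) (S : R -> (T -> R[i]) -> T -> R[i]).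

Definition truncation v (n : nat) : T -> R[i] :=
  fun x => if v x <= n%:R then (v x)%:C%C else 0.

(* For a positive operator, the sequence below is nondecreasing almost
   everywhere, so that the limit exists in [0, +oo] almost everywhere. *)
Definition extended_action (S : (T -> R[i]) -> T -> R[i]) v : T -> \bar R :=
  fun x => limn (fun n => (complex.Re (S (truncation v n) x))%:E).

Definition Q2_characteristic S (w : weight T R) : \bar R :=
  ereal_sup [set ess_sup mu (fun x => extended_action (S t) w x *
                 extended_action (S t) (fun y => (w y)^-1)%R x)%E
            | t in [set t : R | 0 < t]].

End Q2_characteristic.

Section hormander_classes.
Context {R : realType}.
Notation lebesgue := (@lebesgue_measure R).
Implicit Types (f g m eta : R -> R[i]) (s : R).

(* Kernel of the Bessel potential (1 - d^2/dx^2)^(-s/2) on the real line: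
   Gamma(s/2)^-1 \int_0^oo t^(s/2 - 1) e^(-t) h_t dt, where
   h_t(x) = (4 pi t)^(-1/2) e^(-x^2/(4t)) is the heat kernel. *)
Definition bessel_kernel s (x : R) : R :=
  (Rintegral lebesgue `]0, +oo[
    (fun t => powR t (s / 2 - 1) * expR (- t)))^-1 *
  Rintegral lebesgue `]0, +oo[
    (fun t => powR t (s / 2 - 1) * expR (- t) *
              ((Num.sqrt (4 * pi * t))^-1 * expR (- (x ^+ 2 / (4 * t))))).

Definition bessel_potential s g : R -> R[i] :=
  fun x => cintegral lebesgue (fun y => (bessel_kernel s (x - y))%:C%C * g y).

(* W^oo_s is the range of the (injective) Bessel potential on L^oo, and the
   norm of [f] is the L^oo norm of its preimage; it is +oo when [f] is not in
   W^oo_s, as the infimum of the empty set. *)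
Definition sobolev_Loo_norm s f : \bar R :=
  ereal_inf [set cLnorm lebesgue +oo%E g | g in
    [set g | in_Lp lebesgue +oo%E g /\ f = bessel_potential s g %[ae lebesgue]]].

Definition smooth (f : R -> R) := forall n x, derivable (derive1n n f) x 1.

(* nonzero elements of C_c^oo(0, +oo), extended by zero to R *)
Definition cutoff eta :=
  [/\ smooth (fun x => complex.Re (eta x)),
      smooth (fun x => complex.Im (eta x)),
      exists a b : R, 0 < a /\ (forall x, x \notin `[a, b] -> eta x = 0) &
      exists x, eta x != 0].

Definition hormander_norm eta s m : \bar R :=
  ereal_sup [set sobolev_Loo_norm s (fun x => eta x * m (t * x))
            | t in [set t : R | 0 < t]].

Definition hormander_class eta s m :=
  [/\ locally_integrable `]0, +oo[ (fun x => complex.Re (m x)),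
      locally_integrable `]0, +oo[ (fun x => complex.Im (m x)) &
      (hormander_norm eta s m < +oo)%E].

(* Elements of the Hoermander class are equivalence classes, but m(A) depends
   on the values of [m] at the eigenvalues of [A]. For s > 0, every element has
   a unique continuous representative on (0, +oo), which is the one to use. *)
Definition continuous_representative m mc :=
  [/\ m = mc %[ae lebesgue in `]0, +oo[%classic],
      {in `]0, +oo[, continuous (fun x => complex.Re (mc x))} &
      {in `]0, +oo[, continuous (fun x => complex.Im (mc x))}].

(* The values at negative numbers are irrelevant for m(A) since A >= 0. *)
Definition multiplier (m0 : R[i]) m : R -> R[i] :=
  fun l => if 0 < l then m l else m0.

End hormander_classes.

Section hormander_calculus.
Context d (T : measurableType d) (R : realType).
Variable mu : {measure set T -> \bar R}.

(* [M], restricted to L2(mu) and L2(w mu), extends to a bounded operator on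
   L2(w mu) of norm at most [K] *)
Definition extends_to_weighted_L2 (w : weight T R)
    (M : (T -> R[i]) -> T -> R[i]) (K : \bar R) :=
  exists2 S, Lp_bounded_by (weighted_measure mu w) 2%:E S K &
    forall f, in_Lp mu 2%:E f -> in_Lp (weighted_measure mu w) 2%:E f ->
      S f = M f %[ae mu].

Definition hormander_calculus (E : set R -> (T -> R[i]) -> T -> R[i])
    (w : weight T R) (eta : R -> R[i]) (s : R) :=
  exists2 C : R, 0 < C &
    forall (m0 : R[i]) (m mc : R -> R[i]) (M : (T -> R[i]) -> T -> R[i]),
      hormander_class eta s m -> continuous_representative m mc ->
      functional_calculus mu E (multiplier m0 mc) M ->
      extends_to_weighted_L2 w M
        (C%:E * ((Normc.normc m0)%:E + hormander_norm eta s m))%E.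

End hormander_calculus.

(* Main.v *)
(* Take a disjoint union of hypercubes of dimensions 4n^2 with the heat semigroup
   generated by the Walsh number operator A, and on the n-th cube the product
   weight w(x) = prod_i (1 + eps x_i) with eps = 1/(4n). Then Q_2 is at most
   (1 - eps^2)^(-4n^2) <= 4/3. On the other hand e^(i pi A) is the reflection
   f(x) -> f(-x), which takes the density (1 - eps)^(4n^2) at the antipode to
   (1 + eps)^(4n^2), so that its norm on L^2(w) is at least 2^n on the n-th cube.
   The multiplier e^(-l/(4n^2)) cos(pi l) is close enough to it for a lower bound
   2^n / e to persist, while its Hoermander norm of order s is only polynomial
   in n. To bound this norm, let G_s be the Bessel kernel: since
   G_s * G_(2k-s) = G_(2k), and G_2 inverts 1 - d^2/dx^2, a smooth compactly
   supported F is the Bessel potential of order s of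
   G_(2k-s) * (1 - d^2/dx^2)^k F. *)
Require Import Defs.
From HB Require Import structures.
From mathcomp Require Import all_boot all_order all_algebra.
From mathcomp Require Import all_classical all_reals all_analysis.
From mathcomp Require Import measurable_realfun ess_sup_inf.
From mathcomp Require Import complex.
From mathcomp Require Import ring lra.

Set Implicit Arguments.
Unset Strict Implicit.
Unset Printing Implicit Defensive.

Import Order.TTheory GRing.Theory Num.Theory.
Import numFieldNormedType.Exports.
Local Open Scope classical_set_scope.
Local Open Scope ring_scope.

(** * Gamma and beta integrals, the heat kernel and the Bessel kernel *)

(** The parameters separate two scales. In dimension N, Q_2 is governed by N eps^2, whereas the norm
    of the reflection is governed by N eps; the choice N = 4n^2, eps = 1/(4n) keeps the former at
    1/4 and makes the latter equal to n. Blocks do not interact, so a single union, made a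
    probability space by the masses 2^-(n+1), defeats every order s at once. The damping is needed
    because the dilates of e^(i pi l) oscillate at the unbounded frequencies pi t; it limits the
    effective frequencies to the order of N, and on the spectrum {0, ..., N} of the cube it costs a
    factor at most e. On integers cos(pi l) agrees with e^(i pi l), so all operators can be taken
    real. The Sobolev norm is defined through the kernel of the Bessel potential, hence a bound
    requires an explicit bounded preimage; the identities between kernels are derived from heat
    kernels and the Beta integral, without the Fourier transform. *)

Section scaling.
Context {R : realType}.
Notation lebesgue := (@lebesgue_measure R).

(** Lebesgue measure is [c] times its image under x -> c x: the two agree on half-open intervals,
    hence on all measurable sets. *)
Lemma ge0_integral_scale (c : R) (f : R -> \bar R) : 0 < c ->
  measurable_fun setT f -> (forall x, 0 <= f x)%E ->
  (\int[lebesgue]_x f x = c%:E * \int[lebesgue]_x f (c * x)%R)%E.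
Proof.
move=> c0 mf f0; pose k : {nonneg R} := NngNum (ltW c0).
pose phi (x : R) : measurableTypeR R := c * x.
have mphi : measurable_fun setT phi by exact: mulrl_measurable.
pose m : {measure set (measurableTypeR R) -> \bar R} :=
  mscale k (pushforward lebesgue phi).
have mE A : measurable A -> lebesgue A = m mphi A.
  apply: lebesgue_measure_unique => //= _ [[a b] _ <-].
  have cE : phi @^-1` `]a, b] = `]a / c, b / c]%classic.
    by apply/seteqP; split => x /=; rewrite !in_itv/= ltr_pdivrMr// ler_pdivlMr// (mulrC x).
  have -> : m mphi `]a, b]%classic = (c%:E * lebesgue `](a / c)%R, (b / c)%R]%classic)%E.
    by rewrite -cE.
  rewrite !lebesgue_measure_itv/= !lte_fin ltr_pM2r ?invr_gt0//.
  case: ifPn => _; last by rewrite mule0.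
  by rewrite -!EFinD -EFinM; congr (_%:E); field; rewrite gt_eqF.
have -> : (\int[lebesgue]_x f x = \int[m mphi]_x f x)%E.
  by apply: eq_measure_integral => A mA _; exact: mE.
rewrite ge0_integral_mscale//; congr (_ * _)%E.
by rewrite ge0_integral_pushforward.
Qed.

End scaling.

Section gamma.
Context {R : realType}.
Notation lebesgue := (@lebesgue_measure R).
Implicit Types a b t x : R.

(** Extending the Gamma integrand by zero lets every integral run over the whole line, where scaling
    and Tonelli apply directly. *)
Definition gamma_fun a t : R :=
  \1_(`]0, +oo[%classic : set R) t * (powR t (a - 1) * expR (- t)).

Lemma gamma_fun_ge0 a t : 0 <= gamma_fun a t.
Proof. by rewrite /gamma_fun !mulr_ge0 ?powR_ge0 ?expR_ge0. Qed.

Lemma measurable_gamma_fun a : measurable_fun setT (gamma_fun a).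
Proof.
apply: measurable_funM; first exact: measurable_indic.
apply: measurable_funM; first exact: measurable_powR.
by apply: measurableT_comp => //; exact: measurableT_comp.
Qed.

Definition egamma a : \bar R := (\int[lebesgue]_t (gamma_fun a t)%:E)%E.

Lemma egamma_ge0 a : (0 <= egamma a)%E.
Proof. by apply: integral_ge0 => t _; rewrite lee_fin gamma_fun_ge0. Qed.

Lemma indic_oy t : 0 < t -> \1_(`]0, +oo[%classic : set R) t = 1 :> R.
Proof. by move=> t0; rewrite indicE mem_set//= in_itv/= t0. Qed.

Lemma indic_oyN t : t <= 0 -> \1_(`]0, +oo[%classic : set R) t = 0 :> R.
Proof.
by move=> t0; rewrite indicE memNset//= in_itv/= andbT; apply/negP; rewrite -leNgt.
Qed.

Lemma egamma_gt0 a : (0 < egamma a)%E.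
Proof.
rewrite lt_neqAle egamma_ge0 andbT eq_sym; apply/eqP => g0.
have mg : measurable_fun setT (EFin \o gamma_fun a).
  by apply/measurable_EFinP; exact: measurable_gamma_fun.
have [+ _] := @ae_eq_integral_abs _ _ _ lebesgue _ measurableT _ mg.
under eq_integral do rewrite /= ger0_norm ?gamma_fun_ge0//.
move=> /(_ g0) [N [mN N0 sub]].
have : (lebesgue `[1%R, 2%R]%classic <= lebesgue N)%E.
  apply: le_measure; rewrite ?inE//.
  move=> t /= /[!in_itv]/= /andP[t1 t2]; apply: sub => /= /(_ I) [].
  have t0 : 0 < t by rewrite (lt_le_trans _ t1).
  rewrite /gamma_fun indic_oy// mul1r => /eqP.
  by rewrite gt_eqF// mulr_gt0 ?powR_gt0 ?expR_gt0.
rewrite N0 lebesgue_measure_itv/= lte_fin ltr1n -EFinD lee_fin.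
by rewrite leNgt subr_gt0 ltr1n.
Qed.

Lemma continuous_powRl (u b : R) : 0 < u -> {for u, continuous (@powR R ^~ b)}.
Proof.
move=> u0; apply: differentiable_continuous; apply/derivable1_diffP.
by apply: derivable_powR; rewrite in_itv/= u0.
Qed.

(** The half-line is exhausted by the rays [1/(n+1), +oo[; monotone convergence passes to the limit
    in the fundamental theorem on each ray. *)
Lemma ge0_FTC2_oy (f F : R -> R) (l l0 : R) :
  (forall x, 0 < x -> 0 <= f x) ->
  (forall x, 0 < x -> {for x, continuous f}) ->
  (forall x : R, 0 < x -> is_derive x 1 F (f x)) ->
  F x @[x --> +oo] --> l -> F x @[x --> (0:R)^'+] --> l0 ->
  (\int[lebesgue]_(x in `]0%R, +oo[) (f x)%:E = (l - l0)%:E)%E.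
Proof.
move=> f0 cf dF Fl Fl0.
pose e n : R := n.+1%:R^-1.
have e0 n : 0 < e n by rewrite invr_gt0.
have mf : measurable_fun (`]0, +oo[%classic : set R) f.
  apply: open_continuous_measurable_fun; first exact: interval_open.
  by move=> x; rewrite inE/= in_itv/= andbT => /cf.
have UE : \bigcup_n `[e n, +oo[%classic = `]0, +oo[%classic :> set R.
  apply/seteqP; split => x /=.
    by move=> [n _]; rewrite /= !in_itv/= !andbT; exact: lt_le_trans.
  rewrite in_itv/= andbT => x0.
  exists (Num.truncn x^-1) => //=; rewrite in_itv/= andbT /e.
  rewrite -[leRHS]invrK lef_pV2 ?posrE ?invr_gt0//.
  by apply: ltW; rewrite truncnS_gt.
have : (\int[lebesgue]_(x in `[e i, +oo[) (f x)%:E)%E @[i --> \oo] -->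
   (\int[lebesgue]_(x in \bigcup_i `[e i, +oo[%classic) (f x)%:E)%E.
  apply: ge0_nondecreasing_set_cvg_integral => //=.
  - apply/nondecreasing_seqP => n; rewrite subsetEset => x /=.
    rewrite !in_itv/= !andbT; apply: le_trans.
    by rewrite /e lef_pV2 ?posrE// ler_nat.
  - move=> i; apply/measurable_EFinP; apply: measurable_funS mf => //.
    by move=> x /=; rewrite !in_itv/= !andbT; exact: lt_le_trans.
  - move=> i x /andP[ex _].
    by rewrite lee_fin f0// (lt_le_trans (e0 i)).
rewrite UE; move/cvg_lim => <- //; apply/cvg_lim => //.
have -> : (fun i => \int[lebesgue]_(x in `[e i, +oo[) (f x)%:E)%E = 
  (fun i => (l - F (e i))%:E).
  apply/funext => i; rewrite (@ge0_continuous_FTC2y _ f F (e i) l)//.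
  - by move=> x ex; rewrite f0// (lt_le_trans (e0 i)).
  - apply: continuous_in_subspaceT => x; rewrite inE/= in_itv/= andbT => ex.
    by apply: cf; rewrite (lt_le_trans (e0 i)).
  - by move=> x ex; have [] := dF x (lt_trans (e0 i) ex).
  - apply: cvg_at_right_filter; have [dFi _] := dF _ (e0 i).
    by apply: differentiable_continuous; apply/derivable1_diffP.
  - move=> x; rewrite in_itv/= andbT => ex.
    by rewrite derive1E; have [_] := dF x (lt_trans (e0 i) ex).
apply: cvg_EFin; first exact: nearW.
apply: cvgB; first exact: cvg_cst.
move/cvg_at_rightP : Fl0; apply; split=> //.
by apply: (@cvg_harmonic R).
Qed.

(** The integrand is dominated by a multiple of t^(a-1) (1+t)^-(a+1), which has the bounded
    antiderivative (t/(1+t))^a / a. *)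
Lemma egamma_lty a : 0 < a -> (egamma a < +oo)%E.
Proof.
move=> a0.
(* This is u <= e^u at u = (1 + t)/(a + 1), raised to the power a + 1. *)
have [C [C0 hC]] : exists C, 0 < C /\ forall t, 0 < t ->
   expR (- t) <= C * powR (1 + t) (- (a + 1)).
  exists (expR 1 * powR (a + 1) (a + 1)); split.
    by rewrite mulr_gt0 ?expR_gt0 ?powR_gt0// addr_gt0.
  move=> t t0.
  have a10 : 0 < a + 1 by rewrite addr_gt0.
  have t10 : 0 < 1 + t by rewrite addr_gt0.
  rewrite powRN -ler_pdivrMr ?invr_gt0 ?powR_gt0// invrK.
  have -> : powR (1 + t) (a + 1) = powR (a + 1) (a + 1) * powR ((1 + t) / (a + 1)) (a + 1).
    by rewrite -powRM ?ltW ?divr_gt0//; congr powR; field; rewrite gt_eqF.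
  rewrite mulrCA (mulrC (expR 1)) ler_pM2l ?powR_gt0//.
  have : powR ((1 + t) / (a + 1)) (a + 1) <= expR (1 + t).
    have -> : 1 + t = ((1 + t) / (a + 1)) * (a + 1).
      by field; rewrite gt_eqF.
    rewrite expRM.
    have -> : (1 + t) / (a + 1) * (a + 1) / (a + 1) = (1 + t) / (a + 1).
      by field; rewrite gt_eqF.
    apply: ge0_ler_powR; rewrite ?nnegrE ?expR_ge0 ?ltW ?divr_gt0//.
    by rewrite (lt_le_trans _ (expR_ge1Dx _))// ltrDr.
  move=> h; apply: (le_trans (ler_wpM2l (expR_ge0 (- t)) h)).
  by rewrite -expRD addrCA addNr addr0.
pose F (t : R) := powR t a * powR (1 + t) (- a).
pose f (t : R) := a * (powR t (a - 1) * powR (1 + t) (- (a + 1))).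
have dF t : 0 < t -> is_derive t 1 F (f t).
  move=> t0; have t10 : 0 < 1 + t by rewrite addr_gt0.
  rewrite /F.
  have d1 := is_derive1_powR a t0.
  have d2 : is_derive t 1 (fun t => powR (1 + t) (- a)) (- a * powR (1 + t) (- a - 1)).
    have := @is_derive1_comp _ (@powR R ^~ (- a)) (fun t => 1 + t) t _ 1.
    move=> /(_ _ (is_derive1_powR (- a) t10)); rewrite mulr1; apply.
    by have := is_deriveD (is_derive_cst (1 : R) t 1) (is_derive_id t 1); rewrite add0r.
  have -> : f t = powR t a * (- a * powR (1 + t) (- a - 1)) +
      powR (1 + t) (- a) * (a * powR t (a - 1)); last exact: (is_deriveM d1 d2).
  rewrite /f.
  have -> : powR t a = t * powR t (a - 1).
    by rewrite -{2}(powRr1 (ltW t0)) -powRD ?(gt_eqF t0) ?implybT//; congr powR; ring.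
  have -> : powR (1 + t) (- a) = (1 + t) * powR (1 + t) (- a - 1).
    by rewrite -{2}(powRr1 (ltW t10)) -powRD ?(gt_eqF t10) ?implybT//; congr powR; ring.
  have -> : - (a + 1) = - a - 1 by ring.
  ring.
have cf t : 0 < t -> {for t, continuous f}.
  move=> t0; have t10 : 0 < 1 + t by rewrite addr_gt0.
  apply: cvgM; first exact: cvg_cst.
  apply: cvgM; first exact: continuous_powRl.
  apply: (@continuous_comp _ _ _ (fun t => 1 + t) (@powR R ^~ (- (a + 1)))).
    by apply: cvgD; [exact: cvg_cst|exact: cvg_id].
  exact: continuous_powRl.
have f0 t : 0 < t -> 0 <= f t.
  by move=> t0; rewrite /f !mulr_ge0 ?powR_ge0 ?ltW.
have Fl0 : F t @[t --> (0:R)^'+] --> (0 : R).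
  rewrite /F -[X in _ --> X](mul0r (powR (1 + 0) (- a))).
  apply: cvgM; first exact: powR_cvg0.
  apply: cvg_at_right_filter.
  apply: (@continuous_comp _ _ _ (fun t => 1 + t) (@powR R ^~ (- a))).
    by apply: cvgD; [exact: cvg_cst|exact: cvg_id].
  by apply: continuous_powRl; rewrite addr0.
have Fl : F t @[t --> +oo] --> (1 : R).
  have : powR (1 - (1 + t)^-1) a @[t --> +oo] --> powR (1 - 0) a.
    apply: (cvg_comp (fun t : R => 1 - (1 + t)^-1) (@powR R ^~ a)).
      apply: cvgB; first exact: cvg_cst.
      apply/gtr0_cvgV0; last exact: cvg_addrl.
      by near=> t; rewrite addr_gt0//; near: t; exact: nbhs_pinfty_gt.
    by apply: continuous_powRl; rewrite subr0.
  rewrite subr0 powR1; apply: cvg_trans; apply: near_eq_cvg; near=> t.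
  have t0 : 0 < t by near: t; exact: nbhs_pinfty_gt.
  have t10 : 0 < 1 + t by rewrite addr_gt0.
  have -> : 1 - (1 + t)^-1 = t * (1 + t)^-1 by field; rewrite gt_eqF.
  by rewrite powRM ?invr_ge0 ?ltW// /F powRN -powR_inv1 ?ltW// -powRrM mulN1r powRN.
have := ge0_FTC2_oy f0 cf dF Fl Fl0; rewrite subr0 => H.
have mg : measurable_fun setT (EFin \o gamma_fun a).
  by apply/measurable_EFinP; exact: measurable_gamma_fun.
apply: (@le_lt_trans _ _ (\int[lebesgue]_(x in `]0%R, +oo[) ((C / a)%:E * (f x)%:E))%E); last first.
  rewrite ge0_integralZl_EFin//.
  - by rewrite H mule1 ltry.
  - by move=> x /=; rewrite in_itv/= andbT lee_fin => /f0.
  - apply/measurable_EFinP; apply: open_continuous_measurable_fun; first exact: interval_open.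
    by move=> x; rewrite inE/= in_itv/= andbT => /cf.
  - by rewrite divr_ge0// ltW.
rewrite /egamma [leRHS]integral_mkcond; apply: ge0_le_integral => //.
- by move=> x _; rewrite lee_fin gamma_fun_ge0.
- apply/(measurable_restrictT _ _).1 => //; apply: measurable_funeM.
  apply/measurable_EFinP; apply: open_continuous_measurable_fun; first exact: interval_open.
  by move=> x; rewrite inE/= in_itv/= andbT => /cf.
move=> x _; rewrite patchE; case: ifPn => [|/negP].
  rewrite inE/= in_itv/= andbT => x0; rewrite -EFinM lee_fin /gamma_fun indic_oy// mul1r.
  have -> : C / a * f x = powR x (a - 1) * (C * powR (1 + x) (- (a + 1))).
    by rewrite /f; field; rewrite gt_eqF.
  by rewrite ler_wpM2l ?powR_ge0 ?hC.
by rewrite inE/= in_itv/= andbT => /negP; rewrite -leNgt => x0; rewrite /gamma_fun indic_oyN// mul0r.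
Unshelve. all: by end_near. Qed.

End gamma.

(** * Heat kernel, Beta integral and the convolution law of Bessel kernels *)

Section heat.
Context {R : realType}.
Notation lebesgue := (@lebesgue_measure R).
Implicit Types a b t u x y z : R.

Definition heat t x : R := (Num.sqrt (4 * pi * t))^-1 * expR (- (x ^+ 2 / (4 * t))).

Lemma heat_ge0 t x : 0 <= heat t x.
Proof. by rewrite /heat mulr_ge0 ?invr_ge0 ?sqrtr_ge0 ?expR_ge0. Qed.

Lemma heatN t x : heat t (- x) = heat t x.
Proof. by rewrite /heat sqrrN. Qed.

Lemma heat_normal t x y : 0 < t -> heat t (x - y) = normal_pdf x (Num.sqrt (2 * t)) y.
Proof.
move=> t0; have s0 : Num.sqrt (2 * t) != 0 by rewrite gt_eqF// sqrtr_gt0 mulr_gt0.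
rewrite normal_pdfE// /normal_peak /normal_fun /heat sqr_sqrtr ?mulr_ge0 ?ltW//.
congr ((Num.sqrt _)^-1 * expR _); first by rewrite mulr2n; ring.
by rewrite -mulr_natr; field; rewrite gt_eqF.
Qed.

Lemma integral_heat t x : 0 < t -> (\int[lebesgue]_y (heat t (x - y))%:E = 1)%E.
Proof.
move=> t0; under eq_integral do rewrite heat_normal//.
exact: integral_normal_pdf.
Qed.

(* completing the square in the exponent *)
Lemma heatM t u x y z : 0 < t -> 0 < u ->
  heat t (x - y) * heat u (y - z) =
  heat (t + u) (x - z) * heat (t * u / (t + u)) ((u * x + t * z) / (t + u) - y).
Proof.
move=> t0 u0; have tu0 : 0 < t + u by rewrite addr_gt0.
have p0 := pi_gt0 R.
rewrite /heat mulrACA [RHS]mulrACA -!expRD -!invfM -!sqrtrM ?mulr_ge0 ?pi_ge0 ?ltW//.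
congr ((Num.sqrt _)^-1 * expR _); first by field; rewrite gt_eqF.
by field; rewrite !gt_eqF.
Qed.

Lemma integral_heatM t u x z : 0 < t -> 0 < u ->
  (\int[lebesgue]_y (heat t (x - y) * heat u (y - z))%:E = (heat (t + u) (x - z))%:E)%E.
Proof.
move=> t0 u0; have tu0 : 0 < t + u by rewrite addr_gt0.
under eq_integral do rewrite heatM// EFinM.
rewrite ge0_integralZl_EFin//.
- by rewrite integral_heat ?mule1// divr_gt0// mulr_gt0.
- by move=> y _; rewrite lee_fin heat_ge0.
- apply/measurable_EFinP; under eq_fun do rewrite heat_normal ?divr_gt0 ?mulr_gt0//.
  exact: measurable_normal_pdf.
- exact: heat_ge0.
Qed.

Lemma lebesgue_tonelli (f : R -> R -> \bar R) :
  measurable_fun setT (fun p : R * R => f p.1 p.2) ->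
  (forall x y, 0 <= f x y)%E ->
  (\int[lebesgue]_x \int[lebesgue]_y f x y =
   \int[lebesgue]_y \int[lebesgue]_x f x y)%E.
Proof.
by move=> mf f0; exact: (@fubini_tonelli _ _ _ _ _ lebesgue lebesgue
  (fun p => f p.1 p.2) mf (fun p => f0 p.1 p.2)).
Qed.

Definition heat_gamma a t x := gamma_fun a t * heat t x.

Lemma heat_gamma_ge0 a t x : 0 <= heat_gamma a t x.
Proof. by rewrite mulr_ge0 ?gamma_fun_ge0 ?heat_ge0. Qed.

Lemma measurable_heat_gamma a d (T : measurableType d) (f g : T -> R) :
  measurable_fun setT f -> measurable_fun setT g ->
  measurable_fun setT (fun p => heat_gamma a (f p) (g p)).
Proof.
move=> mf mg.
(* For positive times the square root and the quotient are real powers, which are measurable; for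
   the other times the indicator annihilates both sides. *)
have -> : (fun p => heat_gamma a (f p) (g p)) = fun p => gamma_fun a (f p) *
    (powR (4 * pi * f p) (- 2^-1) * expR (- (g p ^+ 2 * powR (4 * f p) (-1)))).
  apply/funext => p; rewrite /heat_gamma /heat; have [f0|f0] := ltP 0 (f p).
    by rewrite powRN powR12_sqrt ?powR_inv1 ?mulr_ge0 ?pi_ge0 ?ltW.
  by rewrite /gamma_fun indic_oyN// !mul0r.
apply: measurable_funM; first by apply: measurableT_comp mf; exact: measurable_gamma_fun.
apply: measurable_funM.
  apply: (measurableT_comp (measurable_powR _)).
  by apply: measurable_funM.
apply: measurableT_comp => //; apply: measurableT_comp => //.
apply: measurable_funM; first exact: measurable_funX.
apply: (measurableT_comp (measurable_powR _)).
by apply: measurable_funM.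
Qed.

(** Gamma(a) times the Bessel kernel of order 2a, that is, of (1 - d^2/dx^2)^(-a). The value is
    extended real because it is infinite at x = 0 when a <= 1/2. *)
Definition bessel_int a x : \bar R := (\int[lebesgue]_t (heat_gamma a t x)%:E)%E.

Lemma bessel_int_ge0 a x : (0 <= bessel_int a x)%E.
Proof. by apply: integral_ge0 => t _; rewrite lee_fin heat_gamma_ge0. Qed.

Lemma measurable_bessel_int a : measurable_fun setT (bessel_int a).
Proof.
apply: (@measurable_fun_fubini_tonelli_F _ _ _ _ _ lebesgue
  (fun p : R * R => (heat_gamma a p.2 p.1)%:E)).
- apply/measurable_EFinP; apply: measurable_heat_gamma.
    exact: measurable_snd.
  exact: measurable_fst.
- by move=> p; rewrite lee_fin heat_gamma_ge0.
Qed.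

Lemma integral_bessel_int a x : (\int[lebesgue]_y bessel_int a (x - y) = egamma a)%E.
Proof.
rewrite /bessel_int lebesgue_tonelli; last 2 first.
- apply/measurable_EFinP; apply: measurable_heat_gamma.
    exact: measurable_snd.
  by apply: measurable_funB => //; exact: measurable_fst.
- by move=> p q; rewrite lee_fin heat_gamma_ge0.
apply: eq_integral => t _; have [t0|t0] := ltP 0 t; last first.
  by rewrite /heat_gamma /gamma_fun indic_oyN// !mul0r; under eq_integral do rewrite mul0r; rewrite integral0.
under eq_integral do rewrite EFinM.
rewrite ge0_integralZl_EFin ?integral_heat ?mule1 ?gamma_fun_ge0//.
- by move=> y _; rewrite lee_fin heat_ge0.
- apply/measurable_EFinP; under eq_fun do rewrite heat_normal//.
  exact: measurable_normal_pdf.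
Qed.

(** The Beta function B(a, b) in its form on the half-line. *)
Definition beta_int a b : \bar R := (\int[lebesgue]_v (\1_(`]0, +oo[%classic : set R) v *
  (powR v (b - 1) * powR (1 + v) (- (a + b))))%:E)%E.

(* the substitutions u = t v and then s = t (1 + v) *)
Lemma integral_beta a b (psi : R -> R) :
  measurable_fun setT psi -> (forall s, 0 <= psi s) ->
  (\int[lebesgue]_t \int[lebesgue]_u
     (\1_(`]0, +oo[%classic : set R) t * \1_(`]0, +oo[%classic : set R) u *
       (powR t (a - 1) * powR u (b - 1) * psi (t + u)))%:E =
   beta_int a b * \int[lebesgue]_s
     (\1_(`]0, +oo[%classic : set R) s * (powR s (a + b - 1) * psi s))%:E)%E.
Proof.
move=> mpsi psi0; set pos : R -> R := \1__.
have mpos : measurable_fun setT pos by exact: measurable_indic.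
have pos0 x : 0 <= pos x by rewrite /pos.
pose S := (\int[lebesgue]_s (pos s * (powR s (a + b - 1) * psi s))%:E)%E.
have mfst := @measurable_fst _ _ R R; have msnd := @measurable_snd _ _ R R.
transitivity (\int[lebesgue]_t \int[lebesgue]_v (pos t * pos v *
     (powR v (b - 1) * (powR t (a + b - 1) * psi (t * (1 + v)))))%:E)%E.
  apply: eq_integral => t _; have [t0|t0] := ltP 0 t; last first.
    have p0 : pos t = 0 by exact: indic_oyN.
    by rewrite p0; under eq_integral do rewrite !mul0r; under [RHS]eq_integral do rewrite !mul0r.
  rewrite (ge0_integral_scale t0)//; last 2 first.
  - apply/measurable_EFinP; apply: measurable_funM.
      by apply: measurable_funM.
    apply: measurable_funM; first by apply: measurable_funM; [|exact: measurable_powR].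
    by apply: (measurableT_comp mpsi); exact: measurable_funD.
  - by move=> u; rewrite lee_fin !mulr_ge0 ?powR_ge0.
  rewrite -ge0_integralZl_EFin ?ltW//; last 2 first.
  - by move=> u _; rewrite lee_fin !mulr_ge0 ?powR_ge0.
  - apply/measurable_EFinP; apply: measurable_funM.
      apply: measurable_funM => //; apply: (measurableT_comp mpos).
      exact: mulrl_measurable.
    apply: measurable_funM.
      apply: measurable_funM => //; apply: (measurableT_comp (measurable_powR _)).
      exact: mulrl_measurable.
    by apply: (measurableT_comp mpsi); apply: measurable_funD.
  apply: eq_integral => v _; rewrite -EFinM; congr (_%:E).
  have [v0|v0] := ltP 0 v; last first.
    have -> : pos (t * v) = 0 by apply: indic_oyN; rewrite pmulr_rle0.
    have -> : pos v = 0 by exact: indic_oyN.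
    by rewrite !(mulr0, mul0r).
  have -> : pos (t * v) = 1 by apply: indic_oy; rewrite mulr_gt0.
  have -> : pos v = 1 by exact: indic_oy.
  have -> : powR t (a + b - 1) = t * (powR t (a - 1) * powR t (b - 1)).
    rewrite -[X in X * _](powRr1 (ltW t0)) -!powRD ?(gt_eqF t0) ?implybT//.
    by congr powR; ring.
  rewrite powRM ?ltW// mulrDr !mulr1; ring.
rewrite lebesgue_tonelli; last 2 first.
- apply/measurable_EFinP; apply: measurable_funM.
    by apply: measurable_funM; apply: (measurableT_comp mpos).
  apply: measurable_funM; first exact: (measurableT_comp (measurable_powR _)).
  apply: measurable_funM; first exact: (measurableT_comp (measurable_powR _)).
  apply: (measurableT_comp mpsi); apply: measurable_funM => //.
  exact: measurable_funD.
- by move=> t v; rewrite lee_fin !mulr_ge0 ?powR_ge0.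
have mbeta : measurable_fun setT (fun v => pos v * (powR v (b - 1) * powR (1 + v) (- (a + b)))).
  apply: measurable_funM => //; apply: measurable_funM; first exact: measurable_powR.
  by apply: (measurableT_comp (measurable_powR _)); exact: measurable_funD.
rewrite muleC /beta_int -ge0_integralZl//; last 3 first.
- by apply/measurable_EFinP.
- by move=> v _; rewrite lee_fin !mulr_ge0 ?powR_ge0.
- by apply: integral_ge0 => s _; rewrite lee_fin !mulr_ge0 ?powR_ge0.
apply: eq_integral => v _; have [v0|v0] := ltP 0 v; last first.
  have p0 : pos v = 0 by exact: indic_oyN.
  rewrite p0 indic_oyN// mul0r mule0; apply: integral0_eq => t _.
  by rewrite mulr0 mul0r.
have v10 : 0 < 1 + v by rewrite addr_gt0.
rewrite [in RHS](ge0_integral_scale v10)//; last 2 first.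
- apply/measurable_EFinP; apply: measurable_funM => //.
  by apply: measurable_funM => //; exact: measurable_powR.
- by move=> s; rewrite lee_fin !mulr_ge0 ?powR_ge0.
rewrite muleAC -EFinM -ge0_integralZl_EFin//; last 3 first.
- by move=> s _; rewrite lee_fin !mulr_ge0 ?powR_ge0.
- apply/measurable_EFinP; apply: measurable_funM.
    by apply: (measurableT_comp mpos); exact: mulrl_measurable.
  apply: measurable_funM; first by apply: (measurableT_comp (measurable_powR _)); exact: mulrl_measurable.
  by apply: (measurableT_comp mpsi); exact: mulrl_measurable.
- by rewrite !mulr_ge0 ?powR_ge0// ltW.
apply: eq_integral => t _; rewrite -EFinM; congr (_%:E).
have [t0|t0] := ltP 0 t; last first.
  have -> : pos ((1 + v) * t) = 0 by apply: indic_oyN; rewrite pmulr_rle0.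
  have -> : pos t = 0 by exact: indic_oyN.
  by rewrite !(mulr0, mul0r).
have -> : pos ((1 + v) * t) = 1 by apply: indic_oy; rewrite mulr_gt0.
have -> : pos t = 1 by exact: indic_oy.
rewrite powRM ?ltW//.
have -> : powR (1 + v) (a + b - 1) = powR (1 + v) (a + b) / (1 + v).
  by rewrite -(powR_inv1 (ltW v10)) -powRD ?(gt_eqF v10) ?implybT.
rewrite powRN (mulrC t); field.
by rewrite !gt_eqF// powR_gt0.
Qed.

(** The case psi(s) = e^(-s) of [integral_beta], where [gamma_fun 1] plays the part of psi since it
    is e^(-s) on the positive half-line. *)
Lemma egammaM a b : (egamma a * egamma b = beta_int a b * egamma (a + b))%E.
Proof.
have mg c := @measurable_gamma_fun R c.
have gE c t : gamma_fun c t = \1_(`]0, +oo[%classic : set R) t * (powR t (c - 1) * gamma_fun 1 t).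
  rewrite /gamma_fun; have [t0|t0] := ltP 0 t; last by rewrite indic_oyN// !mul0r.
  by rewrite indic_oy// !mul1r subrr powRr0 mul1r.
rewrite {3}/egamma; under [in RHS]eq_integral do rewrite gE.
rewrite -integral_beta//; last exact: gamma_fun_ge0.
rewrite muleC [X in (_ * X)%E]/egamma -ge0_integralZl//; last 3 first.
- by apply/measurable_EFinP; exact: mg.
- by move=> t _; rewrite lee_fin gamma_fun_ge0.
- exact: egamma_ge0.
apply: eq_integral => t _; rewrite muleC /egamma -ge0_integralZl_EFin ?gamma_fun_ge0//; last 2 first.
- by move=> u _; rewrite lee_fin gamma_fun_ge0.
- by apply/measurable_EFinP; exact: mg.
apply: eq_integral => u _; rewrite -EFinM; congr (_%:E).
rewrite /gamma_fun; have [t0|t0] := ltP 0 t; last by rewrite indic_oyN// !mul0r.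
have [u0|u0] := ltP 0 u; last by rewrite (indic_oyN u0) !(mul0r,mulr0).
rewrite !indic_oy ?addr_gt0// subrr powRr0 opprD expRD; ring.
Qed.

(** Both properties are read off from Gamma(a) Gamma(b) = B(a, b) Gamma(a + b), in which the Gamma
    values are positive and finite. *)
Lemma beta_int_fin a b : 0 < a -> 0 < b ->
  exists2 c : R, 0 < c & beta_int a b = c%:E.
Proof.
move=> a0 b0; have := egammaM a b; have ab0 : 0 < a + b by rewrite addr_gt0.
have gfin c : 0 < c -> exists2 r : R, 0 < r & egamma c = r%:E.
  move=> c0; have := egamma_gt0 c; have := egamma_lty c0.
  by case: (egamma c) => // r _; rewrite lte_fin => r0; exists r.
have [x x0 ->] := gfin _ a0; have [y y0 ->] := gfin _ b0; have [z z0 ->] := gfin _ ab0.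
have : (0 <= beta_int a b)%E.
  by apply: integral_ge0 => t _; rewrite lee_fin !mulr_ge0 ?powR_ge0.
case: (beta_int a b) => // [r|].
  rewrite lee_fin => r0; rewrite -!EFinM => -[H]; exists r => //.
  rewrite lt_neqAle r0 andbT; apply/eqP => r1.
  by move: H; rewrite -r1 mul0r => /eqP; rewrite gt_eqF// mulr_gt0.
by move=> _; rewrite gt0_mulye ?lte_fin// -EFinM.
Qed.

(** Once Tonelli has moved the integral in y inside, the semigroup law of the heat kernel leaves a
    function of t + u only, and [integral_beta] applies. Up to normalisation this is G_2a * G_2b =
    G_2(a+b). *)
Lemma bessel_int_conv a b x z :
  (\int[lebesgue]_y (bessel_int a (x - y) * bessel_int b (y - z)) =
   beta_int a b * bessel_int (a + b) (x - z))%E.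
Proof.
have mfst := @measurable_fst _ _ R R; have msnd := @measurable_snd _ _ R R.
have mK c f g := @measurable_heat_gamma c _ (R * R)%type f g.
transitivity (\int[lebesgue]_y \int[lebesgue]_t \int[lebesgue]_u
    (heat_gamma a t (x - y) * heat_gamma b u (y - z))%:E)%E.
  apply: eq_integral => y _; rewrite muleC /bessel_int -ge0_integralZl//; last 3 first.
  - by apply/measurable_EFinP; apply: measurable_heat_gamma.
  - by move=> t _; rewrite lee_fin heat_gamma_ge0.
  - by apply: integral_ge0 => t _; rewrite lee_fin heat_gamma_ge0.
  apply: eq_integral => t _; rewrite muleC -ge0_integralZl_EFin ?heat_gamma_ge0//.
  - by move=> u _; rewrite lee_fin heat_gamma_ge0.
  - by apply/measurable_EFinP; apply: measurable_heat_gamma.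
have m3 : measurable_fun setT (fun q : (R * R) * R =>
    (heat_gamma a q.1.2 (x - q.1.1) * heat_gamma b q.2 (q.1.1 - z))%:E).
  apply/measurable_EFinP; apply: measurable_funM; apply: measurable_heat_gamma.
  - exact: (measurableT_comp msnd).
  - apply: measurable_funB => //; exact: (measurableT_comp mfst).
  - exact: measurable_snd.
  - apply: measurable_funB => //; exact: (measurableT_comp mfst).
rewrite lebesgue_tonelli; last 2 first.
- apply: (@measurable_fun_fubini_tonelli_F _ _ _ _ _ lebesgue _ m3).
  by move=> q; rewrite lee_fin mulr_ge0 ?heat_gamma_ge0.
- by move=> y t; apply: integral_ge0 => u _; rewrite lee_fin mulr_ge0 ?heat_gamma_ge0.
have KE c t w : heat_gamma c t w = \1_(`]0, +oo[%classic : set R) t * (powR t (c - 1) * heat_gamma 1 t w).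
  rewrite /heat_gamma /gamma_fun; have [t0|t0] := ltP 0 t; last by rewrite indic_oyN// !mul0r.
  by rewrite indic_oy// !mul1r subrr powRr0 mul1r mulrA.
rewrite /bessel_int; under [in RHS]eq_integral do rewrite KE.
rewrite -integral_beta//; last 2 first.
- exact: measurable_heat_gamma.
- by move=> s; rewrite heat_gamma_ge0.
apply: eq_integral => t _.
rewrite lebesgue_tonelli; last 2 first.
- apply/measurable_EFinP; apply: measurable_funM; apply: measurable_heat_gamma => //;
  exact: measurable_funB.
- by move=> p q; rewrite lee_fin mulr_ge0 ?heat_gamma_ge0.
apply: eq_integral => u _; rewrite /heat_gamma.
have [t0|t0] := ltP 0 t; last first.
  by rewrite indic_oyN// !mul0r; apply: integral0_eq => y _; rewrite /gamma_fun indic_oyN// !mul0r.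
have [u0|u0] := ltP 0 u; last first.
  by rewrite (indic_oyN u0) !(mul0r, mulr0); apply: integral0_eq => y _; rewrite /gamma_fun (indic_oyN u0) !(mul0r, mulr0).
under eq_integral do rewrite mulrACA EFinM.
rewrite ge0_integralZl_EFin ?(mulr_ge0 (gamma_fun_ge0 _ _) (gamma_fun_ge0 _ _))//; last 2 first.
- by move=> y _; rewrite lee_fin mulr_ge0 ?heat_ge0.
- apply/measurable_EFinP; apply: measurable_funM.
    by under eq_fun do rewrite heat_normal//; exact: measurable_normal_pdf.
  under eq_fun do rewrite -heatN opprB heat_normal//.
  exact: measurable_normal_pdf.
rewrite integral_heatM// -EFinM; congr (_%:E).
rewrite /gamma_fun !indic_oy ?addr_gt0// subrr powRr0 opprD expRD; ring.
Qed.

End heat.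

(** * The Bessel kernel of order two in closed form *)

Section laplace_kernel.
Context {R : realType}.
Notation lebesgue := (@lebesgue_measure R).
Implicit Types t v x y : R.

Let sigma : R := (Num.sqrt 2)^-1.

(** This is (1 + erf v)/2. Viewing it as the distribution function of a normal law, of standard
    deviation 1/sqrt 2 so that the density is e^(-v^2)/sqrt pi, yields its limits at both
    infinities. *)
Definition gauss_cdf v : R := Rintegral lebesgue `]-oo, v] (normal_pdf 0 sigma).

Let sigma0 : sigma != 0.
Proof. by rewrite /sigma invr_eq0 gt_eqF// sqrtr_gt0. Qed.

Lemma gauss_pdfE v : normal_pdf 0 sigma v = (Num.sqrt pi)^-1 * expR (- v ^+ 2).
Proof.
rewrite normal_pdfE// /normal_peak /normal_fun subr0.
have s2 : sigma ^+ 2 = 2^-1 by rewrite /sigma exprVn sqr_sqrtr.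
rewrite s2; congr ((Num.sqrt _)^-1 * expR _).
  by rewrite -mulr_natr; field.
by rewrite -mulr_natr; field.
Qed.

Lemma is_derive_gauss_cdf v :
  is_derive v 1 gauss_cdf ((Num.sqrt pi)^-1 * expR (- v ^+ 2)).
Proof.
have H : derivable gauss_cdf v 1 /\ gauss_cdf^`()%classic v = normal_pdf 0 sigma v.
  apply: (@continuous_FTC1 R (normal_pdf 0 sigma) -oo%O v (v + 1)).
  - by rewrite ltrDl.
  - by apply: integrableS (integrable_normal_pdf 0 sigma).
  - by rewrite /Order.lt /=.
  - exact: continuous_normal_pdf.
case: H => dg gE; rewrite -gauss_pdfE -gE derive1E.
exact: derivableP.
Qed.

Let idR (x : measurableTypeR R) : R := x.

Let midR : measurable_fun [set: measurableTypeR R] idR.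
Proof. exact: measurable_id. Qed.

Let X : {RV (normal_prob 0 sigma) >-> R} :=
  HB.pack idR (isMeasurableFun.Build _ _ (measurableTypeR R) R idR midR).

Let cdfE : fine \o cdf X = gauss_cdf.
Proof. by []. Qed.

Lemma cvg_gauss_cdfy : gauss_cdf v @[v --> +oo] --> (1 : R).
Proof. by have /fine_cvgP[_] := cvg_cdfy1 X; rewrite cdfE. Qed.

Lemma cvg_gauss_cdfNy : gauss_cdf v @[v --> -oo] --> (0 : R).
Proof. by have /fine_cvgP[_] := cvg_cdfNy0 X; rewrite cdfE. Qed.

Lemma cvg_sqrty : (Num.sqrt t : R) @[t --> +oo] --> +oo.
Proof.
apply/cvgryPge => A; near=> t.
have [A0|A0] := ltP A 0; first by rewrite (le_trans (ltW A0))// sqrtr_ge0.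
rewrite -[leLHS](ger0_norm A0) -sqrtr_sqr; apply: ler_wsqrtr.
by near: t; apply: nbhs_pinfty_ge; rewrite num_real.
Unshelve. all: by end_near. Qed.

(** The integrand e^(-t) h_t(x) has the explicit antiderivative [F]: as [vp]^2 = t + x + x^2/(4t)
    and [vm]^2 = t - x + x^2/(4t), the factors e^x and e^(-x) turn both Gaussians into e^(-t -
    x^2/(4t)), and the terms in t^(-3/2) cancel. Then F(+oo) - F(0+) = (e^x + e^(-x))/2 - e^x/2. *)
Lemma laplace_kernel_gt0 x : 0 < x ->
  bessel_int 1 x = (2^-1 * expR (- x))%:E.
Proof.
move=> x0.
pose vp t := Num.sqrt t + x / 2 * (Num.sqrt t)^-1.
pose vm t := Num.sqrt t - x / 2 * (Num.sqrt t)^-1.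
pose F t := 2^-1 * (expR x * gauss_cdf (vp t) + expR (- x) * gauss_cdf (vm t)).
pose f t := expR (- t) * heat t x.
have -> : bessel_int 1 x = (\int[lebesgue]_(t in `]0%R, +oo[) (f t)%:E)%E.
  rewrite /bessel_int [RHS]integral_mkcond; apply: eq_integral => t _.
  rewrite patchE /heat_gamma /gamma_fun; case: ifPn => [|/negP].
    by rewrite inE/= in_itv/= andbT => t0; rewrite indic_oy// subrr powRr0 !mul1r.
  rewrite inE/= in_itv/= andbT => /negP; rewrite -leNgt => t0.
  by rewrite indic_oyN// !mul0r.
have s0 t : 0 < t -> 0 < Num.sqrt t by rewrite sqrtr_gt0.
have st t : 0 < t -> t = Num.sqrt t ^+ 2 by move=> t0; rewrite sqr_sqrtr// ltW.
have dsV t : 0 < t -> is_derive t 1 (fun t => x / 2 * (Num.sqrt t)^-1)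
   (- (x / 4) * (Num.sqrt t)^-1 ^+ 3).
  move=> t0; have ds := is_derive1_sqrt t0.
  have nz : Num.sqrt t != 0 by rewrite gt_eqF// s0.
  have := is_deriveZ (x / 2) (is_deriveV nz ds).
  rewrite (_ : _ *: _ = - (x / 4) * (Num.sqrt t)^-1 ^+ 3)//.
  by rewrite /GRing.scale/=; field.
have dvp t : 0 < t -> is_derive t 1 vp (2^-1 * (Num.sqrt t)^-1 - (x / 4) * (Num.sqrt t)^-1 ^+ 3).
  move=> t0; have := is_deriveD (is_derive1_sqrt t0) (dsV _ t0).
  by rewrite invfM mulNr.
have dvm t : 0 < t -> is_derive t 1 vm (2^-1 * (Num.sqrt t)^-1 + (x / 4) * (Num.sqrt t)^-1 ^+ 3).
  move=> t0; have := is_deriveB (is_derive1_sqrt t0) (dsV _ t0).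
  by rewrite invfM mulNr opprK.
have dF t : 0 < t -> is_derive t 1 F (f t).
  move=> t0; have nz : Num.sqrt t != 0 by rewrite gt_eqF// s0.
  have d1 := @is_derive1_comp _ gauss_cdf vp t _ _ (is_derive_gauss_cdf (vp t)) (dvp _ t0).
  have d2 := @is_derive1_comp _ gauss_cdf vm t _ _ (is_derive_gauss_cdf (vm t)) (dvm _ t0).
  have := is_deriveZ 2^-1 (is_deriveD (is_deriveZ (expR x) d1) (is_deriveZ (expR (- x)) d2)).
  rewrite (_ : _ *: _ = f t)// /GRing.scale/= /f /heat.
  have E1 : expR x * expR (- vp t ^+ 2) = expR (- t) * expR (- (x ^+ 2 / (4 * t))).
    rewrite -!expRD /vp; congr expR; move: (st _ t0) nz; set q := Num.sqrt t => tE nz.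
    by rewrite tE; field.
  have E2 : expR (- x) * expR (- vm t ^+ 2) = expR (- t) * expR (- (x ^+ 2 / (4 * t))).
    rewrite -!expRD /vm; congr expR; move: (st _ t0) nz; set q := Num.sqrt t => tE nz.
    by rewrite tE; field.
  have -> : Num.sqrt (4 * pi * t) = 2 * Num.sqrt pi * Num.sqrt t.
    rewrite !sqrtrM ?mulr_ge0 ?pi_ge0// (_ : 4 = 2 ^+ 2) ?sqrtr_sqr ?ger0_norm//.
    by rewrite expr2 -natrM.
  have p0 : Num.sqrt pi != 0 :> R by rewrite gt_eqF// sqrtr_gt0 pi_gt0.
  transitivity (2^-1 * (Num.sqrt pi)^-1 *
    ((expR x * expR (- vp t ^+ 2)) * (2^-1 * (Num.sqrt t)^-1 - x / 4 * (Num.sqrt t)^-1 ^+ 3) +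
    (expR (- x) * expR (- vm t ^+ 2)) * (2^-1 * (Num.sqrt t)^-1 + x / 4 * (Num.sqrt t)^-1 ^+ 3))).
    by ring.
  by rewrite E1 E2; field; rewrite nz p0.
have heat_cont t : 0 < t -> {for t, continuous f}.
  move=> t0; have ct : {for t, continuous (fun t : R => t)} by exact: cvg_id.
  apply: cvgM.
    apply: (@continuous_comp _ _ _ (fun t : R => - t) expR).
      by apply: continuousN.
    exact: continuous_expR.
  apply: cvgM.
    apply: cvgV; first by rewrite gt_eqF// s0// !mulr_gt0 ?pi_gt0.
    apply: (@continuous_comp _ _ _ (fun t : R => 4 * pi * t) Num.sqrt).
      by apply: cvgM; [exact: cvg_cst|exact: cvg_id].
    exact: sqrt_continuous.
  apply: (@continuous_comp _ _ _ (fun t : R => - (x ^+ 2 / (4 * t))) expR).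
    apply: cvgN; apply: cvgM; first exact: cvg_cst.
    apply: cvgV; first by rewrite gt_eqF// mulr_gt0.
    by apply: cvgM; [exact: cvg_cst|exact: cvg_id].
  exact: continuous_expR.
have f0 t : 0 < t -> 0 <= f t by move=> _; rewrite mulr_ge0 ?expR_ge0 ?heat_ge0.
have siy : (Num.sqrt t)^-1 @[t --> +oo] --> (0 : R).
  apply/gtr0_cvgV0; last exact: cvg_sqrty.
  by near=> t; apply: s0; near: t; exact: nbhs_pinfty_gt.
have Fy : F t @[t --> +oo] --> 2^-1 * (expR x * 1 + expR (- x) * 1).
  apply: cvgM; first exact: cvg_cst.
  apply: cvgD; (apply: cvgM; first exact: cvg_cst).
    apply: (cvg_comp vp gauss_cdf); last exact: cvg_gauss_cdfy.
    apply: (ger_cvgy _ cvg_sqrty); near=> t.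
    by rewrite /vp lerDl mulr_ge0 ?invr_ge0 ?sqrtr_ge0 ?divr_ge0 ?ltW.
  apply: (cvg_comp vm gauss_cdf); last exact: cvg_gauss_cdfy.
  apply/cvgryPge => A; near=> t; rewrite /vm lerBrDr.
  have : x / 2 * (Num.sqrt t)^-1 <= 1.
    near: t.
    have : x / 2 * (Num.sqrt t)^-1 @[t --> +oo] --> x / 2 * 0.
      by apply: cvgM; [exact: cvg_cst|].
    by rewrite mulr0 => /cvgr_le; apply.
  have : A + 1 <= Num.sqrt t.
    by near: t; move/cvgryPge : cvg_sqrty; apply.
  by move=> h1 h2; rewrite (le_trans _ h1)// lerD2l.
have si0 : (Num.sqrt t)^-1 @[t --> (0:R)^'+] --> +oo%R.
  apply/cvgrVy; first by near=> t; apply: s0.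
  apply: cvg_at_right_filter; rewrite -[X in _ --> X](sqrtr0 R).
  exact: sqrt_continuous.
have F0 : F t @[t --> (0:R)^'+] --> 2^-1 * (expR x * 1 + expR (- x) * 0).
  apply: cvgM; first exact: cvg_cst.
  apply: cvgD; (apply: cvgM; first exact: cvg_cst).
    apply: (cvg_comp vp gauss_cdf); last exact: cvg_gauss_cdfy.
    apply/cvgryPge => A; near=> t.
    have : A / (x / 2) <= (Num.sqrt t)^-1.
      by near: t; move/cvgryPge : si0; apply.
    rewrite ler_pdivrMr ?divr_gt0// mulrC => h.
    by rewrite /vp (le_trans h)// lerDr sqrtr_ge0.
  apply: (cvg_comp vm gauss_cdf); last exact: cvg_gauss_cdfNy.
  apply/cvgrNyPle => A; near=> t.
  have h : (1 - A) / (x / 2) <= (Num.sqrt t)^-1.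
    by near: t; move/cvgryPge : si0; apply.
  have h1 : Num.sqrt t <= 1.
    near: t.
    have : Num.sqrt t @[t --> (0:R)^'+] --> (0:R).
      apply: cvg_at_right_filter; rewrite -[X in _ --> X](sqrtr0 R).
      exact: sqrt_continuous.
    by move/cvgr_le; apply.
  move: h; rewrite ler_pdivrMr ?divr_gt0// => h.
  by rewrite /vm (mulrC (x / 2)); lra.
rewrite (ge0_FTC2_oy f0 heat_cont dF Fy F0); congr (_%:E); ring.
Unshelve. all: by end_near. Qed.

Lemma laplace_kernel x : x != 0 -> bessel_int 1 x = (2^-1 * expR (- `|x|))%:E.
Proof.
have [x0|x0|//] := ltgtP 0 x => _; first by rewrite gtr0_norm// laplace_kernel_gt0.
rewrite ltr0_norm// -laplace_kernel_gt0 ?oppr_gt0// /bessel_int.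
by apply: eq_integral => t _; rewrite /heat_gamma heatN.
Qed.

End laplace_kernel.

(** * Bessel potentials of smooth functions with compact support *)

Section bessel_convolution.
Context {R : realType}.
Notation lebesgue := (@lebesgue_measure R).
Implicit Types (a b x y : R) (u v : R -> R).

Lemma bessel_kernelE s x :
  bessel_kernel s x = (fine (egamma (s / 2)))^-1 * fine (bessel_int (s / 2) x) :> R.
Proof.
rewrite /bessel_kernel /Rintegral; congr ((fine _)^-1 * fine _).
  rewrite [LHS]integral_mkcond; apply: eq_integral => t _.
  rewrite patchE /gamma_fun; case: ifPn => [|/negP].
    by rewrite inE/= in_itv/= andbT => t0; rewrite indic_oy// mul1r.
  rewrite inE/= in_itv/= andbT => /negP; rewrite -leNgt => t0.
  by rewrite indic_oyN// mul0r.
rewrite [LHS]integral_mkcond; apply: eq_integral => t _.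
rewrite patchE /heat_gamma /gamma_fun; case: ifPn => [|/negP].
  by rewrite inE/= in_itv/= andbT => t0; rewrite indic_oy// mul1r.
rewrite inE/= in_itv/= andbT => /negP; rewrite -leNgt => t0.
by rewrite indic_oyN// !mul0r.
Qed.

Lemma integrable_bessel_int a x : 0 < a ->
  lebesgue.-integrable setT (fun y => bessel_int a (x - y)).
Proof.
move=> a0; have mJ : measurable_fun setT (fun y : R => bessel_int a (x - y)).
  apply: (measurableT_comp (measurable_bessel_int a)); exact: measurable_funB.
apply/integrableP; split=> //.
under eq_integral do rewrite gee0_abs ?bessel_int_ge0//.
by rewrite integral_bessel_int egamma_lty.
Qed.

Lemma bessel_int_fin a x : 0 < a ->
  \forall y \ae lebesgue, bessel_int a (x - y) \is a fin_num.
Proof.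
move=> a0; have := integrable_ae measurableT (integrable_bessel_int x a0).
by apply: filterS => y; apply.
Qed.

Lemma integrable_bessel_kernel a x : 0 < a ->
  lebesgue.-integrable setT (EFin \o (fun y => fine (bessel_int a (x - y)))).
Proof.
move=> a0; have iJ := integrable_bessel_int x a0; have /integrableP[mJ _] := iJ.
apply: le_integrable iJ => //.
  by apply/measurable_EFinP; apply: measurableT_comp.
move=> y _ /=; rewrite ger0_norm ?fine_ge0 ?bessel_int_ge0// gee0_abs ?bessel_int_ge0//.
by case: (bessel_int a (x - y)) (bessel_int_ge0 a (x - y)) => //= _; rewrite leey.
Qed.

Definition bounded_measurable u :=
  measurable_fun setT u /\ exists M : R, forall x, `|u x| <= M.

Lemma bounded_measurable_cst (c : R) : bounded_measurable (fun=> c).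
Proof. by split; [exact: measurable_cst|exists `|c|]. Qed.

Lemma bounded_fun_in u : bounded_measurable u -> [bounded u x | x in setT].
Proof.
move=> [_ [M hM]]; exists M; split; first by rewrite num_real.
by move=> r Mr x _ /=; rewrite (le_trans (hM x))// ltW.
Qed.

(** Convolution with the unnormalised kernel. [fine] sends the infinite values of the kernel to 0;
    they occur only on a null set. *)
Definition bconv a u x : R :=
  Rintegral lebesgue setT (fun y => fine (bessel_int a (x - y)) * u y).

Lemma integrable_bconv a u x : 0 < a -> bounded_measurable u ->
  lebesgue.-integrable setT (EFin \o (fun y => fine (bessel_int a (x - y)) * u y)).
Proof.
move=> a0 bu; have [mu _] := bu.
have := integrableMl measurableT (integrable_bessel_kernel x a0) mu (bounded_fun_in bu).
by apply: eq_integrable => // y _; rewrite /= EFinM.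
Qed.

Lemma bconvB a u v : 0 < a -> bounded_measurable u -> bounded_measurable v ->
  bconv a (fun x => u x - v x) = fun x => bconv a u x - bconv a v x.
Proof.
move=> a0 bu bv; apply/funext => x; rewrite /bconv.
rewrite -RintegralB//; try exact: integrable_bconv.
by apply: eq_Rintegral => y _; rewrite mulrBr.
Qed.

Lemma bconv_bound a u M x : 0 < a -> measurable_fun setT u ->
  (forall x, `|u x| <= M) ->
  `|bconv a u x| <= fine (egamma a) * M.
Proof.
move=> a0 mu hM; have bu : bounded_measurable u by split=> //; exists M.
have M0 : 0 <= M := le_trans (normr_ge0 _) (hM 0).
rewrite /bconv (le_trans (le_normr_Rintegral _ (integrable_bconv x a0 bu)))//.
have -> : fine (egamma a) * M = Rintegral lebesgue setT (fun y => M * fine (bessel_int a (x - y))).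
  rewrite RintegralZl//; last exact: integrable_bessel_kernel.
  rewrite mulrC; congr (_ * fine _).
  rewrite -(integral_bessel_int a x); apply: ae_eq_integral => //.
  - by have /integrableP[] := integrable_bessel_int x a0.
  - by have /integrableP[] := integrable_bessel_kernel x a0.
  - suff : \forall y \ae lebesgue, setT y -> bessel_int a (x - y) = (fine (bessel_int a (x - y)))%:E by [].
    have := bessel_int_fin x a0; apply: (@filterS _ _ (ae_filter_ringOfSetsType lebesgue)) => y Jy _ /=.
    by rewrite fineK.
apply: le_Rintegral => //.
- have := integrable_norm (integrable_bconv x a0 bu).
  by apply: eq_integrable.
- have := integrableZl measurableT M (integrable_bessel_kernel x a0).
  by apply: eq_integrable => // y _; rewrite /= EFinM.
- move=> y _; rewrite normrM mulrC (ger0_norm (fine_ge0 (bessel_int_ge0 _ _))).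
  by rewrite ler_wpM2r ?fine_ge0 ?bessel_int_ge0.
Qed.

(** For nonnegative functions this returns to extended real integrals, where Tonelli is available.
    Signed bounded functions are reduced to this case by adding a constant. *)
Lemma bconv_ge0E a u x : 0 < a -> bounded_measurable u -> (forall x, 0 <= u x) ->
  (bconv a u x)%:E = (\int[lebesgue]_y (bessel_int a (x - y) * (u y)%:E))%E.
Proof.
move=> a0 bu u0; have iu := integrable_bconv x a0 bu; have [mu _] := bu.
rewrite /bconv /Rintegral fineK; last exact: integrable_fin_num.
apply: ae_eq_integral => //.
- by case/integrableP : iu.
- apply: emeasurable_funM; last exact/measurable_EFinP.
  by have /integrableP[] := integrable_bessel_int x a0.
- suff : \forall y \ae lebesgue, setT y -> (fine (bessel_int a (x - y)) * u y)%:E = (bessel_int a (x - y) * (u y)%:E)%E by [].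
  have := bessel_int_fin x a0; apply: (@filterS _ _ (ae_filter_ringOfSetsType lebesgue)) => y Jy _ /=.
  by rewrite EFinM fineK.
Qed.

Lemma measurable_bconv_ge0 a u : 0 < a -> bounded_measurable u -> (forall x, 0 <= u x) ->
  measurable_fun setT (bconv a u).
Proof.
move=> a0 bu u0; have [mu _] := bu; apply/measurable_EFinP.
have -> : EFin \o bconv a u = fun x => (\int[lebesgue]_y (bessel_int a (x - y) * (u y)%:E))%E.
  by apply/funext => x; exact: bconv_ge0E.
apply: (@measurable_fun_fubini_tonelli_F _ _ _ _ _ lebesgue
  (fun p : R * R => (bessel_int a (p.1 - p.2)%R * (u p.2)%:E)%E)).
- apply: emeasurable_funM.
    apply: (measurableT_comp (measurable_bessel_int a)).
    by apply: measurable_funB; [exact: measurable_fst|exact: measurable_snd].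
  by apply/measurable_EFinP; apply: (measurableT_comp mu); exact: measurable_snd.
- by move=> p; rewrite mule_ge0 ?bessel_int_ge0// lee_fin.
Qed.

Lemma bounded_ge0_split u : bounded_measurable u -> exists2 c : R, 0 <= c &
  bounded_measurable (fun x => u x + c) /\ forall x, 0 <= u x + c.
Proof.
move=> [mu [M hM]]; exists `|M| => //; split.
  split; first exact: measurable_funD.
  by exists (M + `|M|) => x; rewrite (le_trans (ler_normD _ _))// lerD// normr_id.
by move=> x; rewrite -lerBlDr sub0r lerNl (le_trans (ler_norm _))// normrN (le_trans (hM x))// ler_norm.
Qed.

Lemma bounded_measurable_bconv a u : 0 < a -> bounded_measurable u ->
  bounded_measurable (bconv a u).
Proof.
move=> a0 bu; split; last first.
  by have [mu [M hM]] := bu; exists (fine (egamma a) * M) => x; exact: bconv_bound.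
have [c c0 [bc uc]] := bounded_ge0_split bu.
have -> : u = fun x => (u x + c) - (fun=> c) x by apply/funext => x; rewrite addrK.
rewrite bconvB//; last exact: bounded_measurable_cst.
apply: measurable_funB; apply: measurable_bconv_ge0 => //.
exact: bounded_measurable_cst.
Qed.

Lemma bconv_ge0 a u x : (forall x, 0 <= u x) -> 0 <= bconv a u x.
Proof.
move=> u0; apply: fine_ge0; apply: integral_ge0 => y _.
by rewrite lee_fin mulr_ge0 ?fine_ge0 ?bessel_int_ge0.
Qed.

(** Tonelli reduces the iterated convolution to that of the two kernels, so that [c] is B(a, b), the
    same for all [u]. *)
Lemma bconv_comp a b : 0 < a -> 0 < b ->
  exists2 c : R, 0 < c & forall u, bounded_measurable u ->
    bconv a (bconv b u) = fun x => c * bconv (a + b) u x.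
Proof.
move=> a0 b0; have [c c0 cE] := beta_int_fin a0 b0; exists c => //.
have ab0 : 0 < a + b by rewrite addr_gt0.
have H u : bounded_measurable u -> (forall x, 0 <= u x) ->
    bconv a (bconv b u) = fun x => c * bconv (a + b) u x.
  move=> bu u0; have [mu _] := bu; apply/funext => x; apply: EFin_inj.
  rewrite bconv_ge0E//; last 2 first.
  - exact: bounded_measurable_bconv.
  - by move=> y; exact: bconv_ge0.
  rewrite [RHS]EFinM [X in _ = (_ * X)%E](bconv_ge0E x ab0 bu u0).
  have mJ e (z : R) : measurable_fun setT (fun y : R => bessel_int e (z - y)).
    by apply: (measurableT_comp (measurable_bessel_int e)); exact: measurable_funB.
  transitivity (\int[lebesgue]_y \int[lebesgue]_z
      (bessel_int a (x - y)%R * (bessel_int b (y - z)%R * (u z)%:E)))%E.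
    apply: eq_integral => y _; rewrite bconv_ge0E// ge0_integralZl//.
    - by apply: emeasurable_funM; [exact: mJ|exact/measurable_EFinP].
    - by move=> z _; rewrite mule_ge0 ?bessel_int_ge0// lee_fin.
    - exact: bessel_int_ge0.
  rewrite lebesgue_tonelli; last 2 first.
  - apply: emeasurable_funM.
      apply: (measurableT_comp (mJ a x)); exact: measurable_fst.
    apply: emeasurable_funM.
      apply: (measurableT_comp (measurable_bessel_int b)).
      by apply: measurable_funB; [exact: measurable_fst|exact: measurable_snd].
    by apply/measurable_EFinP; apply: (measurableT_comp mu); exact: measurable_snd.
  - by move=> y z; rewrite !mule_ge0 ?bessel_int_ge0// lee_fin.
  rewrite -ge0_integralZl_EFin ?ltW//; last 2 first.
  - by move=> z _; rewrite mule_ge0 ?bessel_int_ge0// lee_fin.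
  - by apply: emeasurable_funM; [exact: mJ|exact/measurable_EFinP].
  apply: eq_integral => z _.
  under eq_integral do rewrite muleA muleC.
  rewrite ge0_integralZl_EFin//; last 2 first.
  - by move=> y _; rewrite mule_ge0 ?bessel_int_ge0.
  - apply: emeasurable_funM; first exact: mJ.
    by apply: (measurableT_comp (measurable_bessel_int b)); exact: measurable_funB.
  by rewrite bessel_int_conv cE muleC muleA.
(* A signed [u] is the difference of the nonnegative functions u + e and e, and both sides are
   linear. *)
move=> u bu; have [e e0 [be ue]] := bounded_ge0_split bu.
have bk := bounded_measurable_cst e.
have -> : u = fun x => (u x + e) - (fun=> e) x by apply/funext => x; rewrite addrK.
rewrite !bconvB//; try exact: bounded_measurable_bconv.
by apply/funext => x; rewrite !H// mulrBr.
Qed.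

End bessel_convolution.

(** * Compactly supported smooth functions as Bessel potentials *)

Section jets.
Context {R : realType}.
Notation lebesgue := (@lebesgue_measure R).
Implicit Types (a b x y : R) (F : nat -> R -> R).

(* [F j] is the [j]-th derivative of a smooth function supported in [a, b] *)
Definition jet a b F :=
  (forall j x, is_derive x 1 (F j) (F j.+1 x)) /\
  (forall j x, x \notin `[a, b] -> F j x = 0).

Lemma jet_continuous a b F j : jet a b F -> continuous (F j).
Proof.
move=> [dF _] x; apply: differentiable_continuous; apply/derivable1_diffP.
by have [] := dF j x.
Qed.

Lemma jet_bounded a b F j : jet a b F -> exists2 M : R, 0 <= M & forall x, `|F j x| <= M.
Proof.
move=> jF; have [ab|ab] := leP a b; last first.
  exists 0 => // x; rewrite (jF.2 j x) ?normr0//.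
  by rewrite in_itv/=; apply: contraTN ab => /andP[ax xb]; rewrite -leNgt (le_trans ax).
have cF : {within `[a, b], continuous (fun x => `|F j x|)}.
  by apply: continuous_subspaceT => x; apply: cvg_norm; exact: (jet_continuous jF).
have [c _ hc] := EVT_max ab cF.
exists `|F j c| => // x; have [xab|xab] := boolP (x \in `[a, b]); first exact: hc.
by rewrite (jF.2 j x xab) normr0.
Qed.

Lemma jet_bounded_measurable a b F j : jet a b F -> bounded_measurable (F j).
Proof.
move=> jF; split; last by have [M _ hM] := jet_bounded j jF; exists M.
exact: continuous_measurable_fun (jet_continuous jF).
Qed.

(* the jet of (1 - d^2/dx^2) (F 0) *)
Definition bessel_jet F j x := F j x - F j.+2 x.

Lemma jet_bessel_jet a b F : jet a b F -> jet a b (bessel_jet F).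
Proof.
move=> [dF sF]; split=> j x.
  exact: is_deriveB (dF j x) (dF j.+2 x).
by move=> xab; rewrite /bessel_jet !sF// subrr.
Qed.

Lemma jet_iter a b F k : jet a b F -> jet a b (iter k bessel_jet F).
Proof. by move=> jF; elim: k => // k IH; exact: jet_bessel_jet. Qed.

(** The kernel e^(-|x-y|)/2 is the Green function of 1 - d^2/dx^2. On either side of x the integrand
    has an explicit antiderivative; the contributions (F - F')/2 and (F + F')/2 at y = x add up to
    F(x). *)
Lemma bconv1_jet a b F j : jet a b F -> bconv 1 (bessel_jet F j) = F j.
Proof.
move=> jF; have jG := jet_bessel_jet jF.
apply/funext => x.
pose u := bessel_jet F j; have bu : bounded_measurable u := jet_bounded_measurable j jG.
have cont k : continuous (F k) := jet_continuous jF.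
have cu : continuous u := jet_continuous jG.
pose g y := 2^-1 * expR (- `|x - y|) * u y.
have cg : continuous g.
  move=> y; apply: cvgM; last exact: cu.
  apply: cvgM; first exact: cvg_cst.
  apply: (@continuous_comp _ _ _ (fun y => - `|x - y|) expR); last exact: continuous_expR.
  apply: cvgN; apply: cvg_norm; apply: cvgB; [exact: cvg_cst|exact: cvg_id].
have mg : measurable_fun setT g by exact: continuous_measurable_fun.
have -> : bconv 1 u x = Rintegral lebesgue setT g.
  congr fine; have iu := integrable_bconv x ltr01 bu.
  apply: ae_eq_integral => //.
  - by case/integrableP : iu.
  - exact/measurable_EFinP.
  (* The closed form of the kernel is available off the diagonal only, so the single point y = x is
     discarded. *)
  - exists [set x]; split=> //; first exact: lebesgue_measure_set1.
    move=> y /= ny; apply: contrapT => yx; apply: ny => _.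
    by rewrite laplace_kernel// subr_eq0; apply/eqP => xy; apply: yx.
(* The interval [c, d] contains x in its interior and its ends lie outside the support, so the
   boundary terms at c and d vanish. *)
pose c := Num.min a x - 1; pose d := Num.max b x + 1.
have [cx ca] : c < x /\ c < a.
  have : Num.min a x <= x by rewrite ge_min lexx orbT.
  have : Num.min a x <= a by rewrite ge_min lexx.
  by rewrite /c => h1 h2; split; lra.
have [xd bd] : x < d /\ b < d.
  have : x <= Num.max b x by rewrite le_max lexx orbT.
  have : b <= Num.max b x by rewrite le_max lexx.
  by rewrite /d => h1 h2; split; lra.
have F0 k y : y < a \/ b < y -> F k y = 0.
  move=> yab; apply: jF.2; rewrite in_itv/=.
  by apply/negP => /andP[ay yb]; case: yab; rewrite ltNge ?ay ?yb.
have Fc k : F k c = 0 by apply: F0; left.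
have Fd k : F k d = 0 by apply: F0; right.
have gE : (\int[lebesgue]_y (g y)%:E = \int[lebesgue]_(y in `[c, d]) (g y)%:E)%E.
  rewrite [RHS]integral_mkcond; apply: eq_integral => y _; rewrite patchE.
  case: ifPn => // /negP; rewrite inE/= => ycd.
  rewrite /g (_ : u y = 0) ?mulr0// /u /bessel_jet !F0 ?subrr//;
  have [ya|ay] := ltP y a; (try by left); have [yb|yb] := ltP b y; (try by right);
  by exfalso; apply: ycd; rewrite in_itv/= (le_trans (ltW ca))// (le_trans yb)// ltW.
have I1 : (\int[lebesgue]_(y in `[c, x]) (g y)%:E = (2^-1 * (F j x - F j.+1 x))%:E)%E.
  (* The derivatives F' cancel in (e^y (F - F'))' = e^y (F - F''). *)
  pose H y := 2^-1 * (expR (y - x) * (F j y - F j.+1 y)).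
  have dH (y : R) : is_derive y 1 H (2^-1 * (expR (y - x) * u y)).
    have d1 : is_derive y 1 (fun y => expR (y - x)) (expR (y - x)).
      have dd : is_derive y 1 (fun y : R => y - x) 1.
        by have := is_deriveB (is_derive_id y 1) (is_derive_cst x y 1); rewrite subr0.
      by have := @is_derive1_comp _ expR (fun y => y - x) y _ _ (is_derive_expR (y - x)) dd; rewrite mulr1.
    have := is_deriveZ 2^-1 (is_deriveM d1 (is_deriveB (jF.1 j y) (jF.1 j.+1 y))).
    rewrite (_ : _ *: _ = 2^-1 * (expR (y - x) * u y))//.
    by rewrite /GRing.scale/= /u /bessel_jet !fctE; ring.
  have cH : continuous H.
    move=> y; apply: differentiable_continuous; apply/derivable1_diffP.
    by have [] := dH y.
  transitivity (\int[lebesgue]_(y in `[c, x]) (2^-1 * (expR (y - x) * u y))%:E)%E.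
    apply: eq_integral => y; rewrite inE/= in_itv/= => /andP[_ yx].
    by rewrite /g ger0_norm ?subr_ge0// opprB mulrA.
  rewrite (@continuous_FTC2 _ _ H)//.
  - rewrite /H subrr expR0 mul1r !Fc subrr !mulr0 -EFinB subr0.
    by [].
  - apply: continuous_subspaceT => y; apply: cvgM; first exact: cvg_cst.
    apply: cvgM; last exact: cu.
    apply: (@continuous_comp _ _ _ (fun y => y - x) expR); last exact: continuous_expR.
    by apply: cvgB; [exact: cvg_id|exact: cvg_cst].
  - split.
    + by move=> y _; have [] := dH y.
    + by apply: cvg_at_right_filter; exact: cH.
    + by apply: cvg_at_left_filter; exact: cH.
  - by move=> y _; rewrite derive1E; have [_] := dH y.
have I2 : (\int[lebesgue]_(y in `[x, d]) (g y)%:E = (2^-1 * (F j x + F j.+1 x))%:E)%E.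
  pose H y := - 2^-1 * (expR (x - y) * (F j y + F j.+1 y)).
  have dH (y : R) : is_derive y 1 H (2^-1 * (expR (x - y) * u y)).
    have d1 : is_derive y 1 (fun y => expR (x - y)) (- expR (x - y)).
      have dd : is_derive y 1 (fun y : R => x - y) (- 1).
        by have := is_deriveB (is_derive_cst x y 1) (is_derive_id y 1); rewrite sub0r.
      by have := @is_derive1_comp _ expR (fun y => x - y) y _ _ (is_derive_expR (x - y)) dd; rewrite mulrN1.
    have := is_deriveZ (- 2^-1) (is_deriveM d1 (is_deriveD (jF.1 j y) (jF.1 j.+1 y))).
    rewrite (_ : _ *: _ = 2^-1 * (expR (x - y) * u y))//.
    by rewrite /GRing.scale/= /u /bessel_jet !fctE; ring.
  have cH : continuous H.
    move=> y; apply: differentiable_continuous; apply/derivable1_diffP.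
    by have [] := dH y.
  transitivity (\int[lebesgue]_(y in `[x, d]) (2^-1 * (expR (x - y) * u y))%:E)%E.
    apply: eq_integral => y; rewrite inE/= in_itv/= => /andP[xy _].
    by rewrite /g distrC ger0_norm ?subr_ge0// opprB mulrA.
  rewrite (@continuous_FTC2 _ _ H)//.
  - rewrite /H subrr expR0 mul1r !Fd addr0 !mulr0 -EFinB sub0r mulNr opprK.
    by [].
  - apply: continuous_subspaceT => y; apply: cvgM; first exact: cvg_cst.
    apply: cvgM; last exact: cu.
    apply: (@continuous_comp _ _ _ (fun y => x - y) expR); last exact: continuous_expR.
    by apply: cvgB; [exact: cvg_cst|exact: cvg_id].
  - split.
    + by move=> y _; have [] := dH y.
    + by apply: cvg_at_right_filter; exact: cH.
    + by apply: cvg_at_left_filter; exact: cH.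
  - by move=> y _; rewrite derive1E; have [_] := dH y.
rewrite /Rintegral gE.
have -> : `[c, d]%classic = `[c, x]%classic `|` `]x, d]%classic :> set R.
  apply/seteqP; split => y /=; rewrite !in_itv/=.
    by move=> /andP[cy yd]; have [yx|xy] := leP y x; [left; rewrite cy|right].
  by move=> [/andP[cy yx]|/andP[xy yd]]; rewrite ?cy ?yd ?andbT /= ?(le_trans yx) ?(ltW xd)// ltW// (lt_trans cx).
rewrite integral_setU//; last 2 first.
- by apply/measurable_EFinP; exact: measurable_funTS.
- rewrite disj_set2E; apply/eqP/seteqP; split => // y [] /=; rewrite !in_itv/=.
  by move=> /andP[_ yx] /andP[xy _]; move: xy; rewrite ltNge yx.
rewrite integral_itv_obnd_cbnd; last by apply/measurable_EFinP; exact: measurable_funTS.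
by rewrite I1 I2 -EFinD /=; field.
Qed.

(** By [bconv_comp], raising the order by one amounts to an inner convolution [bconv 1], which
    undoes one factor 1 - d^2/dx^2. The index k + 1 corresponds to the Bessel order 2(k + 1). *)
Lemma bconv_nat_jet k : exists2 c : R, 0 < c & forall a b F, jet a b F ->
  bconv k.+1%:R (iter k.+1 bessel_jet F 0%N) = fun x => c * F 0%N x.
Proof.
elim: k => [|k [c c0 IH]].
  exists 1 => // a b F jF; rewrite (bconv1_jet 0 jF).
  by apply/funext => x; rewrite mul1r.
have [e e0 he] := @bconv_comp R k.+1%:R 1 (ltr0Sn _ _) ltr01.
exists (e^-1 * c) => [|a b F jF]; first by rewrite mulr_gt0 ?invr_gt0.
have jk := jet_iter k.+1 jF.
have := he _ (jet_bounded_measurable 0 (jet_iter k.+2 jF)).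
rewrite (_ : bconv 1 _ = iter k.+1 bessel_jet F 0%N); last exact: (bconv1_jet 0 jk).
rewrite (IH _ _ _ jF) natr1 => H; apply/funext => x.
have := congr1 (@^~ x) H => /= Hx.
by rewrite -mulrA Hx mulrA mulVf ?mul1r// gt_eqF.
Qed.

(** Take an integer k + 1 > s/2. The preimage is a multiple of the convolution of (1 -
    d^2/dx^2)^(k+1) F with the kernel of the positive order 2(k + 1) - s, since a further
    convolution with the kernel of order s gives back a multiple of F. *)
Lemma jet_bessel_preimage s : 0 < s -> exists k, exists2 C : R, 0 < C &
  forall a b F (M : R), jet a b F -> (forall x, `|iter k bessel_jet F 0%N x| <= M) ->
  exists g : R -> R, [/\ measurable_fun setT g, forall x, `|g x| <= C * M &
    forall x, F 0%N x = Rintegral lebesgue setT (fun y => bessel_kernel s (x - y) * g y)].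
Proof.
move=> s0; have a0 : 0 < s / 2 by rewrite divr_gt0.
pose k := Num.truncn (s / 2).
have ak : s / 2 < k.+1%:R by rewrite truncnS_gt.
have b0 : 0 < k.+1%:R - s / 2 by rewrite subr_gt0.
have [c c0 hc] := bconv_nat_jet k.
have [e e0 he] := bconv_comp a0 b0.
have [G G0 GE] : exists2 G : R, 0 < G & fine (egamma (s / 2)) = G.
  exists (fine (egamma (s / 2))) => //; apply: fine_gt0.
  by rewrite egamma_gt0 egamma_lty.
pose Gb := fine (egamma (k.+1%:R - s / 2) : \bar R).
have Gb0 : 0 < Gb by apply: fine_gt0; rewrite egamma_gt0 egamma_lty.
(* [G] = Gamma(s/2) normalises the Bessel kernel, [e] and [c] come from the two composition laws,
   and [Gb] is the L^1 norm of the second kernel. *)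
exists k.+1, (G / (e * c) * Gb).
  by rewrite mulr_gt0// divr_gt0// mulr_gt0.
move=> a b F M jF hM.
have jk := jet_iter k.+1 jF.
have bk := jet_bounded_measurable 0 jk.
set u := iter k.+1 bessel_jet F 0%N in hM bk *.
have bb := bounded_measurable_bconv b0 bk.
exists (fun x => G / (e * c) * bconv (k.+1%:R - s / 2) u x); split.
- by apply: measurable_funM => //; case: bb.
- move=> x; have q0 : 0 <= G / (e * c) by rewrite divr_ge0 ?mulr_ge0 ?ltW.
  rewrite normrM (ger0_norm q0) -mulrA ler_wpM2l//.
  by apply: bconv_bound => //; case: bk.
move=> x; transitivity ((e * c)^-1 * bconv (s / 2) (bconv (k.+1%:R - s / 2) u) x).
  rewrite he//= addrC subrK (hc _ _ _ jF); field.
  by rewrite !gt_eqF.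
rewrite -RintegralZl//; last exact: integrable_bconv.
apply: eq_Rintegral => y _; rewrite bessel_kernelE GE; field.
by rewrite !gt_eqF.
Qed.

(** The Sobolev norm is an infimum over preimages, so one preimage bounds it. The real and imaginary
    parts are treated separately, whence the factor 2. *)
Lemma sobolev_jet s : 0 < s -> exists k, exists2 C : R, 0 < C &
  forall a b F H (M : R), jet a b F -> jet a b H ->
  (forall x, `|iter k bessel_jet F 0%N x| <= M) ->
  (forall x, `|iter k bessel_jet H 0%N x| <= M) ->
  (sobolev_Loo_norm s (fun x => Complex (F 0%N x) (H 0%N x)) <= (C * M)%:E)%E.
Proof.
move=> s0; have [k [C C0 hC]] := jet_bessel_preimage s0.
exists k, (C * 2); first by rewrite mulr_gt0.
move=> a b F H M jF jH FM HM.
have [g [mg gM gE]] := hC _ _ _ _ jF FM.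
have [h [mh hM hE]] := hC _ _ _ _ jH HM.
pose z y := Complex (g y) (h y).
have zb : (cLnorm lebesgue +oo%E z <= (C * 2 * M)%:E)%E.
  rewrite /cLnorm unlock /Lnorm; case: ifPn => _; last first.
    rewrite lee_fin; have := le_trans (normr_ge0 _) (gM 0); lra.
  apply/ess_supP; apply: nearW => y /=; rewrite lee_fin.
  rewrite ger0_norm ?sqrtr_ge0//=.
  have n1 : Num.sqrt (g y ^+ 2 + h y ^+ 2) <= `|g y| + `|h y|.
    rewrite -(ger0_norm (addr_ge0 (normr_ge0 (g y)) (normr_ge0 (h y)))) -sqrtr_sqr.
    by rewrite ler_wsqrtr// sqrrD !real_normK ?num_real// lerD2r lerDl mulrn_wge0// mulr_ge0.
  have := gM y; have := hM y; lra.
apply: (le_trans _ zb); apply: ereal_inf_lbound; exists z => //; split.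
  split; first by split.
  by rewrite (le_lt_trans zb)// ltry.
apply: aeW => x _.
rewrite /bessel_potential /cintegral gE hE.
by congr Complex; apply: eq_Rintegral => y _ /=; rewrite mul0r ?subr0 ?addr0.
Qed.

End jets.

(** * Hörmander norm of the damped cosine *)

Section multiplier_norm.
Context {R : realType}.
Implicit Types (a b x y t : R) (F P E : nat -> R -> R).

(** The complement of [a, b] is open, so a function vanishing there has vanishing derivatives
    there. *)
Lemma jet_derive1n (f : R -> R) a b : smooth f ->
  (forall x, x \notin `[a, b] -> f x = 0) -> jet a b (fun j => derive1n j f).
Proof.
move=> sf f0.
have df j x : is_derive x 1 (derive1n j f) (derive1n j.+1 f x).
  by rewrite derive1nS derive1E; apply/derivableP/sf.
split=> // j; elim: j => [|j IH] x xab; first exact: f0.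
have oab : open (~` `[a, b]%classic) by apply: closed_openC; exact: itv_closed.
have nz : \forall y \near x, derive1n j f y = cst 0 y.
  have : nbhs x (~` `[a, b]%classic) by apply: open_nbhs_nbhs; split => //; exact/negP.
  by apply: filterS => y /= /negP yab; rewrite IH.
have [_ <-] := df j x.
by rewrite (near_eq_derive _ nz) ?oner_eq0// derive_cst.
Qed.

(** The j-th derivative of the product of [P p] and [E q], expanded as a binary tree with 2^j leaves
    in place of binomial coefficients. *)
Fixpoint leibniz P E (j p q : nat) x : R :=
  if j is j'.+1 then leibniz P E j' p.+1 q x + leibniz P E j' p q.+1 x
  else P p x * E q x.

Lemma jet_leibniz a b P E : jet a b P ->
  (forall j x, is_derive x 1 (E j) (E j.+1 x)) ->
  jet a b (fun j => leibniz P E j 0 0).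
Proof.
move=> [dP sP] dE; split=> j x; last first.
  move=> xab; suff H p q : leibniz P E j p q x = 0 by exact: H.
  elim: j p q => [|j IH] p q /=; first by rewrite sP ?mul0r.
  by rewrite !IH addr0.
suff H p q : is_derive x 1 (leibniz P E j p q) (leibniz P E j.+1 p q x) by exact: H.
elim: j p q => [|j IH] p q.
  have := is_deriveM (dP p x) (dE q x).
  by rewrite (_ : _ + _ = leibniz P E 1 p q x)//= addrC /GRing.scale/= mulrC.
exact: is_deriveD (IH p.+1 q) (IH p q.+1).
Qed.

(** Each of the 2^j leaves is at most A B D^(q+j): at most j derivatives fall on the second factor,
    and D >= 1 allows smaller powers to be raised. *)
Lemma leibniz_bound P E (n j p q : nat) x A B D :
  (forall p, (p <= n)%N -> `|P p x| <= A) -> (forall q, `|E q x| <= B * D ^+ q) ->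
  1 <= D -> 0 <= A -> 0 <= B -> (p + j <= n)%N ->
  `|leibniz P E j p q x| <= 2 ^+ j * (A * (B * D ^+ (q + j))).
Proof.
move=> hP hE D1 A0 B0; have D0 : 0 <= D := le_trans ler01 D1.
elim: j p q => [|j IH] p q /= pn.
  by rewrite mul1r addn0 normrM ler_pM ?hP ?hE// -(addn0 p).
have h1 := IH p.+1 q; have h2 := IH p q.+1.
have {}h1 : `|leibniz P E j p.+1 q x| <= 2 ^+ j * (A * (B * D ^+ (q + j.+1))).
  rewrite (le_trans (h1 _)) ?addSnnS// ler_wpM2l ?exprn_ge0// ler_wpM2l// ler_wpM2l//.
  by rewrite ler_weXn2l// leq_add2l.
have {}h2 : `|leibniz P E j p q.+1 x| <= 2 ^+ j * (A * (B * D ^+ (q + j.+1))).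
  by rewrite (le_trans (h2 _)) ?addSnnS// (leq_trans _ pn)// leq_add2l.
rewrite (le_trans (ler_normD _ _))// exprS; lra.
Qed.

(** Every application of 1 - d^2/dx^2 uses two more derivatives and at most doubles the bound. *)
Lemma iter_bessel_jet_bound F k n x B :
  (forall j, (j <= n + k.*2)%N -> `|F j x| <= B) ->
  forall j, (j <= n)%N -> `|iter k bessel_jet F j x| <= 2 ^+ k * B.
Proof.
elim: k n => [|k IH] n hF j jn; first by rewrite mul1r hF// addn0.
rewrite iterS /bessel_jet (le_trans (ler_normB _ _))//.
have h := IH n.+2; have {}h i : (i <= n.+2)%N -> `|iter k bessel_jet F i x| <= 2 ^+ k * B.
  by apply: h => i' hi; apply: hF; rewrite doubleS !addnS -!addSn.
have := h j (leq_trans jn (leqW (leqnSn n))); have := h j.+2 _; rewrite !ltnS => /(_ jn).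
rewrite exprS; lra.
Qed.

Fixpoint osc_coef (al be : R) (j : nat) : R * R :=
  if j is j'.+1 then
    let: (c, d) := osc_coef al be j' in (- al * c + be * d, - be * c - al * d)
  else (1, 0).

(* the [j]-th derivative of e^(-al x) cos(be x) *)
Definition osc (al be : R) (j : nat) x : R :=
  expR (- (al * x)) *
  ((osc_coef al be j).1 * cos (be * x) + (osc_coef al be j).2 * sin (be * x)).

Lemma is_derive_osc al be j x : is_derive x 1 (osc al be j) (osc al be j.+1 x).
Proof.
have dl (c : R) : is_derive x 1 (fun x => c * x) c.
  by have := is_deriveZ c (is_derive_id x 1); rewrite /GRing.scale/= mulr1.
have de : is_derive x 1 (fun x => expR (- (al * x))) (- al * expR (- (al * x))).
  have := @is_derive1_comp _ expR (fun x => - (al * x)) x _ _ (is_derive_expR _) (is_deriveN (dl al)).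
  by rewrite mulrC.
have dc : is_derive x 1 (fun x => cos (be * x)) (- sin (be * x) * be).
  exact: (@is_derive1_comp _ (@cos R) (fun x => be * x) x _ _ (is_derive_cos _) (dl be)).
have ds : is_derive x 1 (fun x => sin (be * x)) (cos (be * x) * be).
  exact: (@is_derive1_comp _ (@sin R) (fun x => be * x) x _ _ (is_derive_sin _) (dl be)).
have d1 c : is_derive x 1 (fun x => c * cos (be * x)) (c * (- sin (be * x) * be)) := is_deriveZ c dc.
have d2 c : is_derive x 1 (fun x => c * sin (be * x)) (c * (cos (be * x) * be)) := is_deriveZ c ds.
have := is_deriveM de (is_deriveD (d1 (osc_coef al be j).1) (d2 (osc_coef al be j).2)).
rewrite (_ : _ + _ = osc al be j.+1 x)// /osc /=.
case: (osc_coef al be j) => c d /=; rewrite /GRing.scale/= !fctE; ring.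
Qed.

(** One differentiation multiplies the larger of the two coefficients by at most al + be; the
    summand 1 in the base makes it at least 1, as [leibniz_bound] requires. *)
Lemma osc_bound al be j x : 0 <= al -> 0 <= be ->
  `|osc al be j x| <= 2 * expR (- (al * x)) * (1 + al + be) ^+ j.
Proof.
move=> al0 be0; set D := 1 + al + be.
have D0 : 0 <= D by rewrite /D; lra.
have [h1 h2] : `|(osc_coef al be j).1| <= D ^+ j /\ `|(osc_coef al be j).2| <= D ^+ j.
  elim: j => [|j]; first by rewrite /= normr1 normr0.
  rewrite /=; case: (osc_coef al be j) => c d /= [hc hd].
  have Dj : 0 <= D ^+ j by rewrite exprn_ge0.
  have K u v (e1 e2 : R) : `|e1| = al -> `|e2| = be -> `|u| <= D ^+ j -> `|v| <= D ^+ j ->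
      `|e1 * u + e2 * v| <= D ^+ j.+1.
    move=> E1 E2 hu hv; rewrite (le_trans (ler_normD _ _))// !normrM E1 E2 exprS.
    have : al * `|u| <= al * D ^+ j by rewrite ler_wpM2l.
    have : be * `|v| <= be * D ^+ j by rewrite ler_wpM2l.
    have -> : D * D ^+ j = D ^+ j + al * D ^+ j + be * D ^+ j by rewrite {1}/D; ring.
    lra.
  split; first by apply: K => //; rewrite ?normrN ger0_norm.
  by rewrite addrC -mulNr; apply: K => //; rewrite ?normrN ger0_norm.
rewrite /osc normrM ger0_norm ?expR_ge0// -mulrA mulrCA ler_wpM2l ?expR_ge0//.
rewrite (le_trans (ler_normD _ _))// !normrM.
have : `|cos (be * x)| <= 1 by rewrite ler_norml cos_geN1 cos_le1.
have : `|sin (be * x)| <= 1 by rewrite ler_norml sin_geN1 sin_le1.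
move: (normr_ge0 (osc_coef al be j).1) (normr_ge0 (osc_coef al be j).2) => ? ? ? ?.
have : `|(osc_coef al be j).1| * `|cos (be * x)| <= D ^+ j.
  by rewrite (le_trans _ h1)// ler_piMr.
have : `|(osc_coef al be j).2| * `|sin (be * x)| <= D ^+ j.
  by rewrite (le_trans _ h2)// ler_piMr.
lra.
Qed.

Lemma jets_bounded a b P n : jet a b P ->
  exists2 A : R, 0 <= A & forall p x, (p <= n)%N -> `|P p x| <= A.
Proof.
move=> jP; elim: n => [|n [A A0 hA]].
  have [M M0 hM] := jet_bounded 0 jP; exists M => // p x.
  by rewrite leqn0 => /eqP ->.
have [M M0 hM] := jet_bounded n.+1 jP; exists (A + M); first exact: addr_ge0.
move=> p x; rewrite leq_eqVlt => /orP[/eqP ->|pn].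
  by rewrite (le_trans (hM x))// lerDr.
by rewrite (le_trans (hA p x _))// lerDl.
Qed.

(** With de = a/(m+1) one has 1 + al <= (1 + 1/de) e^(de al). The m-th power of the exponential is
    e^(m de al), still below e^(a al). *)
Lemma poly_exp_bound m a : 0 < a -> exists2 K : R, 0 < K &
  forall al : R, 0 <= al -> (1 + al) ^+ m * expR (- (al * a)) <= K.
Proof.
move=> a0; pose de := a / m.+1%:R.
have de0 : 0 < de by rewrite divr_gt0.
pose K := 1 + de^-1; have K0 : 0 < K by rewrite addr_gt0// invr_gt0.
exists (K ^+ m); first by rewrite exprn_gt0.
move=> al al0.
have h : 1 + al <= K * expR (de * al).
  apply: (@le_trans _ _ (K * (1 + de * al))); last first.
    by rewrite ler_wpM2l ?expR_ge1Dx// ltW.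
  rewrite /K mulrDl mul1r mulrDr mulr1 mulKf ?gt_eqF//.
  have := mulr_ge0 (ltW de0) al0; have : 0 <= de^-1 by rewrite invr_ge0 ltW.
  lra.
have : (1 + al) ^+ m <= (K * expR (de * al)) ^+ m.
  by rewrite lerXn2r ?nnegrE ?mulr_ge0 ?expR_ge0 ?(ltW K0)//; lra.
rewrite exprMn -expRM_natl => h1.
apply: (le_trans (ler_wpM2r (expR_ge0 _) h1)).
rewrite -mulrA -expRD ler_piMr ?exprn_ge0 ?(ltW K0)// -[leRHS]expR0 ler_expR.
have -> : m%:R * (de * al) - al * a = - (al * de).
  rewrite [X in _ - al * X](_ : a = de * m.+1%:R); last by rewrite /de divfK.
  by rewrite -natr1; ring.
by rewrite oppr_le0 mulr_ge0// ltW.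
Qed.

Definition oscillating_multiplier (N l : R) : R[i] :=
  (expR (- (N^-1 * l)) * cos (pi * l))%:C%C.

(** The dilate by t has decay rate al = t/N and frequency be = pi t = pi N al, so each derivative
    costs at most 1 + al + be <= (1 + al)(1 + pi N). On the support of [eta] one has x >= a > 0, and
    e^(-al a) absorbs the powers of 1 + al. What remains is a power of 1 + pi N, uniformly in t. *)
Lemma hormander_norm_oscillating (eta : R -> R[i]) s : cutoff eta -> 0 < s ->
  exists k, exists2 C : R, 0 < C & forall N, 0 < N ->
    (hormander_norm eta s (oscillating_multiplier N) <= (C * (1 + pi * N) ^+ k)%:E)%E.
Proof.
move=> [sr si [a [b [a0 sab]]] _] s0.
have [k [C C0 hC]] := @sobolev_jet R s s0.
have jr : jet a b (fun j => derive1n j (fun x => complex.Re (eta x))).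
  by apply: jet_derive1n => // x /sab ->.
have ji : jet a b (fun j => derive1n j (fun x => complex.Im (eta x))).
  by apply: jet_derive1n => // x /sab ->.
have [A A0 hA] := jets_bounded k.*2 jr.
have [B B0 hB] := jets_bounded k.*2 ji.
have [K K0 hK] := poly_exp_bound k.*2 a0.
pose W := 2 ^+ k * (2 ^+ k.*2 * ((A + B) * (2 * K))).
have W0 : 0 <= W by rewrite !mulr_ge0 ?exprn_ge0// ?addr_ge0// ltW.
(* [W] is only known to be nonnegative; adding 1 makes the constant positive. *)
exists k.*2, (C * (W + 1)); first by rewrite mulr_gt0// ltr_wpDl.
move=> N N0; apply: ge_ereal_sup => _ [t /= t0 <-].
pose al := N^-1 * t; pose be := pi * t.
have al0 : 0 <= al by rewrite mulr_ge0 ?invr_ge0 ?ltW.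
have be0 : 0 <= be by rewrite mulr_ge0 ?pi_ge0 ?ltW.
have pN0 : 0 <= pi * N by rewrite mulr_ge0 ?pi_ge0 ?ltW.
have beE : be = pi * N * al by rewrite /al mulrA mulfK// gt_eqF.
pose D := 1 + al + be.
have D1 : 1 <= D by rewrite /D; lra.
have Db P X : jet a b P -> 0 <= X -> X <= A + B -> 
    (forall p x, (p <= k.*2)%N -> `|P p x| <= X) ->
    forall x, `|iter k bessel_jet (fun j => leibniz P (osc al be) j 0 0) 0%N x|
       <= W * (1 + pi * N) ^+ k.*2.
  move=> jP X0 XAB hP x.
  have jL := jet_leibniz jP (fun j x => is_derive_osc al be j x).
  have [xab|xab] := boolP (x \in `[a, b]); last first.
    by rewrite ((jet_iter k jL).2 0%N x xab) normr0 mulr_ge0// exprn_ge0// addr_ge0.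
  have e0 : 0 <= expR (- (al * x)) by exact: expR_ge0.
  apply: (@le_trans _ _ (2 ^+ k * (2 ^+ k.*2 * (X * (2 * expR (- (al * x)) * D ^+ k.*2))))).
    apply: (@iter_bessel_jet_bound _ _ 0%N) => // j; rewrite add0n => jk.
    rewrite (le_trans (leibniz_bound (n := k.*2) (A := X) (B := 2 * expR (- (al * x))) (D := D) 0 _ _ _ _ _ _))//.
    - by move=> p pk; exact: hP.
    - by move=> q; exact: osc_bound.
    - rewrite add0n ler_pM ?exprn_ge0 ?mulr_ge0 ?exprn_ge0 ?(le_trans ler01 D1)//.
        by rewrite ler_weXn2l// ler1n.
      by rewrite ler_wpM2l// ler_wpM2l ?mulr_ge0// ler_weXn2l.
  rewrite /W -!mulrA ler_wpM2l ?exprn_ge0// ler_wpM2l ?exprn_ge0//.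
  rewrite ler_pM// ?mulr_ge0 ?exprn_ge0 ?(le_trans ler01 D1)// ler_wpM2l//.
  have ax : a <= x by move: xab; rewrite in_itv/= => /andP[].
  (* The product (1 + al)(1 + pi N) contains each of the summands 1, al and be = pi N al. *)
  have DE : D ^+ k.*2 <= (1 + al) ^+ k.*2 * (1 + pi * N) ^+ k.*2.
    rewrite -exprMn lerXn2r ?nnegrE ?(le_trans ler01 D1) ?mulr_ge0 ?addr_ge0//.
    by rewrite /D beE; nra.
  apply: (@le_trans _ _ (expR (- (al * a)) * ((1 + al) ^+ k.*2 * (1 + pi * N) ^+ k.*2))).
    rewrite ler_pM ?exprn_ge0 ?(le_trans ler01 D1)//.
    by rewrite ler_expR lerN2 [leRHS]mulrA; apply: (ler_wpM2l al0).
  rewrite mulrA ler_wpM2r ?exprn_ge0 ?addr_ge0// mulrC; exact: hK.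
have := hC _ _ _ _ _ (jet_leibniz jr (fun j x => is_derive_osc al be j x))
  (jet_leibniz ji (fun j x => is_derive_osc al be j x))
  (Db _ A jr A0 _ hA) (Db _ B ji B0 _ hB).
rewrite lerDl lerDr => /(_ B0 A0) H.
rewrite (_ : (fun x => eta x * oscillating_multiplier N (t * x)) = fun x =>
   Complex (leibniz (fun j => derive1n j (fun x => complex.Re (eta x))) (osc al be) 0 0 0 x)
   (leibniz (fun j => derive1n j (fun x => complex.Im (eta x))) (osc al be) 0 0 0 x)); last first.
  apply/funext => x; rewrite /oscillating_multiplier /= /osc /= mul0r addr0 mul1r.
  rewrite /al /be !mulrA; case: (eta x) => u v.
  by apply/eqP; rewrite eq_complex /= !mulr0 subr0 add0r !mulrA !eqxx.
apply: (le_trans H); rewrite lee_fin mulrA ler_wpM2r ?exprn_ge0 ?addr_ge0//.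
by rewrite ler_wpM2l ?lerDl// ltW.
Qed.

End multiplier_norm.

(** * The union of hypercubes and the Walsh transform *)

Section walsh.
Context {R : realType}.
Variable n : nat.
Notation cube := {ffun 'I_n -> bool}.
Implicit Types (x y S : cube) (r : R).

(** Points of the hypercube are stored as bits: [false] is the coordinate 1 and [true] is -1. *)
Definition sg (b : bool) : R := (-1) ^+ b.

(** The Walsh character, the product of the coordinates of x indexed by the set S. Encoding S by
    bits as well makes the formula symmetric in S and x. *)
Definition walsh S x : R := \prod_i (-1) ^+ (S i && x i).

Lemma walshC S x : walsh S x = walsh x S.
Proof. by apply: eq_bigr => i _; rewrite andbC. Qed.

Definition weight_of S : nat := \sum_i S i.

Lemma sum_prod_cube (F : 'I_n -> bool -> R) :
  \sum_(S : cube) \prod_i F i (S i) = \prod_i (F i false + F i true).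
Proof.
rewrite -bigA_distr_bigA; apply: eq_bigr => i _.
by rewrite (bigD1 false)//= (bigD1 true)//= big1 ?addr0//; case.
Qed.

(** The unnormalised kernel of r^A factorises over the coordinates. It is used with r = 1 for
    orthogonality, r = e^(-t) for the semigroup and r = -e^(-1/N) for the oscillating multiplier. *)
Lemma walsh_kernel r x y :
  \sum_S r ^+ weight_of S * (walsh S x * walsh S y) =
  \prod_i (1 + r * (sg (x i) * sg (y i))).
Proof.
transitivity (\sum_(S : cube) \prod_i (r ^+ S i * ((-1) ^+ (S i && x i) * (-1) ^+ (S i && y i)))).
  by apply: eq_bigr => S _; rewrite !big_split/= -expr_sum.
rewrite (sum_prod_cube (fun i b => r ^+ b * ((-1) ^+ (b && x i) * (-1) ^+ (b && y i)))).
by apply: eq_bigr => i _; rewrite /= !mulr1 expr1.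
Qed.

(** The kernel at r = 1: a coordinate in which x and y differ contributes a factor 1 - 1, and all
    the others contribute 2. *)
Lemma walsh_orthogonal x y : \sum_S walsh S x * walsh S y = 2 ^+ n * (x == y)%:R.
Proof.
transitivity (\sum_S 1 ^+ weight_of S * (walsh S x * walsh S y)).
  by apply: eq_bigr => S _; rewrite expr1n mul1r.
rewrite walsh_kernel; have [->|xy] := eqVneq x y.
  rewrite mulr1 (eq_bigr (fun=> 2)) ?prodr_const ?card_ord// => i _.
  by rewrite mul1r /sg; case: (y i); rewrite ?expr0 ?expr1 ?mulrNN mulr1.
have [i xyi] : exists i, x i != y i.
  apply/existsP; apply: contraR xy => /existsPn h; apply/eqP/ffunP => i.
  by apply/eqP; have := h i; rewrite negbK.
rewrite mulr0 (bigD1 i)//= mul1r /sg.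
by move: xyi; case: (x i); case: (y i) => //= _; rewrite ?expr0 ?expr1 ?mulr1 ?mul1r subrr mul0r.
Qed.

Lemma prod_kernel_ge0 r x y : 0 <= r <= 1 -> 0 <= \prod_i ((1 + r * (sg (x i) * sg (y i))) / 2).
Proof.
move=> /andP[r0 r1]; apply: prodr_ge0 => i _.
rewrite divr_ge0// /sg; case: (x i); case: (y i); rewrite ?expr0 ?expr1; lra.
Qed.

(** Product functions are sent to product functions, which makes the action on the weight and on its
    inverse computable one coordinate at a time. *)
Lemma sum_prod_kernel r x (f : 'I_n -> bool -> R) :
  \sum_(y : cube) (\prod_i ((1 + r * (sg (x i) * sg (y i))) / 2)) * (\prod_i f i (y i)) =
  \prod_i ((1 + r * sg (x i)) / 2 * f i false + (1 - r * sg (x i)) / 2 * f i true).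
Proof.
transitivity (\sum_(y : cube) \prod_i ((1 + r * (sg (x i) * sg (y i))) / 2 * f i (y i))).
  by apply: eq_bigr => y _; rewrite -big_split.
rewrite (sum_prod_cube (fun i b => (1 + r * (sg (x i) * sg b)) / 2 * f i b)).
by apply: eq_bigr => i _; rewrite /sg expr0 expr1 mulr1 mulrN1 mulrN.
Qed.

Lemma sum_kernel1 r x : \sum_(y : cube) \prod_i ((1 + r * (sg (x i) * sg (y i))) / 2) = 1.
Proof.
transitivity (\sum_(y : cube) (\prod_i ((1 + r * (sg (x i) * sg (y i))) / 2)) * (\prod_(i < n) 1)).
  by apply: eq_bigr => y _; rewrite [X in _ * X]big1 ?mulr1.
rewrite (sum_prod_kernel r x (fun _ _ => 1)) big1// => i _.
by rewrite !mulr1 -mulrDl; field.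
Qed.

End walsh.

(** Block n is the hypercube of dimension 4n^2, block 0 being a single point. The discrete
    sigma-algebra makes every function measurable. *)
Definition cubes := {n : nat & {ffun 'I_(4 * n * n) -> bool}}.

HB.instance Definition _ := Choice.on cubes.
HB.instance Definition _ := isPointed.Build cubes
  (existT (fun n => {ffun 'I_(4 * n * n) -> bool}) 0%N [ffun => false]).
HB.instance Definition _ := @isMeasurable.Build default_measure_display
  cubes discrete_measurable discrete_measurable0
  discrete_measurableC discrete_measurableU.

Definition pt n x : cubes := existT (fun n => {ffun 'I_(4 * n * n) -> bool}) n x.

Section atomic.
Context {R : realType} d (V : measurableType d).
Variables (c : cubes -> {nonneg R}) (phi : cubes -> V).

Definition atom n i : cubes := pt (nth [ffun => false] (enum {ffun 'I_(4 * n * n) -> bool}) i).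

(** The image under [phi] of the measure with mass [c o] at each point o. The identity gives the
    probability measure on the cubes, and [deg] gives the spectral measures on the line. *)
Definition atomic : {measure set V -> \bar R} :=
  mseries (fun n => msum (fun i => mscale (c (atom n i)) \d_(phi (atom n i)))
    #|{ffun 'I_(4 * n * n) -> bool}|) 0.

Lemma ge0_integral_atomic (g : V -> \bar R) : measurable_fun setT g ->
  (forall v, 0 <= g v)%E ->
  (\int[atomic]_v g v =
   \sum_(n <oo) \sum_(x : {ffun 'I_(4 * n * n) -> bool}) (c (pt x))%:num%:E * g (phi (pt x)))%E.
Proof.
move=> mg g0; rewrite /atomic ge0_integral_measure_series//.
apply: eq_eseriesr => n _; rewrite ge0_integral_measure_sum//.
under eq_bigr do rewrite ge0_integral_mscale// integral_dirac// diracT mul1e.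
rewrite [RHS](_ : _ = \sum_(x <- enum {ffun 'I_(4 * n * n) -> bool})
  (c (pt x))%:num%:E * g (phi (pt x)))%E; last by rewrite big_enum.
rewrite (big_nth [ffun => false]) big_mkord -cardE.
by apply: eq_bigr.
Qed.

Lemma atomic_ge (A : set V) (o : cubes) : measurable A -> A (phi o) ->
  ((c o)%:num%:E <= atomic A)%E.
Proof.
move=> mA Ao; rewrite -(setIT A) -integral_indic// ge0_integral_atomic//; last first.
  by apply/measurable_EFinP; exact: measurable_indic.
case: o Ao => n x Ao.
apply: (@le_trans _ _ (\sum_(y : {ffun 'I_(4 * n * n) -> bool})
    (c (pt y))%:num%:E * (\1_A (phi (pt y)))%:E)%E).
  rewrite (bigD1 x)//= indicE mem_set// mule1 leeDl// sume_ge0//.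
pose u k := (\sum_(y : {ffun 'I_(4 * k * k) -> bool})
    (c (pt y))%:num%:E * (\1_A (phi (pt y)))%:E)%E.
have u0 k : (0 <= u k)%E.
  by apply: sume_ge0 => y _; rewrite mule_ge0// lee_fin.
apply: (@le_trans _ _ (\sum_(0 <= k < n.+1) u k)%E).
  by rewrite big_nat_recr//= leeDr// sume_ge0.
by apply: nneseries_lim_ge => k _ _; exact: u0.
Qed.

End atomic.

Section cube_measure.
Context {R : realType}.
Implicit Types (f g h : cubes -> R).

(** Block n has total mass 2^-(n+1), spread uniformly over its 2^(4n^2) points. *)
Definition block_mass n : R := ((2 ^ n.+1)%:R)^-1 * ((2 ^ (4 * n * n))%:R)^-1.

Lemma block_mass_gt0 n : 0 < block_mass n.
Proof. by rewrite mulr_gt0// invr_gt0 ltr0n expn_gt0. Qed.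

Definition cube_mass (o : cubes) : {nonneg R} := NngNum (ltW (block_mass_gt0 (tag o))).

Definition cube_prob : set cubes -> \bar R := atomic cube_mass (fun o => o).

HB.instance Definition _ := isMeasure.Build _ _ _ cube_prob
  (measure0 (atomic cube_mass (fun o => o)))
  (measure_ge0 (atomic cube_mass (fun o => o)))
  (@measure_semi_sigma_additive _ _ _ (atomic cube_mass (fun o => o))).

Lemma integral_cubes g : (forall o, 0 <= g o) ->
  (\int[cube_prob]_o (g o)%:E =
   \sum_(n <oo) (block_mass n * \sum_x g (@pt n x))%:E)%E.
Proof.
move=> g0; rewrite [LHS](@ge0_integral_atomic R _ cubes cube_mass (fun o => o))//.
apply: eq_eseriesr => n _.
by rewrite mulr_sumr sumEFin.
Qed.

Lemma cube_probT : cube_prob setT = 1%E.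
Proof.
rewrite -(setIT setT) -integral_indic// integral_cubes//.
have := @cvg_geometric_eseries_half R 1 0; rewrite expr0 divr1 => /cvg_lim H.
rewrite -[RHS]H//; apply: congr_lim; apply/funext => k.
apply: eq_bigr => n _; congr (_%:E).
under eq_bigr do rewrite indicT.
rewrite sumr_const card_ffun card_bool card_ord addn1 mul1r /block_mass -mulr_natr mul1r mulfVK//.
Qed.

HB.instance Definition _ := Measure_isProbability.Build _ _ _ cube_prob cube_probT.

(** Mass is constant on each block, so plain finite sums over the blocks decide the comparison. *)
Lemma le_integral_cubes g h : (forall o, 0 <= g o) -> (forall o, 0 <= h o) ->
  (forall n, \sum_x g (@pt n x) <= \sum_x h (@pt n x)) ->
  (\int[cube_prob]_o (g o)%:E <= \int[cube_prob]_o (h o)%:E)%E.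
Proof.
move=> g0 h0 gh; rewrite !integral_cubes//; apply: lee_nneseries => n _ //.
  by rewrite lee_fin mulr_ge0 ?sumr_ge0// ltW// block_mass_gt0.
by rewrite lee_fin ler_wpM2l// ltW// block_mass_gt0.
Qed.

Lemma eq_integral_cubes g h : (forall o, 0 <= g o) -> (forall o, 0 <= h o) ->
  (forall n, \sum_x g (@pt n x) = \sum_x h (@pt n x)) ->
  (\int[cube_prob]_o (g o)%:E = \int[cube_prob]_o (h o)%:E)%E.
Proof.
by move=> g0 h0 gh; apply/eqP; rewrite eq_le !le_integral_cubes// => n; rewrite gh.
Qed.

(** Writing g = g+ - g- and h = h+ - h-, the claim becomes an equality of integrals of the
    nonnegative functions g+ + h- and h+ + g-, to which the blockwise criterion applies. *)
Lemma eq_Rintegral_cubes g h :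
  cube_prob.-integrable setT (EFin \o g) -> cube_prob.-integrable setT (EFin \o h) ->
  (forall n, \sum_x g (@pt n x) = \sum_x h (@pt n x)) ->
  Rintegral cube_prob setT g = Rintegral cube_prob setT h.
Proof.
move=> ig ih gh.
have pn (a : R) : Num.max a 0 - Num.max (- a) 0 = a.
  by rewrite /Num.max; case: ltP => a0; case: ltP => a1; lra.
have i1 f : cube_prob.-integrable setT (EFin \o f) ->
    cube_prob.-integrable setT (EFin \o (fun o => Num.max (f o) 0)).
  move=> iff; apply: le_integrable iff => // o _ /=; rewrite lee_fin ger0_norm ?le_max ?lexx ?orbT//.
  by rewrite ge_max normr_ge0 ler_norm.
have i2 f : cube_prob.-integrable setT (EFin \o f) ->
    cube_prob.-integrable setT (EFin \o (fun o => Num.max (- f o) 0)).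
  move=> iff; apply: le_integrable iff => // o _ /=; rewrite lee_fin ger0_norm ?le_max ?lexx ?orbT//.
  by rewrite ge_max normr_ge0 -normrN ler_norm.
suff : Rintegral cube_prob setT (fun o => Num.max (g o) 0) + Rintegral cube_prob setT (fun o => Num.max (- h o) 0) =
       Rintegral cube_prob setT (fun o => Num.max (h o) 0) + Rintegral cube_prob setT (fun o => Num.max (- g o) 0).
  have E f : cube_prob.-integrable setT (EFin \o f) -> Rintegral cube_prob setT f =
     Rintegral cube_prob setT (fun o => Num.max (f o) 0) - Rintegral cube_prob setT (fun o => Num.max (- f o) 0).
    move=> iff; rewrite -RintegralB//; [|exact: i1|exact: i2].
    by apply: eq_Rintegral => o _; rewrite pn.
  rewrite (E g)// (E h)//; lra.
rewrite -!RintegralD//; [|exact: i1|exact: i2|exact: i1|exact: i2].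
congr fine; apply: eq_integral_cubes.
- by move=> o; rewrite addr_ge0// le_max lexx orbT.
- by move=> o; rewrite addr_ge0// le_max lexx orbT.
move=> n; apply/eqP; rewrite -subr_eq0 -sumrB.
rewrite (eq_bigr (fun x => g (pt x) - h (pt x))) ?sumrB ?gh ?subrr// => x _.
by have := pn (g (pt x)); have := pn (h (pt x)); lra.
Qed.

Lemma cube_prob_ge o (g : cubes -> R) : (forall o, 0 <= g o) ->
  ((block_mass (tag o) * g o)%:E <= \int[cube_prob]_o (g o)%:E)%E.
Proof.
move=> g0; apply: (@le_trans _ _ (\int[cube_prob]_x (g o * \1_[set o] x)%:E)%E).
  rewrite (_ : (fun x => (g o * \1_[set o] x)%:E) = fun x => ((g o)%:E * (\1_[set o] x)%:E)%E)//.
  rewrite ge0_integralZl_EFin//.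
    by rewrite integral_indic// setIT mulrC EFinM lee_wpmul2l ?lee_fin// (@atomic_ge R _ cubes cube_mass (fun o => o)).
apply: ge0_le_integral => //.
- by move=> x _; rewrite lee_fin mulr_ge0.
- move=> x _; rewrite lee_fin indicE; have [/set_mem/= ->|_] := boolP (x \in [set o]).
    by rewrite mulr1.
  by rewrite mulr0.
Qed.

(** Every point has positive mass, so a null set is empty and almost everywhere statements hold
    everywhere. *)
Lemma ae_cubes (P : cubes -> Prop) : (\forall o \ae cube_prob, P o) -> forall o, P o.
Proof.
move=> [N [mN N0 sN]] o; apply: contrapT => nP.
have : ((block_mass (tag o))%:E <= cube_prob N)%E.
  by apply: (@atomic_ge R _ cubes cube_mass (fun o => o)) => //; exact: sN.
by rewrite N0 lee_fin leNgt block_mass_gt0.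
Qed.

End cube_measure.

Section real_L2.
Context {R : realType}.
Notation mu := (@cube_prob R).
Implicit Types (f g h : cubes -> R).

Definition sqnorm f : \bar R := (\int[mu]_o (f o ^+ 2)%:E)%E.

Definition L2 f := (sqnorm f < +oo)%E.

Lemma sqnorm_ge0 f : (0 <= sqnorm f)%E.
Proof. by apply: integral_ge0 => o _; rewrite lee_fin sqr_ge0. Qed.

Lemma L2_integrable f : L2 f -> mu.-integrable setT (EFin \o (fun o => f o ^+ 2)).
Proof.
move=> ff; apply/integrableP; split=> //.
by under eq_integral do rewrite /= ger0_norm ?sqr_ge0//.
Qed.

Lemma L2M f g : L2 f -> L2 g -> mu.-integrable setT (EFin \o (fun o => f o * g o)).
Proof.
move=> ff gg.
have := integrableD measurableT (L2_integrable ff) (L2_integrable gg).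
apply: le_integrable => // o _; rewrite /= lee_fin.
rewrite [leRHS]ger0_norm ?addr_ge0 ?sqr_ge0// normrM.
rewrite -(real_normK (num_real (f o))) -(real_normK (num_real (g o))).
have := sqr_ge0 (`|f o| - `|g o|); have := mulr_ge0 (normr_ge0 (f o)) (normr_ge0 (g o)).
nra.
Qed.

Lemma sqnorm_le f g : (forall o, f o ^+ 2 <= g o ^+ 2) -> (sqnorm f <= sqnorm g)%E.
Proof.
move=> fg; apply: ge0_le_integral => //.
- by move=> o _; rewrite lee_fin sqr_ge0.
- by move=> o _; rewrite lee_fin fg.
Qed.

Lemma sqnormZ c f : sqnorm (fun o => c * f o) = ((c ^+ 2)%:E * sqnorm f)%E.
Proof.
rewrite /sqnorm -ge0_integralZl_EFin ?sqr_ge0//.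
  by apply: eq_integral => o _; rewrite exprMn EFinM.
by move=> o _; rewrite lee_fin sqr_ge0.
Qed.

Lemma L2Z c f : L2 f -> L2 (fun o => c * f o).
Proof. by move=> ff; rewrite /L2 sqnormZ lte_mul_pinfty// lee_fin sqr_ge0. Qed.

Lemma L2D f g : L2 f -> L2 g -> L2 (fun o => f o + g o).
Proof.
move=> ff gg; rewrite /L2.
apply: (@le_lt_trans _ _ (\int[mu]_o ((2 * f o ^+ 2)%:E + (2 * g o ^+ 2)%:E))%E).
  apply: ge0_le_integral => //.
  - by move=> o _; rewrite lee_fin sqr_ge0.
  - by move=> o _; rewrite lee_fin; have := sqr_ge0 (f o - g o); nra.
have E u : (\int[mu]_o (2 * u o ^+ 2)%:E = 2%:E * sqnorm u)%E.
  rewrite /sqnorm -ge0_integralZl_EFin//.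
  by move=> o _; rewrite lee_fin sqr_ge0.
rewrite ge0_integralD//; last 2 first.
- by move=> o _; rewrite lee_fin mulr_ge0 ?sqr_ge0.
- by move=> o _; rewrite lee_fin mulr_ge0 ?sqr_ge0.
by rewrite !E lte_add_pinfty// lte_mul_pinfty// ?lee_fin.
Qed.

Lemma L2N f : L2 f -> L2 (fun o => - f o).
Proof. by move=> ff; rewrite /L2 /sqnorm; under eq_integral do rewrite sqrrN. Qed.

Lemma L2B f g : L2 f -> L2 g -> L2 (fun o => f o - g o).
Proof. by move=> ff gg; apply: L2D => //; exact: L2N. Qed.

End real_L2.

(** * The Walsh transform as a unitary involution, and multipliers *)

Section walsh_transform.
Context {R : realType}.
Notation mu := (@cube_prob R).
Implicit Types (f g h : cubes -> R) (m : R -> R).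

(** The factor 2^(-2n^2) is the inverse square root of the number of points of the block; it makes
    the transform symmetric, isometric and its own inverse. *)
Definition wt g (o : cubes) : R := let: existT n x := o in
  (2 ^+ (2 * n * n))^-1 * \sum_y walsh x y * g (@pt n y).

Arguments wt : simpl never.

Lemma wtE g n x : wt g (@pt n x) = (2 ^+ (2 * n * n))^-1 * \sum_y walsh x y * g (pt y).
Proof. by []. Qed.

Lemma wtD a f b g : wt (fun o => a * f o + b * g o) = fun o => a * wt f o + b * wt g o.
Proof.
apply/funext => -[n x]; rewrite /wt mulrCA [b * _]mulrCA -mulrDr; congr (_ * _).
by rewrite !mulr_sumr -big_split /=; apply: eq_bigr => y _; ring.
Qed.

Lemma wtZ a f : wt (fun o => a * f o) = fun o => a * wt f o.
Proof.
have := wtD a f 0 f; rewrite (_ : (fun o => a * f o + 0 * f o) = fun o => a * f o).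
  by move=> ->; apply/funext => o; rewrite mul0r addr0.
by apply/funext => o; rewrite mul0r addr0.
Qed.

Lemma wtB f g : wt (fun o => f o - g o) = fun o => wt f o - wt g o.
Proof.
have := wtD 1 f (-1) g; rewrite (_ : (fun o => 1 * f o + -1 * g o) = fun o => f o - g o).
  by move=> ->; apply/funext => o; rewrite mul1r mulN1r.
by apply/funext => o; rewrite mul1r mulN1r.
Qed.

Lemma wt_sym g h n : \sum_x wt g (@pt n x) * h (pt x) = \sum_x g (@pt n x) * wt h (pt x).
Proof.
transitivity (\sum_x \sum_y (2 ^+ (2 * n * n))^-1 * (walsh x y * (g (@pt n y) * h (@pt n x)))).
  apply: eq_bigr => x _; rewrite wtE -mulrA mulr_suml mulr_sumr.
  by apply: eq_bigr => y _; ring.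
rewrite exchange_big; apply: eq_bigr => y _; rewrite wtE mulrCA !mulr_sumr.
by apply: eq_bigr => x _; rewrite walshC; ring.
Qed.

Lemma dim_split n : (4 * n * n)%N = (2 * n * n + 2 * n * n)%N.
Proof. by rewrite -!mulnDl. Qed.

Lemma wtM_kernel (c : cubes -> R) g n x : wt (fun o => c o * wt g o) (@pt n x) =
  \sum_y (2 ^+ (4 * n * n))^-1 *
    (\sum_(S : {ffun 'I_(4 * n * n) -> bool}) c (pt S) * (walsh S x * walsh S y)) * g (pt y).
Proof.
rewrite wtE mulr_sumr.
transitivity (\sum_S \sum_y (2 ^+ (4 * n * n))^-1 * (c (@pt n S) * (walsh S x * walsh S y)) * g (pt y)).
  apply: eq_bigr => S _; rewrite wtE !mulr_sumr; apply: eq_bigr => y _.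
  by rewrite (walshC x) {3}dim_split exprD invfM; ring.
rewrite exchange_big /=; apply: eq_bigr => y _.
by rewrite -mulr_suml mulr_sumr.
Qed.

Lemma wtK g : wt (wt g) = g.
Proof.
apply/funext => -[n x].
transitivity (wt (fun o => 1 * wt g o) (@pt n x)).
  by congr (wt _ _); apply/funext => o; rewrite mul1r.
rewrite wtM_kernel.
have E y : \sum_S 1 * (walsh S x * walsh S y) = 2 ^+ (4 * n * n) * (x == y)%:R :> R.
  by rewrite -walsh_orthogonal; apply: eq_bigr => S _; rewrite mul1r.
under eq_bigr do rewrite E mulKf ?expf_neq0 ?pnatr_eq0//.
rewrite (bigD1 x)//= eqxx mul1r big1 ?addr0// => y.
by rewrite eq_sym => /negbTE ->; rewrite mul0r.
Qed.

Lemma sqnorm_wt g : sqnorm (wt g) = sqnorm g.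
Proof.
apply: eq_integral_cubes => [a|a|n]; [exact: sqr_ge0|exact: sqr_ge0|].
transitivity (\sum_x wt g (@pt n x) * wt g (@pt n x)); first by apply: eq_bigr.
by rewrite wt_sym wtK; apply: eq_bigr.
Qed.

Lemma L2_wt g : L2 (wt g) <-> L2 g.
Proof. by rewrite /L2 sqnorm_wt. Qed.

Lemma Rintegral_wt g h : L2 g -> L2 h ->
  Rintegral mu setT (fun o => wt g o * h o) = Rintegral mu setT (fun o => g o * wt h o).
Proof.
move=> gg hh; apply: eq_Rintegral_cubes; last by move=> n; rewrite wt_sym.
- by apply: L2M => //; exact/L2_wt.
- by apply: L2M => //; exact/L2_wt.
Qed.

Definition deg (o : cubes) : R := (weight_of (tagged o))%:R.

Lemma deg_ge0 o : 0 <= deg o. Proof. by rewrite ler0n. Qed.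

(* m(A): the Walsh transform diagonalises A, with eigenvalue [deg] *)
Definition mult m g := wt (fun o => m (deg o) * wt g o).

Lemma wt_mult m g : wt (mult m g) = fun o => m (deg o) * wt g o.
Proof. exact: wtK. Qed.

Lemma multD m a f b g : mult m (fun o => a * f o + b * g o) = fun o => a * mult m f o + b * mult m g o.
Proof.
rewrite /mult wtD -wtD; congr wt; apply/funext => o; ring.
Qed.

Lemma mult_comp m1 m2 g : mult m1 (mult m2 g) = mult (fun l => m1 l * m2 l) g.
Proof.
by rewrite {1}/mult wt_mult; congr wt; apply/funext => o; rewrite mulrA.
Qed.

Lemma mult1 m g : (forall l : R, 0 <= l -> m l = 1) -> mult m g = g.
Proof.
move=> m1; rewrite -[RHS]wtK /mult; congr wt.
by apply/funext => o; rewrite m1 ?deg_ge0// mul1r.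
Qed.

Lemma sqnorm_mult m g (K : R) : (forall l : R, 0 <= l -> `|m l| <= K) ->
  (sqnorm (mult m g) <= (K ^+ 2)%:E * sqnorm g)%E.
Proof.
move=> mK; rewrite sqnorm_wt -(sqnorm_wt g) -sqnormZ; apply: sqnorm_le => o.
rewrite !exprMn ler_wpM2r ?sqr_ge0// -(real_normK (num_real (m _))).
by rewrite lerXn2r ?nnegrE ?mK ?deg_ge0// (le_trans (normr_ge0 _) (mK _ (deg_ge0 o))).
Qed.

Lemma L2_mult m g (K : R) : (forall l : R, 0 <= l -> `|m l| <= K) -> L2 g -> L2 (mult m g).
Proof.
move=> mK gg; apply: le_lt_trans (sqnorm_mult g mK) _.
by rewrite lte_mul_pinfty// lee_fin sqr_ge0.
Qed.

Lemma Rintegral_mult m g h (K : R) : (forall l : R, 0 <= l -> `|m l| <= K) -> L2 g -> L2 h ->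
  Rintegral mu setT (fun o => mult m g o * h o) =
  Rintegral mu setT (fun o => m (deg o) * (wt g o * wt h o)).
Proof.
move=> mK gg hh; rewrite -[in LHS](wtK h) -Rintegral_wt; last 2 first.
- by apply: (L2_mult (K := K)).
- exact/L2_wt.
by rewrite wt_mult; apply: eq_Rintegral => o _; rewrite mulrA.
Qed.

(** The eigenvalues are natural numbers, so only the values of m there count; when they form a
    geometric sequence, m(A) = r^A has a product kernel. *)
Lemma mult_kernel m (r : R) g n x : (forall k : nat, m k%:R = r ^+ k) ->
  mult m g (@pt n x) =
  \sum_(y : {ffun 'I_(4 * n * n) -> bool})
    (\prod_i ((1 + r * (sg (x i) * sg (y i))) / 2)) * g (pt y).
Proof.
move=> mr; rewrite /mult wtM_kernel; apply: eq_bigr => y _; congr (_ * _).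
rewrite (eq_bigr (fun S => r ^+ weight_of S * (walsh S x * walsh S y))); last first.
  by move=> S _; rewrite -mr.
by rewrite walsh_kernel big_split /= prodr_const card_ord exprVn mulrC.
Qed.

End walsh_transform.

(** * The heat semigroup on complex functions *)

Section complexification.
Context {R : realType}.
Notation mu := (@cube_prob R).
Implicit Types (f g : cubes -> R[i]) (T : (cubes -> R) -> cubes -> R).

Definition real_linear T := forall (a : R) (f : cubes -> R) (b : R) (g : cubes -> R),
  T (fun o => a * f o + b * g o) = fun o => a * T f o + b * T g o.

Definition L2_bound T (K : R) :=
  forall g : cubes -> R, (sqnorm (T g) <= (K ^+ 2)%:E * sqnorm g)%E.

(** Every multiplier involved is real-valued, so each operator is the complexification of a real
    one, acting separately on real and imaginary parts. *)
Definition cplx T f : cubes -> R[i] := fun o =>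
  Complex (T (fun x => complex.Re (f x)) o) (T (fun x => complex.Im (f x)) o).

Definition csqnorm f : \bar R :=
  (sqnorm (fun o => complex.Re (f o)) + sqnorm (fun o => complex.Im (f o)))%E.

Lemma csqnorm_ge0 f : (0 <= csqnorm f)%E.
Proof. by rewrite adde_ge0 ?sqnorm_ge0. Qed.

Lemma normc_sqr (z : R[i]) : Normc.normc z ^+ 2 = complex.Re z ^+ 2 + complex.Im z ^+ 2.
Proof. by case: z => a b; rewrite /= sqr_sqrtr// addr_ge0 ?sqr_ge0. Qed.

Lemma normc_ge0 (z : R[i]) : 0 <= Normc.normc z.
Proof. by case: z => a b; rewrite /= sqrtr_ge0. Qed.

Lemma csqnormE f : csqnorm f = (\int[mu]_o (Normc.normc (f o) ^+ 2)%:E)%E.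
Proof.
rewrite /csqnorm /sqnorm -ge0_integralD//.
- by apply: eq_integral => o _; rewrite normc_sqr EFinD.
- by move=> o _; rewrite lee_fin sqr_ge0.
- by move=> o _; rewrite lee_fin sqr_ge0.
Qed.

Lemma cLnormE (nu : {measure set cubes -> \bar R}) (p : R) f : p != 0 ->
  cLnorm nu p%:E f = ((\int[nu]_o (powR (Normc.normc (f o)) p)%:E) `^ p^-1)%E.
Proof.
move=> p0; rewrite /cLnorm unlock /Lnorm; congr (_ `^ _)%E.
by apply: eq_integral => o _; rewrite /= ger0_norm ?normc_ge0.
Qed.

Lemma cLnorm2E f : cLnorm mu 2%:E f = (csqnorm f `^ 2^-1)%E.
Proof.
rewrite cLnormE ?pnatr_eq0// csqnormE; congr (_ `^ _)%E.
by apply: eq_integral => o _; rewrite powR_mulrn ?normc_ge0.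
Qed.

Lemma csqnorm_lty f : (csqnorm f < +oo)%E <->
  L2 (fun o => complex.Re (f o)) /\ L2 (fun o => complex.Im (f o)).
Proof.
rewrite /csqnorm /L2; split=> [|[h1 h2]]; last by rewrite lte_add_pinfty.
move=> h; split; apply: le_lt_trans h; [rewrite leeDl//|rewrite leeDr//]; exact: sqnorm_ge0.
Qed.

Lemma in_L2P f : in_Lp mu 2%:E f <->
  L2 (fun o => complex.Re (f o)) /\ L2 (fun o => complex.Im (f o)).
Proof.
rewrite -csqnorm_lty; split=> [[_]|h].
  by rewrite cLnorm2E => /lty_poweRy; apply; rewrite invr_eq0 pnatr_eq0.
by split; [split|rewrite cLnorm2E; apply: poweR_lty].
Qed.

Lemma cdotE f g : in_Lp mu 2%:E f -> in_Lp mu 2%:E g ->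
  cdot mu f g = Complex
    (Rintegral mu setT (fun o => complex.Re (f o) * complex.Re (g o)) +
     Rintegral mu setT (fun o => complex.Im (f o) * complex.Im (g o)))
    (Rintegral mu setT (fun o => complex.Im (f o) * complex.Re (g o)) -
     Rintegral mu setT (fun o => complex.Re (f o) * complex.Im (g o))).
Proof.
move=> /in_L2P[f1 f2] /in_L2P[g1 g2].
rewrite /cdot /cintegral -RintegralD//; try exact: L2M.
rewrite -RintegralB//; try exact: L2M.
congr Complex; apply: eq_Rintegral => o _; case: (f o) => a b; case: (g o) => c d /=; ring.
Qed.

Lemma csqnorm_cplx T f (K : R) : 0 <= K -> L2_bound T K ->
  (csqnorm (cplx T f) <= (K ^+ 2)%:E * csqnorm f)%E.
Proof.
by move=> K0 hT; rewrite /csqnorm ge0_muleDr ?sqnorm_ge0// leeD// hT.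
Qed.

Lemma Lp_bounded_cplx (nu : {measure set cubes -> \bar R}) (p : \bar R) T (K : \bar R) :
  (forall P : cubes -> Prop, (\forall o \ae nu, P o) -> forall o, P o) ->
  real_linear T ->
  (K < +oo)%E -> (0 <= K)%E ->
  (forall f, in_Lp nu p f -> (cLnorm nu p (cplx T f) <= K * cLnorm nu p f)%E) ->
  Lp_bounded_by nu p (cplx T) K.
Proof.
move=> aeP linT Koo K0 hK; split.
- move=> f ff; split; first by split.
  apply: le_lt_trans (hK f ff) _; rewrite lte_mul_pinfty ?ge0_fin_numE//.
  by case: ff.
- move=> f g ff gg fg; have -> : f = g by apply/funext => o; exact: (aeP _ fg o I).
  by apply: aeW.
- move=> a f g ff gg; apply: aeW => o _.
  have E1 : (fun x => complex.Re (a * f x + g x)) = fun x =>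
      1 * (complex.Re a * complex.Re (f x) + (- complex.Im a) * complex.Im (f x)) + 1 * complex.Re (g x).
    by apply/funext => x; case: a (f x) (g x) => a1 a2 [b1 b2] [c1 c2] /=; ring.
  have E2 : (fun x => complex.Im (a * f x + g x)) = fun x =>
      1 * (complex.Re a * complex.Im (f x) + complex.Im a * complex.Re (f x)) + 1 * complex.Im (g x).
    by apply/funext => x; case: {E1}a (f x) (g x) => a1 a2 [b1 b2] [c1 c2] /=; ring.
  rewrite /cplx E1 E2 !linT; case: a {E1 E2} => a1 a2 /=.
  by apply/eqP; rewrite eq_complex /=; apply/andP; split; apply/eqP; ring.
- exact: hK.
Qed.

Lemma L2_bounded_cplx T (K : R) : 0 <= K ->
  real_linear T ->
  L2_bound T K ->
  Lp_bounded_by mu 2%:E (cplx T) K%:E.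
Proof.
move=> K0 linT hT; apply: Lp_bounded_cplx => //.
- exact: ae_cubes.
- by rewrite ltry.
move=> f ff; rewrite !cLnorm2E.
have -> : K%:E = ((K ^+ 2)%:E `^ 2^-1)%E.
  by rewrite poweR_EFin powR12_sqrt ?sqr_ge0// sqrtr_sqr ger0_norm.
rewrite -poweRM ?lee_fin ?sqr_ge0 ?csqnorm_ge0//.
apply: gt0_ler_poweR => //.
- by rewrite in_itv/= csqnorm_ge0 leey.
- by rewrite in_itv/= mule_ge0 ?csqnorm_ge0 ?lee_fin ?sqr_ge0 ?leey.
- exact: csqnorm_cplx.
Qed.

Lemma L2_selfadjoint_cplx T (K : R) : 0 <= K ->
  real_linear T ->
  L2_bound T K ->
  (forall g h : cubes -> R, L2 g -> L2 h -> Rintegral mu setT (fun o => T g o * h o) =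
     Rintegral mu setT (fun o => g o * T h o)) ->
  L2_selfadjoint mu (cplx T).
Proof.
move=> K0 linT hT sT f g ff gg.
have [h _ _ _] := L2_bounded_cplx K0 linT hT.
rewrite !cdotE//; try exact: h.
move: ff gg => /in_L2P[f1 f2] /in_L2P[g1 g2].
by rewrite /cplx /= !sT.
Qed.

End complexification.

Section dominated.
Context {R : realType}.
Notation mu := (@cube_prob R).

(** Dominated convergence for the squares, along an arbitrary sequence tending to 0 from the
    right. *)
Lemma sqnorm_cvg0 (phi : R -> cubes -> R) (H : cubes -> R) : L2 H ->
  (forall t o, 0 < t -> `|phi t o| <= `|H o|) ->
  (forall o, phi t o @[t --> (0 : R)^'+] --> (0 : R)) ->
  fine (sqnorm (phi t)) @[t --> (0 : R)^'+] --> (0 : R).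
Proof.
move=> L2H phiH phi0.
have fin t : 0 < t -> L2 (phi t).
  move=> t0; apply: le_lt_trans L2H; apply: sqnorm_le => o.
  rewrite -(real_normK (num_real (phi t o))) -(real_normK (num_real (H o))).
  by rewrite lerXn2r ?nnegrE// phiH.
apply/cvg_at_rightP => u [u0 ucvg].
suff : sqnorm (phi (u n)) @[n --> \oo] --> 0%E by move=> /fine_cvgP[].
suff : sqnorm (phi (u n)) @[n --> \oo] --> (\int[mu]_o 0)%E by rewrite integral0.
apply: (@dominated_cvg _ _ R mu setT measurableT (fun n o => (phi (u n) o ^+ 2)%:E)
  (fun=> 0%E) (fun o => (H o ^+ 2)%:E)) => //.
- move=> o _.
  have := phi0 o => /cvg_at_rightP /(_ u (conj u0 ucvg)) h.
  apply: cvg_EFin; first exact: nearW.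
  rewrite -[X in _ --> X](mulr0 (0 : R)) (_ : fine \o _ = fun n => phi (u n) o * phi (u n) o)//.
  exact: cvgM.
- exact: L2_integrable.
- move=> n o _ /=; rewrite lee_fin ger0_norm ?sqr_ge0//.
  rewrite -(real_normK (num_real (phi _ o))) -(real_normK (num_real (H o))).
  by rewrite lerXn2r ?nnegrE// phiH.
Qed.

Lemma cLnorm2_fine (f : cubes -> R[i]) : in_Lp mu 2%:E f -> cLnorm mu 2%:E f =
  (Num.sqrt (fine (sqnorm (fun o => complex.Re (f o))) + fine (sqnorm (fun o => complex.Im (f o)))))%:E.
Proof.
move=> /in_L2P[f1 f2]; rewrite cLnorm2E /csqnorm -powR12_sqrt ?addr_ge0 ?fine_ge0 ?sqnorm_ge0//.
by rewrite -poweR_EFin EFinD !fineK// ge0_fin_numE ?sqnorm_ge0.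
Qed.

Lemma cLnorm2_cvg0 (F : R -> cubes -> R[i]) : (forall t, 0 < t -> in_Lp mu 2%:E (F t)) ->
  (cLnorm mu 2%:E (F t) @[t --> (0 : R)^'+] --> 0%E) <->
  (fine (sqnorm (fun o => complex.Re (F t o))) @[t --> (0 : R)^'+] --> (0 : R)) /\
  (fine (sqnorm (fun o => complex.Im (F t o))) @[t --> (0 : R)^'+] --> (0 : R)).
Proof.
move=> LF.
pose a t := fine (sqnorm (fun o => complex.Re (F t o))).
pose b t := fine (sqnorm (fun o => complex.Im (F t o))).
have a0 t : 0 <= a t by rewrite fine_ge0 ?sqnorm_ge0.
have b0 t : 0 <= b t by rewrite fine_ge0 ?sqnorm_ge0.
have E : \forall t \near (0 : R)^'+, cLnorm mu 2%:E (F t) = (Num.sqrt (a t + b t))%:E.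
  by near=> t; rewrite cLnorm2_fine//; apply: LF.
split=> [h|[ha hb]].
  have h1 : (Num.sqrt (a t + b t))%:E @[t --> (0 : R)^'+] --> 0%E.
    by apply: cvg_trans h; apply: near_eq_cvg; near=> t; rewrite (near E t).
  have /fine_cvgP[_ h2] := h1.
  have h3 : a t + b t @[t --> (0 : R)^'+] --> (0 : R).
    rewrite -[X in _ --> X](mulr0 (0 : R)).
    apply: cvg_trans (cvgM h2 h2); apply: near_eq_cvg; near=> t.
    by rewrite /= -expr2 sqr_sqrtr// addr_ge0.
  split; apply: (squeeze_cvgr _ (cvg_cst 0) h3); near=> t.
    by rewrite a0/= lerDl.
  by rewrite b0/= lerDr.
have h1 : (Num.sqrt (a t + b t))%:E @[t --> (0 : R)^'+] --> 0%E.
  apply: cvg_EFin; first exact: nearW.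
  rewrite -[X in _ --> X](sqrtr0 R).
  apply: (cvg_comp (fun t => a t + b t) Num.sqrt); last exact: sqrt_continuous.
  by have hab := cvgD ha hb; rewrite addr0 in hab; exact: hab.
by apply: cvg_trans h1; apply: near_eq_cvg; near=> t; rewrite (near E t).
Unshelve. all: by end_near. Qed.

End dominated.

(** * The generator in Walsh coordinates *)

Section generator.
Context {R : realType}.
Notation mu := (@cube_prob R).
Implicit Types (u v : cubes -> R).

Definition heat_mult (t l : R) : R := expR (- t * l).

Lemma heat_mult_bound t l : 0 <= t -> 0 <= l -> `|heat_mult t l| <= 1.
Proof.
move=> t0 l0; rewrite ger0_norm ?expR_ge0// -[leRHS]expR0 ler_expR.
by rewrite mulNr oppr_le0 mulr_ge0.
Qed.

(** Only 1 + u <= e^u is used: u = -tl gives e^(-tl) >= 1 - tl, and u = tl gives e^(-tl) <= 1/(1 +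
    tl) <= 1 - tl + (tl)^2. *)
Lemma difference_quotient_bound (t l : R) : 0 < t -> 0 <= l ->
  0 <= l - t^-1 * (1 - heat_mult t l) <= t * l ^+ 2 /\ 0 <= t^-1 * (1 - heat_mult t l).
Proof.
move=> t0 l0; rewrite /heat_mult; set e := expR _; have tl0 : 0 <= t * l by rewrite mulr_ge0// ltW.
have e1 : 1 - t * l <= e by rewrite -mulNr; exact: expR_ge1Dx.
have e0 : 0 < e by exact: expR_gt0.
have e2 : e * (1 + t * l) <= 1.
  rewrite -[leRHS](_ : e * expR (t * l) = 1); last by rewrite -expRD mulNr addNr expR0.
  by rewrite ler_wpM2l ?expR_ge1Dx// ltW.
have e3 : e <= 1 - t * l + (t * l) ^+ 2 by nra.
have le1 : e <= 1 by nra.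
have -> : l = t^-1 * (t * l) by rewrite mulKf// gt_eqF.
rewrite -mulrBr; have -> : t * (t^-1 * (t * l)) ^+ 2 = t^-1 * (t * l) ^+ 2.
  by field; rewrite gt_eqF.
have ti : 0 <= t^-1 by rewrite invr_ge0 ltW.
by split; [apply/andP; split; [rewrite mulr_ge0//; lra|rewrite ler_wpM2l//; lra]|rewrite mulr_ge0//; lra].
Qed.

Lemma semigroup_cvg u : L2 u ->
  fine (sqnorm (fun o => mult (heat_mult t) u o - u o)) @[t --> (0 : R)^'+] --> (0 : R).
Proof.
move=> Lu.
have E t : sqnorm (fun o => mult (heat_mult t) u o - u o) =
    sqnorm (fun o => (heat_mult t (deg o) - 1) * wt u o).
  rewrite -sqnorm_wt wtB wt_mult; congr sqnorm; apply/funext => o; ring.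
under eq_fun do rewrite E.
apply: (sqnorm_cvg0 (H := wt u)); first exact/L2_wt.
- move=> t o t0; rewrite normrM ler_piMl//.
  have := heat_mult_bound (ltW t0) (deg_ge0 o).
  have := expR_gt0 (- t * deg o); rewrite /heat_mult => h; rewrite (ger0_norm (ltW h)) => h1.
  by rewrite ler_norml; apply/andP; split; lra.
- move=> o; rewrite -[X in _ --> X](mul0r (wt u o)); apply: cvgM; last exact: cvg_cst.
  rewrite -[X in _ --> X](subrr (1 : R)); apply: cvgB; last exact: cvg_cst.
  rewrite /heat_mult -[X in _ --> X]expR0; apply: cvg_at_right_filter.
  apply: (cvg_comp (fun t : R => - t * deg o) expR (G := nbhs (0 : R))); last exact: continuous_expR.
  have : - t * deg o @[t --> (0 : R)] --> - 0 * deg o.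
    by apply: cvgM; [apply: cvgN; exact: cvg_id|exact: cvg_cst].
  by rewrite oppr0 mul0r.
Qed.

Lemma generator_quotient (t : R) u v :
  sqnorm (fun o => t^-1 * (u o - mult (heat_mult t) u o) - v o) =
  sqnorm (fun o => t^-1 * (1 - heat_mult t (deg o)) * wt u o - wt v o).
Proof.
rewrite -sqnorm_wt wtB wtZ wtB wt_mult; congr sqnorm; apply/funext => o; ring.
Qed.

Lemma cvg_difference_quotient (l : R) : 0 <= l ->
  t^-1 * (1 - heat_mult t l) @[t --> (0 : R)^'+] --> l.
Proof.
move=> l0; have lt0 : l - t * l ^+ 2 @[t --> (0 : R)^'+] --> l.
  rewrite -[X in _ --> X]subr0; apply: cvgB; first exact: cvg_cst.
  rewrite -[X in _ --> X](mul0r (l ^+ 2)); apply: cvgM; last exact: cvg_cst.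
  by apply: cvg_at_right_filter; exact: cvg_id.
apply: (squeeze_cvgr _ lt0 (cvg_cst l)); near=> t.
have t0 : 0 < t by [].
have [/andP[h1 h2] _] := difference_quotient_bound t0 l0.
by apply/andP; split; lra.
Unshelve. all: by end_near. Qed.

Lemma L2_generator_quotient (t : R) u v : 0 < t -> L2 u -> L2 v ->
  L2 (fun o => t^-1 * (u o - mult (heat_mult t) u o) - v o).
Proof.
move=> t0 Lu Lv; apply: L2B => //; apply: L2Z; apply: L2B => //.
by apply: (L2_mult (K := 1)) => // l l0; apply: heat_mult_bound => //; exact: ltW.
Qed.

(** Convergence in norm forces convergence at each point, because points have positive mass; this
    identifies v. Conversely, the difference of multipliers is at most [deg], so [wt v] itself is a
    square-integrable majorant for dominated convergence. *)
Lemma generatorP u v : L2 u -> L2 v ->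
  (fine (sqnorm (fun o => t^-1 * (u o - mult (heat_mult t) u o) - v o)) @[t --> (0 : R)^'+] --> (0 : R))
  <-> (forall o, wt v o = deg o * wt u o).
Proof.
move=> Lu Lv; split=> [h o|wv].
  have c1 : t^-1 * (1 - heat_mult t (deg o)) * wt u o - wt v o @[t --> (0 : R)^'+] -->
      deg o * wt u o - wt v o.
    apply: cvgB; last exact: cvg_cst.
    by apply: cvgM; [exact/cvg_difference_quotient/deg_ge0|exact: cvg_cst].
  pose G t := t^-1 * (1 - heat_mult t (deg o)) * wt u o - wt v o.
  have c2 : block_mass (tag o) * G t ^+ 2 @[t --> (0 : R)^'+] --> (0 : R).
    apply: (squeeze_cvgr _ (cvg_cst 0) h); near=> t.
    have t0 : 0 < t by [].
    apply/andP; split; first by rewrite mulr_ge0 ?sqr_ge0// ltW// block_mass_gt0.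
    rewrite -lee_fin fineK; last first.
      by rewrite ge0_fin_numE ?sqnorm_ge0//; exact: L2_generator_quotient.
    rewrite generator_quotient.
    by apply: (@cube_prob_ge R o (fun o => (t^-1 * (1 - heat_mult t (deg o)) * wt u o - wt v o) ^+ 2)) => ?; exact: sqr_ge0.
  have c3 : block_mass (tag o) * G t ^+ 2 @[t --> (0 : R)^'+] -->
      block_mass (tag o) * (deg o * wt u o - wt v o) ^+ 2.
    by apply: cvgM; [exact: cvg_cst|apply: cvgM].
  have /esym/eqP : 0 = block_mass (tag o) * (deg o * wt u o - wt v o) ^+ 2 :> R.
    exact: (cvg_unique _ c2 c3).
  rewrite mulf_eq0 gt_eqF ?block_mass_gt0//=.
  by rewrite sqrf_eq0 subr_eq0 => /eqP.
under eq_fun do rewrite generator_quotient.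
apply: (sqnorm_cvg0 (H := wt v)); first exact/L2_wt.
- move=> t o t0; rewrite wv -mulrBl !normrM ler_wpM2r//.
  have [/andP[h1 h2] h3] := difference_quotient_bound t0 (deg_ge0 o).
  rewrite (ger0_norm (deg_ge0 o)) ler_norml; apply/andP; split; lra.
- move=> o; rewrite -[X in _ --> X](subrr (wt v o)); apply: cvgB; last exact: cvg_cst.
  by rewrite wv; apply: cvgM; [exact/cvg_difference_quotient/deg_ge0|exact: cvg_cst].
Unshelve. all: by end_near. Qed.

End generator.

(** * Spectral measures and functional calculus *)

Section spectral.
Context {R : realType}.
Notation mu := (@cube_prob R).
Implicit Types (f g : cubes -> R[i]) (B : set R).

Definition re f : cubes -> R := fun o => complex.Re (f o).
Definition im f : cubes -> R := fun o => complex.Im (f o).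

(** The squared modulus of the Walsh coefficient of f. Pushing this density forward by the
    eigenvalue [deg] gives the spectral measure of f. *)
Definition energy f (o : cubes) : R := wt (re f) o ^+ 2 + wt (im f) o ^+ 2.

Lemma energy_ge0 f o : 0 <= energy f o.
Proof. by rewrite addr_ge0 ?sqr_ge0. Qed.

Definition spectral_mass f (o : cubes) : {nonneg R} :=
  NngNum (mulr_ge0 (ltW (block_mass_gt0 (tag o))) (energy_ge0 f o)).

Definition spectral_measure f : {measure set R -> \bar R} := atomic (spectral_mass f) deg.

Lemma ge0_integral_spectral f (g : R -> \bar R) : measurable_fun setT g ->
  (forall l, 0 <= g l)%E ->
  (\int[spectral_measure f]_l g l = \int[mu]_o (g (deg o) * (energy f o)%:E))%E.
Proof.
move=> mg g0; rewrite ge0_integral_atomic//.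
rewrite [RHS](@ge0_integral_atomic R _ cubes cube_mass (fun o => o))//; last first.
  by move=> o; rewrite mule_ge0// lee_fin energy_ge0.
apply: eq_eseriesr => n _; apply: eq_bigr => x _.
by rewrite /= EFinM -muleA (muleC (energy _ _)%:E).
Qed.

Lemma Rintegral_spectral f (m : R -> R) : measurable_fun setT m ->
  Rintegral (spectral_measure f) setT m = Rintegral mu setT (fun o => m (deg o) * energy f o).
Proof.
move=> mm; congr fine.
have mM : measurable_fun setT (EFin \o m) by exact/measurable_EFinP.
rewrite integralE [RHS]integralE; congr (_ - _)%E.
  rewrite ge0_integral_spectral//; last exact: measurable_funepos.
  apply: eq_integral => o _; rewrite !funeposE /=.
  by rewrite -!EFin_max -EFinM maxr_pMl ?energy_ge0// mul0r.
rewrite ge0_integral_spectral//; last exact: measurable_funeneg.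
apply: eq_integral => o _; rewrite !funenegE /=.
by rewrite -!EFin_max -EFinM maxr_pMl ?energy_ge0// mul0r mulNr.
Qed.

Lemma multP (m : R -> R) (K : R) : 0 <= K -> (forall l, 0 <= l -> `|m l| <= K) ->
  Lp_bounded_by mu 2%:E (cplx (mult m)) K%:E /\ L2_selfadjoint mu (cplx (mult m)).
Proof.
move=> K0 mK; have lin : real_linear (mult m) by move=> a u b v; exact: multD.
have bd : L2_bound (mult m) K by move=> g; exact: sqnorm_mult.
split; first exact: L2_bounded_cplx.
apply: (L2_selfadjoint_cplx K0 lin bd) => u v Lu Lv.
rewrite (Rintegral_mult mK Lu Lv).
have := Rintegral_mult mK Lv Lu => H.
transitivity (Rintegral mu setT (fun o => mult m v o * u o)).
  by rewrite H; apply: eq_Rintegral => o _; rewrite (mulrC (wt v o)).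
by apply: eq_Rintegral => o _; rewrite mulrC.
Qed.

Lemma cdot_mult f (m : R -> R) (K : R) : measurable_fun setT m -> 0 <= K ->
  (forall l, 0 <= l -> `|m l| <= K) -> in_Lp mu 2%:E f ->
  cdot mu (cplx (mult m) f) f = (Rintegral (spectral_measure f) setT m)%:C%C.
Proof.
move=> mm K0 mK ff; have [[h _ _ _] _] := multP K0 mK.
rewrite cdotE//; last exact: h.
move/in_L2P : ff => [f1 f2].
have L2m u v : L2 u -> L2 v -> mu.-integrable setT (EFin \o (fun o => m (deg o) * (wt u o * wt v o))).
  move=> Lu Lv.
  have -> : (fun o => m (deg o) * (wt u o * wt v o)) = fun o => wt (mult m u) o * wt v o.
    by apply/funext => o; rewrite wt_mult mulrA.
  apply: L2M; last exact/L2_wt.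
  by apply/L2_wt; apply: (L2_mult (K := K)).
rewrite /cplx /= Rintegral_spectral//; congr Complex.
  rewrite !(Rintegral_mult mK)// -RintegralD//; [|exact: L2m|exact: L2m].
  by apply: eq_Rintegral => o _; rewrite /energy /re /im !expr2; ring.
rewrite !(Rintegral_mult mK)//; apply/eqP; rewrite subr_eq0; apply/eqP.
by apply: eq_Rintegral => o _; rewrite (mulrC (wt _ o)).
Qed.

Definition specproj B : (cubes -> R[i]) -> cubes -> R[i] := cplx (mult (\1_B)).

Lemma indic_bound B (l : R) : 0 <= l -> `|\1_B l| <= 1 :> R.
Proof. by move=> _; rewrite indicE; case: (_ \in _); rewrite ?normr1 ?normr0. Qed.

Lemma spectral_measureP f : in_Lp mu 2%:E f -> scalar_spectral_measure mu specproj f (spectral_measure f).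
Proof.
(* A real integral does not detect the value +oo, so finiteness is shown separately: by Parseval,
   the mass of B is at most the squared norm of f. *)
move=> ff B mB; suff fin : (spectral_measure f B < +oo)%E.
  rewrite (cdot_mult _ ler01 (@indic_bound B) ff)//= /Rintegral integral_indic// setIT.
  by rewrite fineK// ge0_fin_numE.
rewrite -(setIT B) -integral_indic// ge0_integral_spectral//; last first.
  exact/measurable_EFinP.
move/in_L2P : ff => [/L2_wt f1 /L2_wt f2].
apply: (@le_lt_trans _ _ (sqnorm (wt (re f)) + sqnorm (wt (im f))))%E; last by rewrite lte_add_pinfty.
rewrite /sqnorm -ge0_integralD//; last 2 first.
- by move=> o _; rewrite lee_fin sqr_ge0.
- by move=> o _; rewrite lee_fin sqr_ge0.
apply: ge0_le_integral => //.
- by move=> o _; rewrite mule_ge0// lee_fin energy_ge0.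
- move=> o _; rewrite -EFinD -EFinM lee_fin -[leRHS]mul1r ler_wpM2r ?energy_ge0//.
Qed.

Lemma spectral_measure_uniq f (nu : {measure set R -> \bar R}) :
  in_Lp mu 2%:E f -> scalar_spectral_measure mu specproj f nu ->
  forall B, measurable B -> nu B = spectral_measure f B.
Proof. by move=> ff h B mB; rewrite h// spectral_measureP. Qed.

Lemma Rintegral_nu f (nu : {measure set R -> \bar R}) (m : R -> R) :
  in_Lp mu 2%:E f -> scalar_spectral_measure mu specproj f nu ->
  Rintegral nu setT m = Rintegral (spectral_measure f) setT m.
Proof.
move=> ff h; congr fine; apply: eq_measure_integral => B mB _.
exact: spectral_measure_uniq.
Qed.

Lemma functional_calculus_mult (m : R -> R[i]) (mr : R -> R) (K : R) :
  (forall l, m l = (mr l)%:C%C) -> measurable_fun setT mr -> 0 <= K ->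
  (forall l, 0 <= l -> `|mr l| <= K) ->
  functional_calculus mu specproj m (cplx (mult mr)).
Proof.
move=> mE mm K0 mK; split; first by exists K; have [] := multP K0 mK.
move=> f nu ff h; rewrite (cdot_mult mm K0 mK ff) -(Rintegral_nu mr ff h).
rewrite /cintegral; congr Complex; first by apply: eq_Rintegral => l _; rewrite mE.
transitivity (Rintegral nu setT (fun=> 0)); first by rewrite Rintegral_cst// mul0r.
by apply: eq_Rintegral => l _; rewrite mE.
Qed.

Lemma projection_valued : projection_valued_measure mu specproj.
Proof.
split.
- by move=> B mB; exact: (multP ler01 (@indic_bound B)).
- move=> f ff; apply: aeW => o _; rewrite /specproj /cplx !mult1.
  + by case: (f o).
  + by move=> l _; rewrite indicT.
  + by move=> l _; rewrite indicT.
- move=> B C f mB mC ff; apply: aeW => o _.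
  rewrite /specproj /cplx /= !mult_comp indicI.
  by congr Complex; congr (mult _ _ _); apply/funext => l.
- by move=> f ff; exists (spectral_measure f); exact: spectral_measureP.
Qed.

Definition heat_semigroup (t : R) : (cubes -> R[i]) -> cubes -> R[i] := cplx (mult (heat_mult t)).

Lemma neg_generatorP f g : neg_generator mu heat_semigroup f g <->
  [/\ in_Lp mu 2%:E f, in_Lp mu 2%:E g,
     forall o, wt (re g) o = deg o * wt (re f) o & forall o, wt (im g) o = deg o * wt (im f) o].
Proof.
pose F t o := (t^-1)%:C%C * (f o - heat_semigroup t f o) - g o.
have FE t : (re (F t) = fun o => t^-1 * (re f o - mult (heat_mult t) (re f) o) - re g o) /\
            (im (F t) = fun o => t^-1 * (im f o - mult (heat_mult t) (im f) o) - im g o).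
  by split; apply/funext => o; rewrite /F /re /im /heat_semigroup /cplx;
    case: (g o) => g1 g2; case: (f o) => f1 f2 /=; ring.
have FL t : 0 < t -> in_Lp mu 2%:E f -> in_Lp mu 2%:E g -> in_Lp mu 2%:E (F t).
  move=> t0 /in_L2P[f1 f2] /in_L2P[g1 g2]; apply/in_L2P; have [E1 E2] := FE t.
  by split; [move: E1|move: E2]; rewrite /re /im => ->; apply: L2_generator_quotient.
have C : in_Lp mu 2%:E f -> in_Lp mu 2%:E g ->
    (cLnorm mu 2%:E (F t) @[t --> (0 : R)^'+] --> 0%E) <->
    (forall o, wt (re g) o = deg o * wt (re f) o) /\ (forall o, wt (im g) o = deg o * wt (im f) o).
  move=> ff gg; have := @cLnorm2_cvg0 R F (fun t t0 => FL t t0 ff gg).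
  move/in_L2P : (ff) => [f1 f2]; move/in_L2P : (gg) => [g1 g2].
  have H1 := generatorP f1 g1; have H2 := generatorP f2 g2.
  have E1 : (fun t => fine (sqnorm (fun o => complex.Re (F t o)))) =
     fun t => fine (sqnorm (fun o => t^-1 * (re f o - mult (heat_mult t) (re f) o) - re g o)).
    by apply/funext => t; have [<- _] := FE t.
  have E2 : (fun t => fine (sqnorm (fun o => complex.Im (F t o)))) =
     fun t => fine (sqnorm (fun o => t^-1 * (im f o - mult (heat_mult t) (im f) o) - im g o)).
    by apply/funext => t; have [_ <-] := FE t.
  rewrite E1 E2 => ->.
  by split=> -[/H1 h1 /H2 h2].
split=> [[ff gg h]|[ff gg h1 h2]]; last by split=> //; apply/(C ff gg).
by have [h1 h2] := (C ff gg).1 h; split.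
Qed.

Lemma heat_spectral_resolution : spectral_resolution mu (neg_generator mu heat_semigroup) specproj.
Proof.
split; first exact: projection_valued.
move=> f nu ff hnu.
have nuE : (\int[nu]_l (l ^+ 2)%:E = \int[mu]_o ((deg o * wt (re f) o) ^+ 2)%:E +
    \int[mu]_o ((deg o * wt (im f) o) ^+ 2)%:E)%E.
  rewrite (@eq_measure_integral _ _ _ _ (spectral_measure f)); last first.
    by move=> B mB _; exact: spectral_measure_uniq.
  rewrite ge0_integral_spectral//; last 2 first.
  - by apply/measurable_EFinP; exact: exprn_measurable.
  - by move=> l; rewrite lee_fin sqr_ge0.
  rewrite -ge0_integralD//; last 2 first.
  - by move=> o _; rewrite lee_fin sqr_ge0.
  - by move=> o _; rewrite lee_fin sqr_ge0.
  by apply: eq_integral => o _; rewrite -EFinM -EFinD /energy !exprMn mulrDr.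
split; first split.
- move=> [g /neg_generatorP[_ /in_L2P[/L2_wt g1 /L2_wt g2] h1 h2]].
  rewrite nuE lte_add_pinfty//.
    by under eq_integral do rewrite -h1.
  by under eq_integral do rewrite -h2.
- rewrite nuE => h.
  have s0 (u : cubes -> R) : (0 <= \int[mu]_o ((u o) ^+ 2)%:E)%E.
    by apply: integral_ge0 => o _; rewrite lee_fin sqr_ge0.
  (* The function with Walsh coefficients [deg] times those of f, the only candidate for A f;
     finiteness of the second moment says that it is square integrable. *)
  exists (fun o => Complex (wt (fun o => deg o * wt (re f) o) o) (wt (fun o => deg o * wt (im f) o) o)).
  apply/neg_generatorP; split=> //; [|by move=> o; rewrite /re wtK|by move=> o; rewrite /im wtK].
  apply/in_L2P; split; apply/L2_wt; apply: le_lt_trans h; rewrite /sqnorm.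
    by rewrite leeDl// s0.
  by rewrite leeDr// s0.
move=> g /neg_generatorP[_ gg h1 h2].
rewrite cdotE// /cintegral /= !(Rintegral_nu _ ff hnu) !Rintegral_spectral//.
move/in_L2P : ff => [f1 f2]; move/in_L2P : gg => [g1 g2].
have W u v : L2 u -> L2 v -> Rintegral mu setT (fun o => u o * v o) =
    Rintegral mu setT (fun o => wt u o * wt v o).
  move=> Lu Lv; rewrite -[in LHS](wtK u) Rintegral_wt//; exact/L2_wt.
congr Complex.
  rewrite (W _ _ g1 f1) (W _ _ g2 f2) -RintegralD//; last 2 first.
  - by apply: L2M; exact/L2_wt.
  - by apply: L2M; exact/L2_wt.
  apply: eq_Rintegral => o _; have := h1 o; have := h2 o; rewrite /re /im /energy => -> ->; ring.
rewrite (W _ _ g2 f1) (W _ _ g1 f2) -RintegralB//; last 2 first.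
- by apply: L2M; exact/L2_wt.
- by apply: L2M; exact/L2_wt.
apply: eq_Rintegral => o _; have := h1 o; have := h2 o; rewrite /re /im /= => -> ->; ring.
Qed.

End spectral.

(** * Heat kernel on the cubes and the Markov property *)

Section markov.
Context {R : realType}.
Notation mu := (@cube_prob R).
Implicit Types (f g : cubes -> R[i]).

Lemma normc_sum (I : Type) (s : seq I) (k a b : I -> R) : (forall i, 0 <= k i) ->
  Normc.normc (Complex (\sum_(i <- s) k i * a i) (\sum_(i <- s) k i * b i)) <=
  \sum_(i <- s) k i * Normc.normc (Complex (a i) (b i)).
Proof.
move=> k0; elim: s => [|i s IH]; first by rewrite !big_nil /= expr0n addr0 sqrtr0.
rewrite !big_cons.
have := le_normcD (Complex (k i * a i) (k i * b i) : Rcomplex R)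
  (Complex (\sum_(i <- s) k i * a i) (\sum_(i <- s) k i * b i)).
move=> h; apply: (le_trans h); rewrite lerD//.
by rewrite /= !exprMn -mulrDr sqrtrM ?sqr_ge0// sqrtr_sqr ger0_norm.
Qed.

(** Let A be the mean. Young's inequality bounds a_i A^(r-1) by a_i^r/r + A^r/q; averaging turns the
    left side into A^r, and 1 - 1/q = 1/r gives the claim. *)
Lemma powR_jensen (I : finType) (k a : I -> R) (r : R) : 1 <= r ->
  (forall i, 0 <= k i) -> \sum_i k i = 1 -> (forall i, 0 <= a i) ->
  powR (\sum_i k i * a i) r <= \sum_i k i * powR (a i) r.
Proof.
move=> r1 k0 k1 a0; set A := \sum_i k i * a i.
have A0 : 0 <= A by apply: sumr_ge0 => i _; rewrite mulr_ge0.
move: r1; rewrite le_eqVlt => /predU1P[<-|r1].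
  by rewrite powRr1//; apply: ler_sum => i _; rewrite powRr1.
have r0 : 0 < r by lra.
have rr : 0 < r - 1 by lra.
pose q := r / (r - 1); have q0 : 0 < q by rewrite divr_gt0.
have rq : r^-1 + q^-1 = 1 by rewrite /q; field; rewrite !gt_eqF.
have h i : a i * powR A (r - 1) <= powR (a i) r / r + powR A r / q.
  have := conjugate_powR (a0 i) (powR_ge0 A (r - 1)) r0 q0 rq.
  by rewrite -powRrM (_ : (r - 1) * q = r)// /q; field; rewrite gt_eqF.
have : \sum_i k i * (a i * powR A (r - 1)) <= \sum_i k i * (powR (a i) r / r + powR A r / q).
  by apply: ler_sum => i _; rewrite ler_wpM2l.
have -> : \sum_i k i * (a i * powR A (r - 1)) = powR A r.
  under eq_bigr do rewrite mulrA.
  by rewrite -mulr_suml -/A mulr_powRB1.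
have -> : \sum_i k i * (powR (a i) r / r + powR A r / q) =
   (\sum_i k i * powR (a i) r) / r + powR A r / q.
  under eq_bigr do rewrite mulrDr.
  rewrite big_split /= -[X in _ + X]mulr_suml k1 mul1r; congr (_ + _).
  by rewrite mulr_suml; apply: eq_bigr => i _; rewrite mulrA.
have -> : powR A r / q = powR A r - powR A r / r.
  have -> : q^-1 = 1 - r^-1 by rewrite -rq; ring.
  ring.
move=> H; have {}H : powR A r / r <= (\sum_i k i * powR (a i) r) / r by lra.
by move: H; rewrite ler_pM2r ?invr_gt0.
Qed.

Definition heat_kernel (t : R) n (x y : {ffun 'I_n -> bool}) : R :=
  \prod_i ((1 + expR (- t) * (sg (x i) * sg (y i))) / 2).

Lemma heat_kernel_ge0 t n x y : 0 <= t -> 0 <= @heat_kernel t n x y.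
Proof.
by move=> t0; apply: prod_kernel_ge0; rewrite expR_ge0 /= -[leRHS]expR0 ler_expR oppr_le0.
Qed.

Lemma heat_kernel_sum t n x : \sum_y @heat_kernel t n x y = 1.
Proof. exact: sum_kernel1. Qed.

Lemma heat_kernelC t n x y : @heat_kernel t n x y = heat_kernel t y x.
Proof. by apply: eq_bigr => i _; rewrite (mulrC (sg _)). Qed.

Lemma mult_heat t (u : cubes -> R) n x :
  mult (heat_mult t) u (@pt n x) = \sum_y heat_kernel t x y * u (pt y).
Proof.
by apply: mult_kernel => k; rewrite /heat_mult mulrC expRM_natl.
Qed.

Lemma heat_pointwise t f n x : 0 <= t ->
  Normc.normc (heat_semigroup t f (@pt n x)) <=
  \sum_y heat_kernel t x y * Normc.normc (f (@pt n y)).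
Proof.
move=> t0; rewrite /heat_semigroup /cplx !mult_heat.
apply: (le_trans (normc_sum _ _ _ _)); first by move=> y; exact: heat_kernel_ge0.
by apply: ler_sum => y _; rewrite ler_wpM2l ?heat_kernel_ge0//; case: (f (pt y)).
Qed.

(** The kernel is nonnegative with row sums 1. For finite p, Jensen's inequality is applied at each
    x, and symmetry of the kernel makes the column sums 1 as well; for p = +oo the pointwise average
    is bounded by the supremum. *)
Lemma heat_contraction t (p : \bar R) f : 0 <= t -> (1 <= p)%E -> in_Lp mu p f ->
  (cLnorm mu p (heat_semigroup t f) <= 1 * cLnorm mu p f)%E.
Proof.
move=> t0 p1 ff; rewrite mul1e; case: p p1 ff => [r| |]//.
  rewrite lee_fin => r1 _; have r0 : 0 < r by lra.
  rewrite !cLnormE ?gt_eqF//; apply: gt0_ler_poweR.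
  - by rewrite invr_ge0 ltW.
  - by rewrite in_itv/= leey andbT integral_ge0// => o _; rewrite lee_fin powR_ge0.
  - by rewrite in_itv/= leey andbT integral_ge0// => o _; rewrite lee_fin powR_ge0.
  apply: le_integral_cubes => [a|a|n]; [exact: powR_ge0|exact: powR_ge0|].
  apply: (@le_trans _ _ (\sum_x \sum_y heat_kernel t x y * powR (Normc.normc (f (@pt n y))) r)).
    apply: ler_sum => x _; apply: (le_trans _ (powR_jensen r1 _ _ _)).
    - apply: ge0_ler_powR; rewrite ?nnegrE ?normc_ge0 ?(ltW r0)//.
        by apply: sumr_ge0 => y _; rewrite mulr_ge0 ?heat_kernel_ge0 ?normc_ge0.
      exact: heat_pointwise.
    - by move=> y; exact: heat_kernel_ge0.
    - exact: heat_kernel_sum.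
    - by move=> y; exact: normc_ge0.
  rewrite exchange_big /=; apply: ler_sum => y _; rewrite -mulr_suml.
  by under eq_bigr do rewrite heat_kernelC; rewrite heat_kernel_sum mul1r.
move=> _ [_]; rewrite /cLnorm unlock /Lnorm.
have -> : (0 < mu setT)%E = true by rewrite probability_setT lte_fin ltr01.
set M := ess_sup _ _ => Moo.
have fM o : ((Normc.normc (f o))%:E <= M)%E.
  have := @ess_sup_ge _ _ _ mu (abse \o (fun x => (Normc.normc (f x))%:E)) => /ae_cubes /(_ o) /=.
  by rewrite ger0_norm ?normc_ge0.
(* At any point the bound is at least a nonnegative modulus, which excludes M = -oo. *)
have := fM (@pt 0%N [ffun => false]).
case: M Moo fM => [m _ fM _|//|_ fM]; last by rewrite leeNy_eq.
apply/ess_supP; apply: aeW => -[n x].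
rewrite -/(@pt n x) [(abse \o _) _](_ : _ = (Normc.normc (heat_semigroup t f (pt x)))%:E); last first.
  by rewrite /comp abse_EFin ger0_norm// normc_ge0.
rewrite lee_fin; apply: (le_trans (heat_pointwise f x t0)).
rewrite -[leRHS]mul1r -(heat_kernel_sum t x) mulr_suml; apply: ler_sum => y _.
by rewrite ler_wpM2l ?heat_kernel_ge0// -lee_fin.
Qed.

Lemma heat_c0_semigroup : c0_semigroup mu (@heat_semigroup R).
Proof.
have hb t : 0 <= t -> forall l : R, 0 <= l -> `|heat_mult t l| <= 1.
  by move=> t0 l l0; exact: heat_mult_bound.
split.
- by move=> t t0; exists 1; have [] := multP ler01 (hb t t0).
- move=> f ff; apply: aeW => o _; rewrite /heat_semigroup /cplx !mult1.
  + by case: (f o).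
  + by move=> l _; rewrite /heat_mult oppr0 mul0r expR0.
  + by move=> l _; rewrite /heat_mult oppr0 mul0r expR0.
- move=> s t f s0 t0 ff; apply: aeW => o _.
  rewrite /heat_semigroup /cplx /= !mult_comp.
  have -> : (fun l => heat_mult s l * heat_mult t l) = heat_mult (s + t).
    by apply/funext => l; rewrite /heat_mult -expRD; congr expR; ring.
  by [].
move=> f ff; have /in_L2P[f1 f2] := ff.
pose F t o := heat_semigroup t f o - f o.
have FE t : (fun o => complex.Re (F t o)) = (fun o => mult (heat_mult t) (re f) o - re f o) /\
            (fun o => complex.Im (F t o)) = (fun o => mult (heat_mult t) (im f) o - im f o).
  by split; apply/funext => o; rewrite /F /re /im /heat_semigroup /cplx; case: (f o) => a b.
have E1 : (fun t => fine (sqnorm (fun o => complex.Re (F t o)))) =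
    fun t => fine (sqnorm (fun o => mult (heat_mult t) (re f) o - re f o)).
  by apply/funext => t; have [-> _] := FE t.
have E2 : (fun t => fine (sqnorm (fun o => complex.Im (F t o)))) =
    fun t => fine (sqnorm (fun o => mult (heat_mult t) (im f) o - im f o)).
  by apply/funext => t; have [_ ->] := FE t.
apply/(cLnorm2_cvg0 (F := F)).
  move=> t t0; apply/in_L2P; have [-> ->] := FE t.
  by split; apply: L2B => //; apply: (L2_mult (K := 1)) => //; exact: hb (ltW t0).
by rewrite E1 E2; split; exact: semigroup_cvg.
Qed.

Lemma heat_markovian : markovian mu (@heat_semigroup R).
Proof.
split; first exact: heat_c0_semigroup.
move=> t t0.
have hb (l : R) : 0 <= l -> `|heat_mult t l| <= 1 by move=> l0; exact: heat_mult_bound.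
split.
- by have [] := multP ler01 hb.
- move=> p p1; exists (heat_semigroup t); last by move=> f _ _; exact: aeW.
  apply: Lp_bounded_cplx => //.
  + exact: ae_cubes.
  + by move=> a u b v; exact: multD.
  + by rewrite ltry.
  + by move=> f ff; exact: heat_contraction.
- move=> f ff /ae_cubes f0; apply: aeW => -[n x].
  have f1 y : 0 <= complex.Re (f (@pt n y)) /\ complex.Im (f (@pt n y)) = 0.
    by have := f0 (@pt n y); rewrite lecE /= => /andP[/eqP -> ->].
  rewrite lecE /heat_semigroup /cplx -/(@pt n x) !mult_heat; apply/andP; split.
    by apply/eqP/big1 => y _; rewrite (f1 y).2 mulr0.
  by apply: sumr_ge0 => y _; rewrite mulr_ge0 ?heat_kernel_ge0// (f1 y).1.
- apply: aeW => -[n x] _; rewrite -/(@pt n x) /heat_semigroup /cplx !mult_heat /=.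
  congr Complex; last by apply: big1 => y _; rewrite mulr0.
  by under eq_bigr do rewrite mulr1; exact: heat_kernel_sum.
Qed.

End markov.

(** * The weight and the lower bound for oscillating multipliers *)

Section cube_weights.
Context {R : realType}.
Notation mu := (@cube_prob R).

(** For n = 0 this is 0, since the inverse of zero is zero, so the weight is 1 on the one-point
    block. For n > 0 it gives 4n^2 eps^2 = 1/4. *)
Definition eps n : R := (4 * n)%:R^-1.

Lemma eps_bound n : 0 <= eps n <= 4^-1.
Proof.
rewrite /eps invr_ge0 ler0n /=; case: n => [|n].
  by rewrite muln0 invr0 invr_ge0.
by rewrite lef_pV2 ?posrE ?ltr0n// ler_nat leq_pmulr.
Qed.

Lemma sg_pm (b : bool) : (sg b == 1 :> R) || (sg b == -1 :> R).
Proof. by case: b; rewrite /sg ?expr0 ?expr1 eqxx ?orbT. Qed.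

Lemma eps_sg_gt0 n b : 0 < 1 + eps n * sg b.
Proof.
have /andP[e0 e1] := eps_bound n.
by have /orP[] := sg_pm b => /eqP ->; lra.
Qed.

Definition cube_weight (o : cubes) : R :=
  let: existT n x := o in \prod_i (1 + eps n * sg (x i)).

Lemma cube_weight_gt0 o : 0 < cube_weight o.
Proof. by case: o => n x; apply: prodr_gt0 => i _; exact: eps_sg_gt0. Qed.

Lemma measurable_cube_weight : measurable_fun setT cube_weight.
Proof. by []. Qed.

Definition cweight : weight cubes R := Weight measurable_cube_weight cube_weight_gt0.

(** The semigroup acts within the finite block of x, on which the truncation is inactive once N
    exceeds the sum of |v| over the block. *)
Lemma extended_action_heat t (v : cubes -> R) n x :
  extended_action (heat_semigroup t) v (@pt n x) =
  (\sum_y heat_kernel t x y * v (pt y))%:E.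
Proof.
apply: lim_near_cst => //; near=> N; congr (_%:E).
rewrite /heat_semigroup /cplx mult_heat; apply: eq_bigr => y _.
rewrite /truncation ifT//.
apply: (@le_trans _ _ (\sum_(z : {ffun 'I_(4 * n * n) -> bool}) `|v (pt z)|)).
  by rewrite (bigD1 y)//= ler_wpDr ?ler_norm// sumr_ge0.
by near: N; exact: nbhs_infty_ger.
Unshelve. all: by end_near. Qed.

Lemma bernoulli (a : R) k : -1 <= a -> 1 + k%:R * a <= (1 + a) ^+ k.
Proof.
move=> a1; elim: k => [|k IH]; first by rewrite mul0r addr0 expr0.
rewrite exprS -natr1; apply: (@le_trans _ _ ((1 + a) * (1 + k%:R * a))).
  have : 0 <= k%:R * a ^+ 2 by rewrite mulr_ge0 ?sqr_ge0.
  by nra.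
by rewrite ler_wpM2l//; lra.
Qed.

(** Both averages factorise, and each coordinate contributes (1 - r^2 eps^2)/(1 - eps^2) whatever
    the sign of x_i. The numerator is at most 1, and Bernoulli's inequality gives (1 - eps^2)^(4n^2)
    >= 1 - 1/4. *)
Lemma heat_weight_product t n x : 0 < t ->
  (\sum_y heat_kernel t x y * cube_weight (@pt n y)) *
  (\sum_y heat_kernel t x y * (cube_weight (@pt n y))^-1) <= 4 / 3.
Proof.
move=> t0; have /andP[e0 e1] := eps_bound n.
have r0 : 0 < expR (- t) by exact: expR_gt0.
have r1 : expR (- t) < 1 by rewrite -[ltRHS]expR0 ltr_expR oppr_lt0.
have -> : \sum_y heat_kernel t x y * (cube_weight (@pt n y))^-1 =
    \sum_y heat_kernel t x y * \prod_i (1 + eps n * sg (y i))^-1.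
  by apply: eq_bigr => y _; rewrite /cube_weight /pt prodfV.
rewrite (sum_prod_kernel (expR (- t)) x (fun i b => 1 + eps n * sg b)).
rewrite (sum_prod_kernel (expR (- t)) x (fun i b => (1 + eps n * sg b)^-1)).
rewrite -big_split /=; set e := eps n in e0 e1 *; set r := expR _ in r0 r1 *.
apply: (@le_trans _ _ (\prod_(i < 4 * n * n) (1 - e ^+ 2)^-1)).
  apply: ler_prod => i _.
  have -> : ((1 + r * sg (x i)) / 2 * (1 + e * sg false) +
     (1 - r * sg (x i)) / 2 * (1 + e * sg true)) *
    ((1 + r * sg (x i)) / 2 * (1 + e * sg false)^-1 +
     (1 - r * sg (x i)) / 2 * (1 + e * sg true)^-1) =
    (1 - (r * e) ^+ 2) * (1 - e ^+ 2)^-1.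
    rewrite /sg expr0 expr1; case: (x i); rewrite ?expr0 ?expr1; field;
      rewrite ?gt_eqF//; nra.
  have i0 : 0 < (1 - e ^+ 2)^-1 by rewrite invr_gt0; nra.
  have re0 : 0 <= r * e by rewrite mulr_ge0// ltW.
  have re1 : r * e <= 1 by nra.
  apply/andP; split; first by rewrite mulr_ge0 ?(ltW i0)//; nra.
  by rewrite ler_piMl ?(ltW i0)//; nra.
rewrite prodr_const card_ord exprVn.
have e21 : -1 <= - e ^+ 2 by nra.
have := bernoulli (4 * n * n) e21.
have : (4 * n * n)%:R * e ^+ 2 <= 4^-1.
  rewrite /e /eps; case: (n) => [|k]; first by rewrite !muln0 mul0r.
  rewrite -(mulnA 4%N) !natrM exprVn expr2.
  have k0 : k.+1%:R != 0 :> R by rewrite pnatr_eq0.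
  by rewrite [leLHS](_ : _ = 4^-1)//; move: k0; set K := k.+1%:R => k0; field.
move=> h1 h2; rewrite -[leRHS]invrK lef_pV2 ?posrE; lra.
Qed.

Lemma heat_Q2 : (Q2_characteristic mu (@heat_semigroup R) cweight < +oo)%E.
Proof.
apply: (@le_lt_trans _ _ (4 / 3)%:E); last by rewrite ltry.
apply: ge_ereal_sup => _ [t /= t0 <-].
apply/ess_supP; apply: aeW => -[n x]; rewrite -/(@pt n x).
by rewrite !extended_action_heat lee_fin heat_weight_product.
Qed.

End cube_weights.

Lemma functional_calculus_heat (R : realType) (t : R) : 0 <= t ->
  functional_calculus (@cube_prob R) (@specproj R) (fun l => (expR (- t * l))%:C%C)
    (heat_semigroup t).
Proof.
move=> t0; apply: (functional_calculus_mult (K := 1)) => //.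
- apply: measurableT_comp => //; exact: mulrl_measurable.
- by move=> l; exact: heat_mult_bound.
Qed.

(** * Testing weighted bounds on point masses *)

Section point_masses.
Context {R : realType}.
Notation mu := (@cube_prob R).
Notation nu := (weighted_measure mu (@cweight R)).

Lemma pt_inj n : injective (@pt n).
Proof. by move=> x y /eqP; rewrite /pt eq_Tagged => /eqP. Qed.

Lemma cube_prob_set1 n x y : mu [set @pt n x] = mu [set @pt n y].
Proof.
have E (z : {ffun 'I_(4 * n * n) -> bool}) : mu [set pt z] = (\int[mu]_o (\1_[set pt z] o)%:E)%E.
  by rewrite integral_indic// setIT.
rewrite !E; apply: eq_integral_cubes => // k.
have [kn|nk] := eqVneq k n; last first.
  have Z (z : {ffun 'I_(4 * n * n) -> bool}) : \sum_u \1_[set pt z] (@pt k u) = 0 :> R.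
    apply: big1 => u _; rewrite indicE memNset// => /(congr1 (@tag _ _))/= kn.
    by rewrite kn eqxx in nk.
  by rewrite !Z.
subst k; have O (z : {ffun 'I_(4 * n * n) -> bool}) : \sum_u \1_[set pt z] (@pt n u) = 1 :> R.
  rewrite (bigD1 z)//= indicE mem_set// big1 ?addr0// => u uz.
  by rewrite indicE memNset// => /pt_inj uz'; rewrite uz' eqxx in uz.
by rewrite !O.
Qed.

Lemma cube_prob_set1_gt0 o : (0 < mu [set o])%E.
Proof.
apply: (@lt_le_trans _ _ (block_mass (tag o))%:E); first by rewrite lte_fin block_mass_gt0.
exact: (@atomic_ge R _ cubes cube_mass (fun o => o)).
Qed.

Lemma weighted_set1 o : nu [set o] = ((cube_weight o)%:E * mu [set o])%E.
Proof.
rewrite /weighted_measure; transitivity (\int[mu]_(x in [set o]) (cube_weight o)%:E)%E.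
  by apply: eq_integral => x /set_mem ->.
by rewrite integral_cst.
Qed.

Definition delta (q : cubes) : cubes -> R[i] := fun o => ((o == q)%:R)%:C%C.

Lemma integral_delta (rho : {measure set cubes -> \bar R}) q :
  (\int[rho]_o (powR (Normc.normc (delta q o)) 2)%:E = rho [set q])%E.
Proof.
rewrite -[X in _ = rho X]setIT -integral_indic//; apply: eq_integral => o _.
rewrite indicE powR_mulrn ?normc_ge0// normc_sqr /=.
rewrite (_ : (o \in [set q]) = (o == q)); last first.
  by apply/idP/eqP => [/set_mem|->]; rewrite ?inE.
by case: (o == q); rewrite ?expr0n ?expr1n addr0.
Qed.

Lemma in_Lp_delta (rho : {measure set cubes -> \bar R}) q : (rho [set q] < +oo)%E ->
  in_Lp rho 2%:E (delta q).
Proof.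
move=> h; split; first by split.
by rewrite cLnormE ?pnatr_eq0// integral_delta; apply: poweR_lty.
Qed.

(** Apply the bound to the point mass at y and keep only the value at x. Both points lie in the same
    block, so their common mass cancels and only the densities remain. *)
Lemma weighted_bound_pointwise n (x y : {ffun 'I_(4 * n * n) -> bool}) S (k : R) K : 0 <= k ->
  (K <= k%:E)%E -> Lp_bounded_by nu 2%:E S K ->
  Normc.normc (S (delta (pt y)) (pt x)) ^+ 2 * cube_weight (pt x) <= k ^+ 2 * cube_weight (@pt n y).
Proof.
move=> k0 Kk [_ _ _ hS].
pose a := fine (mu [set @pt n y]).
have aE : mu [set @pt n y] = a%:E.
  by rewrite fineK// ge0_fin_numE// (le_lt_trans (probability_le1 _ _))// ltry.
have a0 : 0 < a by rewrite -lte_fin -aE cube_prob_set1_gt0.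
have nE z : nu [set @pt n z] = (cube_weight (@pt n z) * a)%:E.
  by rewrite weighted_set1 (cube_prob_set1 z y) aE EFinM.
have dL : in_Lp nu 2%:E (delta (pt y)) by apply: in_Lp_delta; rewrite [ltLHS]nE ltry.
set g := S (delta (pt y)).
have h1 : ((Normc.normc (g (pt x)) ^+ 2 * (cube_weight (pt x) * a))%:E <=
    \int[nu]_o (powR (Normc.normc (g o)) 2)%:E)%E.
  rewrite EFinM -nE -(setIT [set pt x]) -integral_indic// -ge0_integralZl_EFin//; last first.
    exact: sqr_ge0.
  apply: ge0_le_integral => //.
  - by move=> o _; rewrite mule_ge0// lee_fin ?sqr_ge0.
  move=> o _; rewrite powR_mulrn ?normc_ge0// indicE.
  have [/set_mem ->|_] := boolP (o \in [set pt x]); first by rewrite mule1.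
  by rewrite mule0 lee_fin sqr_ge0.
have h2 := hS _ dL; rewrite !cLnormE ?pnatr_eq0// integral_delta in h2.
rewrite [X in (_ <= _ * poweR X _)%E]nE in h2.
have W0 z : 0 <= cube_weight (@pt n z) * a by rewrite mulr_ge0// ltW// cube_weight_gt0.
have L0 : 0 <= Normc.normc (g (pt x)) ^+ 2 * (cube_weight (pt x) * a) by rewrite mulr_ge0 ?sqr_ge0.
have : ((Normc.normc (g (pt x)) ^+ 2 * (cube_weight (pt x) * a))%:E `^ 2^-1 <=
   k%:E * (cube_weight (@pt n y) * a)%:E `^ 2^-1)%E.
  apply: (@le_trans _ _ (K * (cube_weight (@pt n y) * a)%:E `^ 2^-1)%E); last first.
    by apply: lee_wpmul2r => //; exact: poweR_ge0.
  apply: le_trans h2; apply: gt0_ler_poweR => //.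
  - by rewrite in_itv/= lee_fin L0 leey.
  - by rewrite in_itv/= leey andbT integral_ge0// => o _; rewrite lee_fin powR_ge0.
rewrite !poweR_EFin -EFinM lee_fin !powR12_sqrt// => h3.
have : Num.sqrt (Normc.normc (g (pt x)) ^+ 2 * (cube_weight (pt x) * a)) ^+ 2 <=
   (k * Num.sqrt (cube_weight (pt y) * a)) ^+ 2.
  by rewrite lerXn2r ?nnegrE ?mulr_ge0 ?sqrtr_ge0.
by rewrite exprMn !sqr_sqrtr// !mulrA ler_pM2r.
Qed.

End point_masses.

Section oscillating.
Context {R : realType}.
Notation mu := (@cube_prob R).
Implicit Types (N l : R).

(** The real form of [multiplier 1 (oscillating_multiplier N)]. Prescribing the value 1 at the
    origin makes the values at the natural numbers a geometric sequence. *)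
Definition osc_mult N l : R :=
  if 0 < l then expR (- (N^-1 * l)) * cos (pi * l) else 1.

Lemma cos_pi_nat k : cos (pi * k%:R) = (-1) ^+ k :> R.
Proof.
elim: k => [|k IH]; first by rewrite mulr0 cos0 expr0.
by rewrite -natr1 mulrDr mulr1 cosDpi IH exprS mulN1r.
Qed.

Lemma osc_mult_nat N k : osc_mult N k%:R = (- expR (- N^-1)) ^+ k.
Proof.
rewrite /osc_mult ltr0n; case: k => [|k] /=; first by rewrite expr0.
by rewrite cos_pi_nat -mulNr expRM_natr [in RHS]exprNn mulrC.
Qed.

Lemma osc_mult_bound N l : 0 <= N -> 0 <= l -> `|osc_mult N l| <= 1.
Proof.
move=> N0 l0; rewrite /osc_mult; case: ifP => _; last by rewrite normr1.
rewrite normrM ger0_norm ?expR_ge0//; apply: mulr_ile1 => //.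
  by rewrite -[leRHS]expR0 ler_expR oppr_le0 mulr_ge0// invr_ge0.
by rewrite ler_norml cos_geN1 cos_le1.
Qed.

Lemma continuous_osc N : continuous (fun l : R => expR (- (N^-1 * l)) * cos (pi * l)).
Proof.
move=> l; have L (a : R) : {for l, continuous (fun u : R => a * u)}.
  by apply: cvgM; [exact: cvg_cst|exact: cvg_id].
apply: cvgM.
  apply: (continuous_comp (f := fun u : R => - (N^-1 * u)) (g := expR)); last exact: continuous_expR.
  by apply: cvgN; exact: L.
by apply: (continuous_comp (f := fun u : R => pi * u) (g := cos)); [exact: L|exact: continuous_cos].
Qed.

Lemma measurable_osc_mult N : measurable_fun setT (osc_mult N).
Proof.
apply: measurable_fun_ifT => //; first by apply: measurable_fun_ltr.
by apply: continuous_measurable_fun; exact: continuous_osc.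
Qed.

Lemma functional_calculus_osc N : 0 <= N ->
  functional_calculus mu (@specproj R) (multiplier 1 (oscillating_multiplier N))
    (cplx (mult (osc_mult N))).
Proof.
move=> N0; apply: (functional_calculus_mult (K := 1)) => //.
- by move=> l; rewrite /multiplier /osc_mult /oscillating_multiplier; case: ifP.
- exact: measurable_osc_mult.
- by move=> l; exact: osc_mult_bound.
Qed.

Lemma continuous_locally_integrable (f : R -> R) : continuous f ->
  locally_integrable `]0, +oo[ f.
Proof.
move=> cf; split.
- by apply: measurable_funTS; exact: continuous_measurable_fun.
- exact: interval_open.
- move=> K _ cK.
  have := @continuous_compact_integrable R f K cK.
  by move=> /(_ (continuous_subspaceT cf)) /integrableP[].
Qed.

Lemma hormander_class_osc (eta : R -> R[i]) s N : cutoff eta -> 0 < s -> 0 < N ->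
  hormander_class eta s (oscillating_multiplier N).
Proof.
move=> ce s0 N0; split.
- exact/continuous_locally_integrable/continuous_osc.
- by apply: continuous_locally_integrable => x; exact: cvg_cst.
- have [k [C _ hC]] := hormander_norm_oscillating ce s0.
  by apply: le_lt_trans (hC N N0) _; rewrite ltry.
Qed.

Lemma continuous_representative_osc N :
  continuous_representative (oscillating_multiplier N) (oscillating_multiplier N).
Proof.
split; first exact: aeW.
- by move=> x _; exact: continuous_osc.
- by move=> x _; exact: cvg_cst.
Qed.

End oscillating.

Section not_hormander.
Context {R : realType}.
Notation mu := (@cube_prob R).

(** With r = e^(-1/N), the kernel at a pair of antipodes is the product of N factors (1 + r)/2. Each
    is at least r because r <= 1, and r^N = e^(-1). *)
Lemma osc_mult_delta n : (0 < n)%N ->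
  expR (- 1) <= mult (osc_mult (4 * n * n)%:R)
    (fun o => (o == @pt n [ffun => true])%:R) (@pt n [ffun => false]) :> R.
Proof.
move=> n0; set N := (4 * n * n)%N.
have N0 : (0 < N)%N by rewrite !muln_gt0 n0.
rewrite (mult_kernel _ _ (osc_mult_nat N%:R)).
rewrite (bigD1 ([ffun => true] : {ffun 'I_(4 * n * n) -> bool}))//= eqxx mulr1 [X in _ + X]big1; last first.
  move=> y yt; rewrite (_ : (_ == _) = false) ?mulr0//.
  by apply/negP => /eqP /pt_inj /eqP; rewrite (negbTE yt).
set r := expR (- N%:R^-1); have r0 : 0 < r by exact: expR_gt0.
have r1 : r <= 1 by rewrite -[leRHS]expR0 ler_expR oppr_le0 invr_ge0 ler0n.
rewrite addr0 (eq_bigr (fun=> (1 + r) / 2)); last first.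
  by move=> i _; rewrite !ffunE /sg expr0 expr1 mul1r mulrNN mulr1.
rewrite prodr_const card_ord (_ : expR (- 1) = r ^+ N).
  by rewrite lerXn2r ?nnegrE//; lra.
by rewrite -expRM_natr mulNr mulVf// pnatr_eq0 -lt0n.
Qed.

Lemma cube_weight_const n b : cube_weight (@pt n [ffun => b]) = (1 + eps n * sg b) ^+ (4 * n * n) :> R.
Proof.
rewrite /cube_weight /pt (eq_bigr (fun=> 1 + eps n * sg b)) ?prodr_const ?card_ord//.
by move=> i _; rewrite ffunE.
Qed.

(** Let A = (1 + eps)^N and B = (1 - eps)^N be the densities at the two antipodes. The point mass
    test gives e^(-2) A <= k^2 B; multiplying by A and using A B <= 1 yields A <= e k. *)
Lemma weighted_osc_norm n (k : R) K : (0 < n)%N -> 0 <= k -> (K <= k%:E)%E ->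
  extends_to_weighted_L2 mu (@cweight R) (cplx (mult (osc_mult (4 * n * n)%:R))) K ->
  2 ^+ n <= expR 1 * k.
Proof.
move=> n0 k0 Kk [S hS SM]; set N := (4 * n * n)%N in SM *.
have := @weighted_bound_pointwise R n [ffun => false] [ffun => true] _ _ _ k0 Kk hS.
have muoo q : (mu [set q] < +oo)%E.
  by apply: le_lt_trans (probability_le1 _ _) _ => //; rewrite ltry.
have nuoo q : (weighted_measure mu (@cweight R) [set q] < +oo)%E.
  by rewrite weighted_set1 lte_mul_pinfty ?lee_fin ?ltW// cube_weight_gt0.
rewrite (ae_cubes (SM _ (in_Lp_delta (muoo _)) (in_Lp_delta (nuoo _))) _ I).
rewrite normc_sqr !cube_weight_const -/N /sg expr0 expr1 mulr1 mulrN1.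
have := osc_mult_delta n0; rewrite -/N.
set z := mult _ _ _ => hz; set z' := complex.Re _; have -> : z' = z by [].
set e := eps n; set zi := complex.Im _; have /andP[e0 e1] := @eps_bound R n.
rewrite -/e in e0 e1 => H.
set A := (1 + e) ^+ N in H *; set B := (1 - e) ^+ N in H *.
have AB : A * B <= 1.
  rewrite -exprMn -[leRHS](expr1n _ N) lerXn2r ?nnegrE//; nra.
have A0 : 0 < A by rewrite exprn_gt0//; lra.
(* Since N = 4n * n, it suffices that (1 + eps)^(4n) >= 1 + 4n eps = 2. *)
have A2 : 2 ^+ n <= A.
  rewrite /A /N exprM; apply: lerXn2r; rewrite ?nnegrE ?exprn_ge0//; first lra.
  have M : (4 * n)%:R * e = 1.
    by rewrite /e /eps mulfV// pnatr_eq0 -lt0n muln_gt0 n0.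
  by have := bernoulli (4 * n) (le_trans (lerN10 R) e0); rewrite M.
have E0 : 0 < expR (-1) :> R by exact: expR_gt0.
have EE : expR (-1) * expR 1 = 1 :> R by rewrite -expRD addNr expR0.
have : expR (-1) ^+ 2 * A <= k ^+ 2 * B.
  apply: le_trans H; rewrite ler_wpM2r ?(ltW A0)//.
  by rewrite -[leLHS]addr0 lerD ?sqr_ge0// lerXn2r ?nnegrE// ?(ltW E0)// (le_trans (ltW E0)).
move=> H2; have : (expR (-1) * A) ^+ 2 <= k ^+ 2.
  have : expR (-1) ^+ 2 * A * A <= k ^+ 2 * B * A by rewrite ler_wpM2r// ltW.
  rewrite exprMn (expr2 A) mulrA => h; apply: (le_trans h).
  by rewrite -mulrA ler_piMr ?sqr_ge0// mulrC.
rewrite ler_sqr ?nnegrE ?mulr_ge0 ?(ltW A0) ?(ltW E0)// => h.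
apply: (le_trans A2); have := ler_wpM2l (expR_ge0 1) h.
by rewrite mulrA (mulrC (expR 1)) EE mul1r.
Qed.

(** The spare power in (1 + n)^(k+1) <= K 2^n would make 1 + n bounded by D K. *)
Lemma exponential_not_polynomial (D : R) k :
  ~ (forall n, (0 < n)%N -> 2 ^+ n <= D * (1 + n%:R) ^+ k).
Proof.
move=> H; have l0 : 0 < ln 2 :> R by rewrite ln_gt0// ltr1n.
have [K K0 hK] := poly_exp_bound k.+1 l0.
have D0 : 0 <= D.
  have := H 1%N erefl; rewrite expr1 => h.
  have P : 0 < (1 + 1%:R) ^+ k :> R by rewrite exprn_gt0// addr_gt0.
  by rewrite -(pmulr_lge0 D P); lra.
have B n : (0 < n)%N -> 1 + n%:R <= D * K.
  move=> n0; have := hK n%:R (ler0n _ _).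
  rewrite expRN mulrC expRM_natl lnK ?posrE// => h.
  have p0 : 0 < 2 ^+ n :> R by exact: exprn_gt0.
  have : (1 + n%:R) * 2 ^+ n <= D * (1 + n%:R) ^+ k.+1.
    by rewrite exprS mulrCA ler_wpM2l ?addr_ge0// H.
  move=> h2; rewrite -(ler_pM2r p0); apply: (le_trans h2).
  by rewrite -mulrA ler_wpM2l// -ler_pdivrMr// mulrC.
pose n := (Num.truncn `|D * K|).+1.
have := B n isT; have := truncnS_gt `|D * K|; have := ler_norm (D * K).
rewrite -/n; lra.
Qed.

(** The multipliers with N = 4n^2 and m(0) = 1 are tested together: their operator norm is at least
    2^n / e, while a calculus would bound it by a polynomial in n. *)
Lemma not_hormander_calculus (eta : R -> R[i]) s : cutoff eta -> 0 < s ->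
  ~ hormander_calculus mu (@specproj R) (@cweight R) eta s.
Proof.
move=> ce s0 [C C0 hC].
have [k [C1 C10 hC1]] := hormander_norm_oscillating ce s0.
have p0 : 0 < pi :> R by exact: pi_gt0.
pose D := expR 1 * (C * (1 + C1 * (1 + 4 * pi) ^+ k)).
apply: (@exponential_not_polynomial D (k.*2)) => n n0.
set N := (4 * n * n)%:R : R; have N0 : 0 < N by rewrite ltr0n !muln_gt0 n0.
have := hC 1 _ _ _ (hormander_class_osc ce s0 N0) (continuous_representative_osc N)
  (functional_calculus_osc (ltW N0)).
pose q := C * (1 + C1 * (1 + pi * N) ^+ k).
have q0 : 0 <= q.
  by rewrite !(mulr_ge0, addr_ge0)// ?exprn_ge0 ?addr_ge0 ?mulr_ge0 ?ltW.
move=> /(weighted_osc_norm (k := q) n0 q0) h.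
apply: (@le_trans _ _ (expR 1 * q)).
  apply: h; rewrite /q EFinM lee_wpmul2l ?lee_fin ?(ltW C0)// EFinD leeD//.
    by rewrite lee_fin /= expr0n addr0 expr1n sqrtr1.
  exact: hC1.
rewrite /D /q -!mulrA ler_wpM2l ?expR_ge0// ler_wpM2l ?(ltW C0)//.
have n1 : 1 <= 1 + n%:R :> R by rewrite lerDl.
rewrite [leRHS]mulrDl [in leRHS]mul1r lerD//; first by rewrite exprn_ege1.
(* As N = 4n^2, one has 1 + pi N <= (1 + 4 pi)(1 + n)^2, which accounts for the degree 2k. *)
rewrite -mulrA ler_wpM2l ?(ltW C10)// -mul2n exprM -exprMn.
rewrite lerXn2r ?nnegrE ?mulr_ge0 ?exprn_ge0 ?addr_ge0 ?mulr_ge0 ?(ltW p0) ?(ltW N0)//.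
rewrite /N !natrM; have : 0 <= n%:R :> R by [].
by set u : R := n%:R => u0; nra.
Qed.

End not_hormander.

Theorem theorem1p4 (R : realType) (eta : R -> R[i]) (heta : cutoff eta) :
  exists (d : measure_display) (Omega : measurableType d)
    (mu : probability Omega R) (T : R -> (Omega -> R[i]) -> Omega -> R[i])
    (E : set R -> (Omega -> R[i]) -> Omega -> R[i]) (w : weight Omega R),
  [/\ markovian mu T,
      spectral_resolution mu (neg_generator mu T) E,
      forall t : R, 0 <= t ->
        functional_calculus mu E (fun l => (expR (- t * l))%:C%C) (T t),
      (Q2_characteristic mu T w < +oo)%E &
      forall s : R, 0 < s -> ~ hormander_calculus mu E w eta s].
Proof.
exists default_measure_display, cubes, (@cube_prob R), (@heat_semigroup R),
  (@specproj R), (@cweight R); split.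
- exact: heat_markovian.
- exact: heat_spectral_resolution.
- exact: functional_calculus_heat.
- exact: heat_Q2.
- by move=> s; exact: not_hormander_calculus.
Qed.
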